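(* Let $\psi:M^m\to\mathbb R^{n+1}$, $n\ge m$, be a complete, connected self-shrinker (that is, a mean curvature flow soliton with respect to the position vector field with constant $c<0$). Assume that, for some $\mathsf v\in\mathbb S^n$, $$\langle\psi(x),\mathsf v\rangle\to+\infty\quad\text{as }x\to\infty\text{ in }M,$$ and let $$|II|^2\le-c.$$ Then either $\mathbf H\equiv0$, or $|II|^2\equiv-c$ and $\mathbf H$ is parallel (in the normal bundle); consequently, either the immersion is totally geodesic or $\psi(M)$ is a product of the type $\mathbb S^k(\sqrt{-k/c})\times\mathbb R^{m-k}$ for some $1\le k\le m$.
   Context: An isometric immersion $\psi:M^m\to\mathbb R^{n+1}$ is a mean curvature flow soliton with respect to the position field $X(x)=x$ if $c\,X^\perp=\mathbf H$ along $\psi$ for some constant $c\in\mathbb R$, where $\perp$ is projection on the normal bundle, $II$ is the second fundamental form, and $\mathbf H$ is the non-normalized mean curvature vector (the trace of $II$). Complete means that $M$ with the induced metric is complete; $x\to\infty$ means leaving every compact subset of $M$. $\mathbb S^k(r)$ is the round $k$-sphere of radius $r$. *)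

(* Defs.v *)
From HB Require Import structures.
From mathcomp Require Import all_boot all_order all_algebra.
From mathcomp Require Import all_classical all_reals all_analysis.
Set Implicit Arguments.
Unset Strict Implicit.
Unset Printing Implicit Defensive.
Import Order.TTheory GRing.Theory Num.Theory.
Import numFieldNormedType.Exports.
Local Open Scope classical_set_scope.
Local Open Scope ring_scope.

(* The library's norm on row vectors is the sup norm: it gives the usual
   topology and derivatives, but lengths and angles must come from here. *)
Definition edot {R : realType} {n : nat} (x y : 'rV[R]_n) : R :=
  \sum_(i < n) x 0 i * y 0 i.

Definition enorm {R : realType} {n : nat} (x : 'rV[R]_n) : R :=
  Num.sqrt (edot x x).

Definition partial {R : realType} {m : nat} {V : normedModType R}
    (i : 'I_m) (f : 'rV[R]_m -> V) : 'rV[R]_m -> V :=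
  'D_(delta_mx 0 i) f.

(* Meaningful for U open only. *)
Fixpoint Ck {R : realType} {m : nat} {V : normedModType R}
    (k : nat) (U : set 'rV[R]_m) (f : 'rV[R]_m -> V) : Prop :=
  match k with
  | 0%N => forall x, U x -> {for x, continuous f}
  | k'.+1 => (forall x, U x -> differentiable f x) /\
             (forall i : 'I_m, Ck k' U (partial i f))
  end.

Definition smooth_on {R : realType} {m : nat} {V : normedModType R}
    (U : set 'rV[R]_m) (f : 'rV[R]_m -> V) : Prop :=
  forall k : nat, Ck k U f.

Record chart (R : realType) (M : topologicalType) (m : nat) : Type := Chart {
  dom : set M;
  coords : M -> 'rV[R]_m;    (* junk outside [dom] *)
  param : 'rV[R]_m -> M     (* junk outside [coords @` dom] *)
}.

Definition codom_of {R : realType} {M : topologicalType} {m : nat}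
    (e : chart R M m) : set 'rV[R]_m := coords e @` dom e.

Definition is_chart {R : realType} {M : topologicalType} {m : nat}
    (e : chart R M m) : Prop :=
  [/\ open (dom e),
      open (codom_of e),
      (forall x, dom e x -> param e (coords e x) = x),
      (forall x, dom e x -> {for x, continuous (coords e)}) &
      (forall u, codom_of e u -> {for u, continuous (param e)})].

Definition smooth_atlas {R : realType} {M : topologicalType} {m : nat}
    (A : set (chart R M m)) : Prop :=
  [/\ (forall e, A e -> is_chart e),
      (forall x, exists2 e, A e & dom e x) &
      (forall e e', A e -> A e' ->
         smooth_on (coords e @` (dom e `&` dom e')) (coords e' \o param e))].

Definition smooth_manifold {R : realType} {M : topologicalType} {m : nat}
    (A : set (chart R M m)) : Prop :=
  [/\ hausdorff_space M, @second_countable M & smooth_atlas A].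

(* P holds at every point for every local representative psi \o param e. *)
Definition locally_everywhere {R : realType} {M : topologicalType} {m p : nat}
    (A : set (chart R M m)) (psi : M -> 'rV[R]_p)
    (P : ('rV[R]_m -> 'rV[R]_p) -> 'rV[R]_m -> Prop) : Prop :=
  forall e, A e -> forall u, codom_of e u -> P (psi \o param e) u.

Definition immersion {R : realType} {M : topologicalType} {m p : nat}
    (A : set (chart R M m)) (psi : M -> 'rV[R]_p) : Prop :=
  (forall e, A e -> smooth_on (codom_of e) (psi \o param e)) /\
  locally_everywhere A psi (fun F u => row_free ('J F u)).

(* First fundamental form g_ij = <d_i F, d_j F>; the rows of 'J F u are the
   d_i F, since the library's Jacobian acts on row vectors. *)
Definition gram {R : realType} {m p : nat} (F : 'rV[R]_m -> 'rV[R]_p)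
    (u : 'rV[R]_m) : 'M[R]_m :=
  'J F u *m ('J F u)^T.

(* w^perp = w - sum_ij g^ij <w, d_i F> d_j F *)
Definition normal_proj {R : realType} {m p : nat} (F : 'rV[R]_m -> 'rV[R]_p)
    (u : 'rV[R]_m) (w : 'rV[R]_p) : 'rV[R]_p :=
  w - w *m ('J F u)^T *m invmx (gram F u) *m 'J F u.

Definition second_ff {R : realType} {m p : nat} (F : 'rV[R]_m -> 'rV[R]_p)
    (u : 'rV[R]_m) (i j : 'I_m) : 'rV[R]_p :=
  normal_proj F u (partial i (partial j F) u).

Definition mean_curvature {R : realType} {m p : nat}
    (F : 'rV[R]_m -> 'rV[R]_p) (u : 'rV[R]_m) : 'rV[R]_p :=
  \sum_(i < m) \sum_(j < m) invmx (gram F u) i j *: second_ff F u i j.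

(* |II|^2 = g^ik g^jl <II_ij, II_kl> *)
Definition second_ff_sqnorm {R : realType} {m p : nat}
    (F : 'rV[R]_m -> 'rV[R]_p) (u : 'rV[R]_m) : R :=
  \sum_(i < m) \sum_(j < m) \sum_(k < m) \sum_(l < m)
    invmx (gram F u) i k * invmx (gram F u) j l *
    edot (second_ff F u i j) (second_ff F u k l).

Definition normal_derivative {R : realType} {m p : nat}
    (F N : 'rV[R]_m -> 'rV[R]_p) (u : 'rV[R]_m) (i : 'I_m) : 'rV[R]_p :=
  normal_proj F u (partial i N u).

Definition soliton {R : realType} {M : topologicalType} {m p : nat}
    (A : set (chart R M m)) (psi : M -> 'rV[R]_p) (c : R) : Prop :=
  locally_everywhere A psi
    (fun F u => c *: normal_proj F u (F u) = mean_curvature F u).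

Definition minimal {R : realType} {M : topologicalType} {m p : nat}
    (A : set (chart R M m)) (psi : M -> 'rV[R]_p) : Prop :=
  locally_everywhere A psi (fun F u => mean_curvature F u = 0).

Definition parallel_mean_curvature {R : realType} {M : topologicalType}
    {m p : nat} (A : set (chart R M m)) (psi : M -> 'rV[R]_p) : Prop :=
  locally_everywhere A psi
    (fun F u => forall i, normal_derivative F (mean_curvature F) u i = 0).

Definition totally_geodesic {R : realType} {M : topologicalType} {m p : nat}
    (A : set (chart R M m)) (psi : M -> 'rV[R]_p) : Prop :=
  locally_everywhere A psi (fun F u => forall i j, second_ff F u i j = 0).

Definition C1_at {R : realType} {M : topologicalType} {m : nat}
    (A : set (chart R M m)) (g : R -> M) (t : R) : Prop :=
  {for t, continuous g} /\
  forall e, A e -> dom e (g t) ->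
    (\forall s \near t, derivable (coords e \o g) s 1) /\
    {for t, continuous (derive1 (coords e \o g))}.

(* As psi is isometric, the speed of g is the Euclidean speed of psi \o g. *)
Definition curve_length {R : realType} {M : topologicalType} {p : nat}
    (psi : M -> 'rV[R]_p) (g : R -> M) : \bar R :=
  (\int[@lebesgue_measure R]_(t in `[0%R, 1%R]) (enorm (derive1 (psi \o g) t))%:E)%E.

(* [joined A psi x y L]: some piecewise C^1 curve from x to y has length L.
   Each piece is C^1 on a neighbourhood of [0, 1], i.e. up to the endpoints. *)
Inductive joined {R : realType} {M : topologicalType} {m p : nat}
    (A : set (chart R M m)) (psi : M -> 'rV[R]_p) :
    M -> M -> \bar R -> Prop :=
| joined_refl x : joined A psi x x 0%E
| joined_cons g y L :
    (forall t, t \in `[0, 1]%R -> C1_at A g t) ->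
    joined A psi (g 1) y L ->
    joined A psi (g 0) y (curve_length psi g + L)%E.

Definition riemannian_dist {R : realType} {M : topologicalType} {m p : nat}
    (A : set (chart R M m)) (psi : M -> 'rV[R]_p) (x y : M) : \bar R :=
  ereal_inf [set L | joined A psi x y L].

Definition complete_induced {R : realType} {M : topologicalType} {m p : nat}
    (A : set (chart R M m)) (psi : M -> 'rV[R]_p) : Prop :=
  forall s : nat -> M,
    (forall eps : R, 0 < eps -> exists N : nat, forall i j : nat,
       (N <= i)%N -> (N <= j)%N ->
       (riemannian_dist A psi (s i) (s j) < eps%:E)%E) ->
    exists x : M, riemannian_dist A psi (s i) x @[i --> \oo] --> 0%E.

(* The filter of x -> oo in M; it is improper (so limits along it are vacuous)
   when M is compact. *)
Definition at_infinity (M : topologicalType) : set_system M :=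
  [set U | exists2 K : set M, compact K & ~` K `<=` U].
Arguments at_infinity : clear implicits.

(* S^k(r) x R^(m-k) x {0} inside R^p = R^(k+1) x R^(m-k) x R^(p-m-1), centred
   at the origin; the intended range is k <= m < p. *)
Definition sphere_product {R : realType} {p : nat} (k m : nat) (r : R) :
    set 'rV[R]_p :=
  [set x | Num.sqrt (\sum_(i < p | (i <= k)%N) x 0 i ^+ 2) = r /\
           (forall i : 'I_p, (m < i)%N -> x 0 i = 0)].

Definition is_sphere_product {R : realType} {p : nat} (k m : nat) (r : R)
    (S : set 'rV[R]_p) : Prop :=
  exists2 Q : 'M[R]_p, Q *m Q^T = 1%:M &
    S = (fun x => x *m Q) @` sphere_product k m r.

(* Main.v *)
Require Import Defs.
From HB Require Import structures.
From mathcomp Require Import all_boot all_order all_algebra.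
From mathcomp Require Import all_classical all_reals all_analysis.
From mathcomp Require Import ring lra.
Set Implicit Arguments.
Unset Strict Implicit.
Unset Printing Implicit Defensive.
Import Order.TTheory GRing.Theory Num.Theory.
Import numFieldNormedType.Exports.
Local Open Scope classical_set_scope.
Local Open Scope ring_scope.

(* Let [P] be the tangential projection matrix, [x] the position, [h = x - xP]
   its normal part (so [H = c h]), and [L = Delta + c <x, grad>].
   The height [u = <x, v>] satisfies [L u = c u] and is proper, so bounded
   functions [f] with [L f >= 0] attain their maximum and are constant by the
   strong maximum principle.  This applies to [f = |h|^2], since
     [L f = 2 |II(., x^T)|^2 + 2 (- c f - |<II, h>|^2) >= 0].
   If [f = 0], then [Delta u = 0] and [Delta |x|^2 = 2 m], and
   [C u - |x|^2] contradicts the minimum principle unless [m = 0] or [M] is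
   empty.  If [f > 0], equality gives [II = <II, h> h / f] and [II(., x^T) = 0].
   With [b = <II, h>], differentiating [b x = 0] along [x^T] yields
   [D_x b = - (b + b^2)], and the constancy of [tr b], [tr b^2], [tr b^3] forces
   [b^2 = - b]; then [G = P + b] is a projection, parallel by the Codazzi
   equation, hence a constant matrix.  Since [<x, w>] has a critical point for
   suitable [w] in the range of [G], properness gives [G = 0]: so [x] is
   normal, the image lies in a round sphere, [M] is compact, and the image is
   the whole sphere by looking at critical points of linear functions. *)

(** The computations avoid orthonormal frames and the Levi-Civita connection. The tangential parts
    of the [p] ambient basis vectors give derivations [D a] that do not depend on the chart, with
    [D a x = row a P], and their sum of squares is the Laplacian. The price is that they do not
    commute: the commutator is the antisymmetrized derivative of [P], and it is the source of every
    Codazzi equation below. The bound on [f] that the maximum principle needs comes from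
    [0 <= tr (P + b)^2], which gives [f <= - m / c]. When [f > 0], the classical splitting along the
    kernel of [b] would require integrating distributions globally. Constant matrices replace it:
    [P + b] projects onto the would-be Euclidean factor, and [P + h^T h / f] onto the tangent space
    plus the line of [h], which is the linear span of the sphere once the former vanishes. A
    Euclidean factor would contain a line on which the height is affine, hence not [+oo] at both
    ends; the critical point argument expresses this without constructing the line. *)

Section Smooth.
Context {R : realType} {m : nat}.
Implicit Types (V : normedModType R) (U : set 'rV[R]_m) (k : nat).

Lemma partialE V (f : 'rV[R]_m -> V) i u :
  differentiable f u -> partial i f u = 'd f u (delta_mx 0 i).
Proof. exact: deriveE. Qed.

Lemma near_eq_partial V (f g : 'rV[R]_m -> V) i u :
  {near u, f =1 g} -> partial i f u = partial i g u.
Proof. exact: near_eq_derive. Qed.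

(** Only values near [u] enter the first-order expansion at [u], so [g] has the same expansion as
    [f], and [diff_unique] identifies its differential with the continuous ['d f u]. *)
Lemma near_eq_differentiable V (f g : 'rV[R]_m -> V) u :
  {near u, f =1 g} -> differentiable f u -> differentiable g u.
Proof.
move=> fg df; have cdf := diff_continuous df.
have gE : g \o shift u = cst (g u) + 'd f u +o_ (0 : 'rV[R]_m) id.
  have /eqaddoP fE := diff_locally df; apply/eqaddoP => _/posnumP[e].
  have e0 : 0 < e%:num by [].
  move: e0 => /fE {}fE.
  have fg0 : \forall h \near (0 : 'rV[R]_m), f (h + u) = g (h + u).
    have : \forall h \near (0 : 'rV[R]_m), f (u + h) = g (u + h).
      by rewrite (near_shift u) /=; near do rewrite /= sub0r addrC addrNK//.
    by apply: filterS => h; rewrite addrC.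
  apply: filterS2 fE fg0 => h; rewrite !fctE /= => + fgh.
  by rewrite fgh (nbhs_singleton fg).
apply/diff_locallyP; rewrite (diff_unique cdf gE).
by split => //; exact: cdf.
Unshelve. all: by end_near. Qed.

Lemma Ck_differentiable V k U (f : 'rV[R]_m -> V) u :
  Ck k.+1 U f -> U u -> differentiable f u.
Proof. by case=> /(_ u) + _ => /[apply]. Qed.

Lemma CkW V k U (f : 'rV[R]_m -> V) : Ck k.+1 U f -> Ck k U f.
Proof.
elim: k f => [|k IH] f [df dpf]; first by move=> x /df /differentiable_continuous.
by split => // i; exact: IH.
Qed.

Lemma open_near U u (P : 'rV[R]_m -> Prop) : open U -> U u ->
  (forall x, U x -> P x) -> \forall x \near u, P x.
Proof. by move=> oU Uu UP; apply: filterS UP _; exact: open_nbhs_nbhs. Qed.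

Lemma open_near_eq V U u (f g : 'rV[R]_m -> V) : open U -> U u ->
  (forall x, U x -> f x = g x) -> {near u, f =1 g}.
Proof. by move=> oU Uu fg; apply: filterS fg _; exact: open_nbhs_nbhs. Qed.

(** On an open set, agreement on [U] is agreement near each of its points, so it is inherited by the
    partial derivatives and induction on [k] applies. *)
Lemma eq_Ck V k U (f g : 'rV[R]_m -> V) : open U ->
  (forall x, U x -> f x = g x) -> Ck k U f -> Ck k U g.
Proof.
move=> oU; elim: k f g => [|k IH] f g fg /=.
  move=> cf x Ux; rewrite /prop_for /continuous_at -(fg x Ux).
  apply: (cvg_trans _ (cf x Ux)); apply: (@near_eq_cvg _ _ (nbhs x)).
  exact: open_near_eq Ux fg.
move=> [df dpf]; split => [x Ux|i].
  by apply: near_eq_differentiable (df _ Ux); exact: open_near_eq Ux fg.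
apply: IH (dpf i) => x Ux; apply: near_eq_partial; exact: open_near_eq Ux fg.
Qed.

Lemma Ck_cst V k U (a : V) : Ck k U (cst a).
Proof.
elim: k a => [|k IH] a /=; first by move=> x _; exact: cst_continuous.
split => [x _|i]; first exact: differentiable_cst.
have -> : partial i (cst a) = cst 0 by apply/funext => x; exact: derive_cst.
exact: IH.
Qed.

Lemma partialD V i (f g : 'rV[R]_m -> V) u :
  differentiable f u -> differentiable g u ->
  partial i (f \+ g) u = partial i f u + partial i g u.
Proof. by move=> df dg; rewrite /partial -deriveD; [|exact: diff_derivable..]. Qed.

Lemma partialM i (f g : 'rV[R]_m -> R) u :
  differentiable f u -> differentiable g u ->
  partial i (fun x => f x * g x) u = partial i f u * g u + f u * partial i g u.
Proof.
move=> df dg; rewrite /partial deriveM; try exact: diff_derivable.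
by rewrite addrC [g u *: _]mulrC.
Qed.

Lemma CkD V k U (f g : 'rV[R]_m -> V) : open U ->
  Ck k U f -> Ck k U g -> Ck k U (f \+ g).
Proof.
move=> oU; elim: k f g => [|k IH] f g /=.
  by move=> cf cg x Ux; apply: continuousD; [exact: cf|exact: cg].
move=> [df dpf] [dg dpg]; split => [x Ux|i].
  by apply: differentiableD; [exact: df|exact: dg].
apply: (@eq_Ck _ _ _ (partial i f \+ partial i g)) => //; last exact: IH.
by move=> x Ux; rewrite [RHS]partialD //; [exact: df|exact: dg].
Qed.

Lemma CkM k U (f g : 'rV[R]_m -> R) : open U ->
  Ck k U f -> Ck k U g -> Ck k U (fun x => f x * g x).
Proof.
move=> oU; elim: k f g => [|k IH] f g.
  by move=> cf cg x Ux; apply: continuousM; [exact: cf|exact: cg].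
move=> Cf Cg; have [df dpf] := Cf; have [dg dpg] := Cg; split => [x Ux|i].
  by apply: differentiableM; [exact: df|exact: dg].
apply: (@eq_Ck _ _ _ ((fun x => partial i f x * g x) \+
   (fun x => f x * partial i g x))) => //.
  by move=> x Ux; rewrite [RHS]partialM //; [exact: df|exact: dg].
apply: CkD => //.
  exact: (IH (partial i f) g (dpf i) (CkW Cg)).
exact: (IH f (partial i g) (CkW Cf) (dpg i)).
Qed.

Lemma partialV i (f : 'rV[R]_m -> R) u : f u != 0 ->
  differentiable f u ->
  partial i (fun x => (f x)^-1) u = - ((f u)^-1 * (f u)^-1 * partial i f u).
Proof.
move=> f0 df; rewrite /partial (deriveV f0); last exact: diff_derivable.
by rewrite scaleNr; congr (- (_ * _)); rewrite -exprVn expr2.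
Qed.

Lemma CkV k U (f : 'rV[R]_m -> R) : open U -> (forall x, U x -> f x != 0) ->
  Ck k U f -> Ck k U (fun x => (f x)^-1).
Proof.
move=> oU f0; elim: k => [|k IH] Cf.
  by move=> x Ux; apply: continuousV; [exact: f0|exact: Cf].
have [df dpf] := Cf; split => [x Ux|i].
  by apply: differentiableV; [exact: df|exact: f0].
apply: (@eq_Ck _ _ _ (fun x => (-1) * ((f x)^-1 * (f x)^-1 * partial i f x))) => //.
  by move=> x Ux; rewrite partialV ?mulN1r; [|exact: f0|exact: df].
apply: CkM => //; first exact: Ck_cst.
exact: (CkM oU (CkM oU (IH (CkW Cf)) (IH (CkW Cf))) (dpf i)).
Qed.

Lemma differentiable_entry p (F : 'rV[R]_m -> 'rV[R]_p) a u :
  differentiable F u -> differentiable (fun x => F x 0 a) u.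
Proof.
move=> dF; apply: (@differentiable_comp _ _ _ _ F (fun v : 'rV[R]_p => v 0 a)) => //.
exact: differentiable_coord.
Qed.

Lemma partial_entry p (F : 'rV[R]_m -> 'rV[R]_p) a i u :
  differentiable F u -> partial i (fun x => F x 0 a) u = partial i F u 0 a.
Proof.
by move=> dF; rewrite /partial [in RHS]derive_mx ?mxE //; exact: diff_derivable.
Qed.

Lemma Ck_entry p k U (F : 'rV[R]_m -> 'rV[R]_p) a : open U ->
  Ck k U F -> Ck k U (fun x => F x 0 a).
Proof.
move=> oU; elim: k F => [|k IH] F.
  move=> cF x Ux; apply: (@continuous_comp _ _ _ F (fun v : 'rV[R]_p => v 0 a)).
    exact: cF.
  exact: coord_continuous.
move=> [dF dpF]; split => [x Ux|i]; first exact: differentiable_entry (dF _ Ux).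
apply: (eq_Ck oU _ (IH _ (dpF i))) => x Ux.
by rewrite partial_entry //; exact: dF.
Qed.

End Smooth.

Section SmoothOn.
Context {R : realType} {m : nat}.
Implicit Types (V : normedModType R) (U : set 'rV[R]_m).

Lemma smooth_differentiable V U (f : 'rV[R]_m -> V) u :
  smooth_on U f -> U u -> differentiable f u.
Proof. by move=> /(_ 1%N); exact: Ck_differentiable. Qed.

Lemma smooth_continuous V U (f : 'rV[R]_m -> V) u :
  smooth_on U f -> U u -> {for u, continuous f}.
Proof. by move=> /(_ 0%N) /(_ u). Qed.

Lemma smooth_partial V U (f : 'rV[R]_m -> V) i :
  smooth_on U f -> smooth_on U (partial i f).
Proof. by move=> sf k; case: (sf k.+1) => _ /(_ i). Qed.

Lemma eq_smooth V U (f g : 'rV[R]_m -> V) : open U ->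
  (forall x, U x -> f x = g x) -> smooth_on U f -> smooth_on U g.
Proof. by move=> oU fg sf k; exact: eq_Ck (sf k). Qed.

Lemma smooth_cst V U (a : V) : smooth_on U (cst a).
Proof. by move=> k; exact: Ck_cst. Qed.

Lemma smoothD V U (f g : 'rV[R]_m -> V) : open U ->
  smooth_on U f -> smooth_on U g -> smooth_on U (fun x => f x + g x).
Proof. by move=> oU sf sg k; exact: (CkD oU (sf k) (sg k)). Qed.

Lemma smoothM U (f g : 'rV[R]_m -> R) : open U ->
  smooth_on U f -> smooth_on U g -> smooth_on U (fun x => f x * g x).
Proof. by move=> oU sf sg k; exact: CkM. Qed.

Lemma smoothV U (f : 'rV[R]_m -> R) : open U -> (forall x, U x -> f x != 0) ->
  smooth_on U f -> smooth_on U (fun x => (f x)^-1).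
Proof. by move=> oU f0 sf k; exact: CkV. Qed.

Lemma smooth_entry p U (F : 'rV[R]_m -> 'rV[R]_p) a : open U ->
  smooth_on U F -> smooth_on U (fun x => F x 0 a).
Proof. by move=> oU sF k; exact: Ck_entry. Qed.

Lemma smoothN U (f : 'rV[R]_m -> R) : open U ->
  smooth_on U f -> smooth_on U (fun x => - f x).
Proof.
move=> oU sf; apply: (@eq_smooth _ _ (fun x => (-1) * f x)) => //.
  by move=> x _; rewrite mulN1r.
by apply: smoothM => //; exact: smooth_cst.
Qed.

Lemma smooth_sum (I : Type) (r : seq I) (Q : pred I) U
    (f : I -> 'rV[R]_m -> R) : open U -> (forall i, smooth_on U (f i)) ->
  smooth_on U (fun x => \sum_(i <- r | Q i) f i x).
Proof.
move=> oU sf; elim: r => [|i r IH].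
  by under eq_fun do rewrite big_nil; exact: smooth_cst.
under eq_fun do rewrite big_cons.
by case: (Q i) => //; exact: smoothD.
Qed.

Lemma smooth_prod (I : Type) (r : seq I) (Q : pred I) U
    (f : I -> 'rV[R]_m -> R) : open U -> (forall i, smooth_on U (f i)) ->
  smooth_on U (fun x => \prod_(i <- r | Q i) f i x).
Proof.
move=> oU sf; elim: r => [|i r IH].
  by under eq_fun do rewrite big_nil; exact: smooth_cst.
under eq_fun do rewrite big_cons.
by case: (Q i) => //; exact: smoothM.
Qed.

Lemma partial_sum (I : Type) (r : seq I) (Q : pred I) i u
    (f : I -> 'rV[R]_m -> R) : (forall j, differentiable (f j) u) ->
  partial i (fun x => \sum_(j <- r | Q j) f j x) u =
  \sum_(j <- r | Q j) partial i (f j) u.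
Proof.
move=> df; suff [] : differentiable (fun x => \sum_(j <- r | Q j) f j x) u /\
  partial i (fun x => \sum_(j <- r | Q j) f j x) u =
  \sum_(j <- r | Q j) partial i (f j) u by [].
elim: r => [|j r [IHd IH]].
  rewrite big_nil; under eq_fun do rewrite big_nil.
  by split; [exact: differentiable_cst|exact: derive_cst].
rewrite big_cons; under eq_fun do rewrite big_cons.
case: (Q j) => //; split; first exact: differentiableD.
by rewrite -IH -partialD.
Qed.

End SmoothOn.

(** * Restriction to lines and mixed second differences *)

Section Lines.
Context {R : realType} {m : nat}.
Implicit Types (U : set 'rV[R]_m) (f : 'rV[R]_m -> R).

Lemma is_derive_line f (u w : 'rV[R]_m) (t : R) :
  differentiable f (u + t *: w) ->
  is_derive t (1 : R) (fun s => f (u + s *: w)) ('D_w f (u + t *: w)).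
Proof.
move=> df; have dw := @diff_derivable _ _ _ _ _ w df.
have E : (fun h : R => h^-1 *: (((fun s => f (u + s *: w)) \o shift t) (h *: (1:R))
    - f (u + t *: w))) =
    (fun h => h^-1 *: ((f \o shift (u + t *: w)) (h *: w) - f (u + t *: w))).
  apply/funext => h /=; congr (_ *: (f _ - _)).
  by rewrite /= [h *: 1]mulr1 scalerDl addrCA.
by split; rewrite /derivable /derive /= E.
Qed.

Lemma mean_value (g dg : R -> R) (a b : R) : a < b ->
  (forall x, a <= x <= b -> is_derive x 1 g (dg x)) ->
  exists2 t, a < t < b & g b - g a = dg t * (b - a).
Proof.
move=> ab dgE; have [x|x xab|t tab ->] := @MVT R g dg a b ab.
- rewrite in_itv /= => /andP[ax xb]; apply: dgE; rewrite !ltW//.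
- by apply: derivable_within_continuous xab => y; rewrite in_itv /= => /dgE [].
- by exists t.
Qed.

(** The mean value theorem is applied along [v] to the increment of [f] by [h w], then along [w] to
    ['D_v f]. The left side is symmetric in [v] and [w], which is what [partialC] exploits. *)
Lemma second_difference f (u v w : 'rV[R]_m) (h : R) : 0 < h ->
  (forall s t, 0 <= s <= h -> 0 <= t <= h ->
    differentiable f (u + s *: v + t *: w) /\
    differentiable ('D_v f) (u + s *: v + t *: w)) ->
  exists s t, [/\ 0 < s < h, 0 < t < h &
    f (u + h *: v + h *: w) - f (u + h *: v) - f (u + h *: w) + f u =
    'D_w ('D_v f) (u + s *: v + t *: w) * h ^+ 2].
Proof.
move=> h0 df.
have normal_part : 0 <= h <= h by apply/andP; split; [exact: ltW|].
have h00 : (0 : R) <= 0 <= h by apply/andP; split; [|exact: ltW].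
have C s t : u + s *: v + t *: w = u + t *: w + s *: v by rewrite addrAC.
have [x xh|s sh E1] := @mean_value
    (fun s => f (u + h *: w + s *: v) - f (u + s *: v))
    (fun s => 'D_v f (u + h *: w + s *: v) - 'D_v f (u + s *: v)) 0 h h0.
  apply: is_deriveB; apply: is_derive_line.
    by rewrite -C; exact: (df x h xh normal_part).1.
  by have := (df x 0 xh h00).1; rewrite scale0r addr0.
have sh' : 0 <= s <= h by case/andP: sh => *; rewrite !ltW.
have [x xh|t th E2] := @mean_value
    (fun t => 'D_v f (u + s *: v + t *: w))
    (fun t => 'D_w ('D_v f) (u + s *: v + t *: w)) 0 h h0.
  by apply: is_derive_line; exact: (df s x sh' xh).2.
exists s, t; split=> //.
move: E2; rewrite scale0r addr0 subr0 (C s h) => E2.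
move: E1; rewrite !scale0r !addr0 subr0 E2 expr2 mulrA => <-.
by rewrite C; ring.
Qed.

End Lines.

(** * Symmetry of second derivatives and the second derivative test *)

Section SecondOrder.
Context {R : realType} {m : nat}.
Implicit Types (U : set 'rV[R]_m) (f : 'rV[R]_m -> R).

Lemma near_norm (u : 'rV[R]_m) (Q : 'rV[R]_m -> Prop) :
  (\forall x \near u, Q x) ->
  exists2 r : R, 0 < r & forall x, `|x - u| < r -> Q x.
Proof.
move=> /nbhs_ballP[r /= r0 rQ]; exists r => // x xu.
by apply: rQ; rewrite -ball_normE /= distrC.
Qed.

Lemma near_plane (u v w : 'rV[R]_m) (Q : 'rV[R]_m -> Prop) :
  (\forall x \near u, Q x) ->
  exists2 r : R, 0 < r & forall s t, `|s| <= r -> `|t| <= r ->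
    Q (u + s *: v + t *: w).
Proof.
move=> /near_norm[r r0 rQ]; set K := `|v| + `|w| + 1.
have K0 : 0 < K by rewrite ltr_wpDl// addr_ge0.
exists (r / K); first exact: divr_gt0.
move=> s t sr tr; apply: rQ; rewrite -(addrA u) addrAC subrr add0r.
apply: le_lt_trans (ler_normD _ _) _; rewrite !normrZ.
have rK : 0 <= r / K by rewrite ltW ?divr_gt0.
apply: (@le_lt_trans _ _ (r / K * `|v| + r / K * `|w|)).
  by apply: lerD; apply: ler_wpM2r.
rewrite -mulrDr mulrAC ltr_pdivrMr// ltr_pM2l//.
by rewrite /K ltrDl.
Qed.

Lemma deriveE_partial f (u w : 'rV[R]_m) : differentiable f u ->
  'D_w f u = \sum_(i < m) w 0 i * partial i f u.
Proof.
move=> df; rewrite deriveE// {1}(row_sum_delta w) linear_sum.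
by apply: eq_bigr => i _; rewrite linearZ /= partialE.
Qed.

(** Schwarz's theorem: by [second_difference] in both orders, [A] and [B] take a common value at two
    points close to [u]. If [A u] and [B u] differed, values within half the gap of each could not
    coincide. *)
Lemma partialC U f i j u : open U -> smooth_on U f -> U u ->
  partial i (partial j f) u = partial j (partial i f) u.
Proof.
move=> oU sf Uu; apply/eqP; apply: contraT => neq.
set A := partial i (partial j f); set B := partial j (partial i f).
pose d := `|A u - B u| / 2.
have d0 : 0 < d by rewrite divr_gt0// normr_gt0 subr_eq0.
have cA := smooth_continuous (smooth_partial i (smooth_partial j sf)) Uu.
have cB := smooth_continuous (smooth_partial j (smooth_partial i sf)) Uu.
have nA : \forall x \near u, `|A u - A x| < d by move/cvgrPdist_lt: cA => /(_ d d0).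
have nB : \forall x \near u, `|B u - B x| < d by move/cvgrPdist_lt: cB => /(_ d d0).
have nU : \forall x \near u, U x by exact: (open_near oU Uu).
have nABU : \forall x \near u, [/\ U x, `|A u - A x| < d & `|B u - B x| < d].
  by apply: filterS3 nU nA nB => x ? ? ?; split.
have [r r0 rQ] := near_plane (delta_mx 0 i) (delta_mx 0 j) nABU.
have [r' r'0 rQ'] := near_plane (delta_mx 0 j) (delta_mx 0 i) nABU.
pose h := Num.min r r'.
have h0 : 0 < h by rewrite lt_min r0.
have hr : h <= r by rewrite ge_min lexx.
have hr' : h <= r' by rewrite ge_min lexx orbT.
have le_norm (s q : R) : h <= q -> 0 <= s <= h -> `|s| <= q.
  by move=> hq /andP[s0 sh]; rewrite ger0_norm// (le_trans sh).
have ltle (s : R) : 0 < s < h -> 0 <= s <= h by case/andP=> *; rewrite !ltW.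
have [s|s [t [sh th E]]] :=
    @second_difference _ _ f u (delta_mx 0 i) (delta_mx 0 j) h h0.
  move=> t sh th; have [Ux _ _] := rQ s t (le_norm s r hr sh) (le_norm t r hr th).
  by split; [exact: smooth_differentiable sf Ux|
             exact: smooth_differentiable (smooth_partial i sf) Ux].
have [s'|s' [t' [sh' th' E']]] :=
    @second_difference _ _ f u (delta_mx 0 j) (delta_mx 0 i) h h0.
  move=> t' sh' th'.
  have [Ux _ _] := rQ' s' t' (le_norm _ _ hr' sh') (le_norm _ _ hr' th').
  by split; [exact: smooth_differentiable sf Ux|
             exact: smooth_differentiable (smooth_partial j sf) Ux].
have [_ _ By] := rQ s t (le_norm _ _ hr (ltle _ sh)) (le_norm _ _ hr (ltle _ th)).
have [_ Ay _] := rQ' s' t' (le_norm _ _ hr' (ltle _ sh')) (le_norm _ _ hr' (ltle _ th')).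
move: By Ay; set y := _ + t *: _; set y' := _ + t' *: _ => By Ay.
have BA : B y = A y'.
  apply: (@mulIf _ (h ^+ 2)); first by rewrite expf_neq0// gt_eqF.
  apply: (etrans (esym E)); apply: (etrans _ E').
  rewrite (addrAC u); congr (_ + _); rewrite -!addrA; congr (_ + _).
  exact: addrC.
move: neq By Ay; rewrite BA /d -/(A u) -/(B u) -/(B u); move: (A u) (B u) (A y') => a b z.
rewrite -subr_eq0 -normr_gt0 => ab0 bz az.
have := ler_distD z a b; rewrite (distrC z) => abz.
by have := le_lt_trans abz (ltrD az bz); rewrite -splitr ltxx.
Qed.

(** If the second derivative along [w] were positive at the critical point, the first derivative
    would be positive on some [(0, t)], and [f] would increase strictly away from the maximum. *)
Lemma local_max_derive U f (u w : 'rV[R]_m) : open U -> smooth_on U f -> U u ->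
  (\forall x \near u, f x <= f u) ->
  'D_w f u = 0 /\ 'D_w ('D_w f) u <= 0.
Proof.
move=> oU sf Uu fmax.
have sDw : smooth_on U ('D_w f).
  apply: (@eq_smooth _ _ _ _ (fun x => \sum_(i < m) w 0 i * partial i f x)) => //.
    by move=> x Ux; rewrite -deriveE_partial//; exact: smooth_differentiable sf Ux.
  apply: smooth_sum => // i; apply: smoothM => //; first exact: smooth_cst.
  exact: smooth_partial.
have nU : \forall x \near u, U x by exact: (open_near oU Uu).
have nfU : \forall x \near u, U x /\ f x <= f u by apply: filterS2 nU fmax => x ? ?; split.
have [r r0 rQ] := near_plane w 0 nfU.
have {}rQ t : `|t| <= r -> U (u + t *: w) /\ f (u + t *: w) <= f u.
  move=> tr; have := rQ t 0 tr; rewrite scaler0 addr0; apply.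
  by rewrite normr0 ltW.
have rhoE t : `|t| <= r ->
    is_derive t (1 : R) (fun s => f (u + s *: w)) ('D_w f (u + t *: w)).
  by move=> /rQ[Ux _]; apply: is_derive_line; exact: smooth_differentiable sf Ux.
have nr (t : R) : t \in `]-r, r[ -> `|t| <= r.
  by rewrite in_itv /= => /andP[rt tr]; rewrite ler_norml !ltW.
have D0 : 'D_w f u = 0.
  have := @derive1_at_max _ (fun s => f (u + s *: w)) (-r) r 0.
  have -> : -r <= r by rewrite (@le_trans _ _ 0)// ?oppr_le0 ltW.
  move=> /(_ isT) dm; have {dm}[t tr||t tr|_] := dm.
  - by have [] := rhoE t (nr _ tr).
  - by rewrite in_itv /= oppr_lt0 r0.
  - by rewrite scale0r addr0; exact: (rQ t (nr _ tr)).2.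
  - have [_] : is_derive (0:R) (1:R) (fun s => f (u + s *: w)) ('D_w f (u + 0 *: w)).
      by apply: rhoE; rewrite normr0 ltW.
    by rewrite scale0r addr0 => ->.
split=> //; rewrite leNgt; apply/negP => kpos.
set k := 'D_w _ u in kpos; pose sg t := 'D_w f (u + t *: w).
have [dv dE] : is_derive (0 : R) (1 : R) sg k.
  have := @is_derive_line _ _ ('D_w f) u w 0; rewrite scale0r addr0.
  by apply; exact: smooth_differentiable sDw Uu.
have : (fun h : R => h^-1 *: ((sg \o shift 0) (h *: (1 : R)) - sg 0)) @ 0^' --> k.
  by rewrite -dE; exact: dv.
move=> /cvgr_gt /(_ _ kpos) /nbhs_ballP[e /= e0 eP].
have sg_gt0 t : 0 < t -> t < e -> 0 < sg t.
  move=> t0 te; have et : ball (0 : R) e t.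
    by rewrite -ball_normE /ball_ /= sub0r normrN (gtr0_norm t0).
  have /= := eP t et (lt0r_neq0 t0).
  have -> : sg (t *: (1 : R) + 0) - sg 0 = sg t.
    by rewrite addr0 [t *: _]mulr1 /sg scale0r addr0 D0 subr0.
  by rewrite /GRing.scale /= (pmulr_rgt0 _ (_ : 0 < t^-1)) ?invr_gt0.
pose t := Num.min r (e / 2).
have t0 : 0 < t by rewrite lt_min r0 divr_gt0.
have tr : t <= r by rewrite ge_min lexx.
have te : t < e.
  apply: (@le_lt_trans _ _ (e / 2)); first by rewrite ge_min lexx orbT.
  by rewrite [ltRHS]splitr ltrDl divr_gt0.
have [x /andP[x0 xt]|x /andP[x0 xt] E] := @mean_value _ (fun s => f (u + s *: w)) sg 0 t t0.
  apply: rhoE; have -> : `|x| = x by exact: ger0_norm.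
  exact: le_trans xt tr.
have tn : `|t| = t by exact: gtr0_norm.
have [_] := rQ t (eq_ind_r (fun s => s <= r) tr tn).
rewrite leNgt => /negP; apply.
have := mulr_gt0 (sg_gt0 x x0 (lt_trans xt te)) t0.
by move: E; rewrite scale0r addr0 subr0 => <-; rewrite subr_gt0.
Qed.

End SecondOrder.

(** Derivative along the vector field whose chart coefficients are column [a] of [W]. In the
    application there is one field for each ambient basis vector, namely its tangential part; hence
    the index [a] in ['I_p], with more fields than dimensions. *)
Definition vf {R : realType} {m p : nat} (W : 'rV[R]_m -> 'M[R]_(m, p))
    (a : 'I_p) (f : 'rV[R]_m -> R) (u : 'rV[R]_m) : R :=
  \sum_(i < m) W u i a * partial i f u.

Section VectorFields.
Context {R : realType} {m p : nat} (U : set 'rV[R]_m).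
Context (W : 'rV[R]_m -> 'M[R]_(m, p)).
Hypothesis oU : open U.
Hypothesis sW : forall i a, smooth_on U (fun u => W u i a).
Implicit Types (f g : 'rV[R]_m -> R) (a : 'I_p).
Local Notation D := (vf W).

Lemma smooth_vf a f : smooth_on U f -> smooth_on U (D a f).
Proof.
move=> sf; apply: smooth_sum => // i; apply: smoothM => //.
exact: smooth_partial.
Qed.

Lemma eq_vf a f g u : U u -> (forall x, U x -> f x = g x) -> D a f u = D a g u.
Proof.
move=> Uu fg; apply: eq_bigr => i _; congr (_ * _).
by apply: near_eq_partial; exact: open_near_eq Uu fg.
Qed.

Lemma vf_cst a (k : R) u : D a (cst k) u = 0.
Proof.
by apply: big1 => i _; rewrite (_ : partial i _ _ = 0) ?mulr0//; exact: derive_cst.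
Qed.

Lemma vfD a f g u : U u -> smooth_on U f -> smooth_on U g ->
  D a (fun x => f x + g x) u = D a f u + D a g u.
Proof.
move=> Uu sf sg; rewrite -big_split; apply: eq_bigr => i _.
by rewrite /= -mulrDr -(partialD i (smooth_differentiable sf Uu) (smooth_differentiable sg Uu)).
Qed.

Lemma vfM a f g u : U u -> smooth_on U f -> smooth_on U g ->
  D a (fun x => f x * g x) u = D a f u * g u + f u * D a g u.
Proof.
move=> Uu sf sg; rewrite mulr_suml mulr_sumr -big_split; apply: eq_bigr => i _.
rewrite (partialM i (smooth_differentiable sf Uu) (smooth_differentiable sg Uu)).
by rewrite mulrDr mulrA mulrCA.
Qed.

Lemma vfZ a (k : R) f u : U u -> smooth_on U f ->
  D a (fun x => k * f x) u = k * D a f u.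
Proof.
move=> Uu sf; rewrite vfM ?vf_cst ?mul0r ?add0r//; exact: smooth_cst.
Qed.

Lemma vfN a f u : U u -> smooth_on U f -> D a (fun x => - f x) u = - D a f u.
Proof.
move=> Uu sf; rewrite -mulN1r -vfZ//; apply: eq_vf => // x _.
by rewrite mulN1r.
Qed.

Lemma vf_sum a (I : Type) (r : seq I) (Q : pred I) (F : I -> 'rV[R]_m -> R) u :
  U u -> (forall i, smooth_on U (F i)) ->
  D a (fun x => \sum_(i <- r | Q i) F i x) u = \sum_(i <- r | Q i) D a (F i) u.
Proof.
move=> Uu sF; rewrite /vf exchange_big; apply: eq_bigr => i _.
rewrite partial_sum ?mulr_sumr// => j; exact: smooth_differentiable (sF j) Uu.
Qed.

(** Differentiating the coefficients of the field only produces multiples of first derivatives of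
    [f], which vanish at the maximum. What remains is the second derivative along the field frozen
    at [u]. *)
Lemma local_max_vf a f u : smooth_on U f -> U u ->
  (\forall x \near u, f x <= f u) -> D a f u = 0 /\ D a (D a f) u <= 0.
Proof.
move=> sf Uu fmax.
have pf0 i : partial i f u = 0.
  by have [] := local_max_derive (delta_mx 0 i) oU sf Uu fmax.
split; first by apply: big1 => i _; rewrite pf0 mulr0.
pose w : 'rV[R]_m := \row_i W u i a.
have [_ le0] := local_max_derive w oU sf Uu fmax.
apply: le_trans le0; rewrite le_eqVlt; apply/orP; left; apply/eqP.
pose Dwf x := \sum_(j < m) w 0 j * partial j f x.
have sDwf : smooth_on U Dwf.
  apply: smooth_sum => // i; apply: smoothM => //; first exact: smooth_cst.
  exact: smooth_partial.
have -> : 'D_w ('D_w f) u = 'D_w Dwf u.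
  apply: near_eq_derive; apply: (open_near oU Uu) => x Ux.
  by apply: deriveE_partial; exact: smooth_differentiable sf Ux.
rewrite deriveE_partial; last exact: smooth_differentiable sDwf Uu.
apply: eq_bigr => i _; rewrite mxE; congr (_ * _).
have dp j := smooth_differentiable (smooth_partial j sf) Uu.
have dW j := smooth_differentiable (sW j a) Uu.
rewrite !partial_sum => [|j|j]; last 2 first.
- by apply: differentiableM => //; exact: differentiable_cst.
- exact: differentiableM.
apply: eq_bigr => j _.
have dc : differentiable (cst (w 0 j) : 'rV[R]_m -> R) u by exact: differentiable_cst.
rewrite (partialM i (dW j) (dp j)) (partialM i dc (dp j)) pf0 !mulr0 !add0r.
by rewrite mxE.
Qed.

End VectorFields.

(** Hopf's barrier needs a smooth function with round level sets, so the sup norm of the topology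
    does not serve; [norm_sqdist] compares the two. *)
Definition sqdist {R : realType} {m : nat} (y x : 'rV[R]_m) : R :=
  \sum_(i < m) (x 0 i - y 0 i) ^+ 2.

Section Sqdist.
Context {R : realType} {m : nat}.
Implicit Types (x y u : 'rV[R]_m) (U : set 'rV[R]_m).

Lemma sqdist_ge0 y x : 0 <= sqdist y x.
Proof. by apply: sumr_ge0 => i _; exact: sqr_ge0. Qed.

Lemma sqdistC y x : sqdist y x = sqdist x y.
Proof. by apply: eq_bigr => i _; rewrite -sqrrN opprB. Qed.

Lemma sqdistxx x : sqdist x x = 0.
Proof. by apply: big1 => i _; rewrite subrr expr0n. Qed.

Lemma sqdist_eq0 y x : (sqdist y x == 0) = (x == y).
Proof.
apply/idP/eqP => [|->]; last by rewrite sqdistxx.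
rewrite psumr_eq0 => [/allP xy|i _]; last exact: sqr_ge0.
apply/rowP => i; have := xy i (mem_index_enum i).
by rewrite sqrf_eq0 subr_eq0 => /eqP.
Qed.

Lemma coord_sqdist y x i : (x 0 i - y 0 i) ^+ 2 <= sqdist y x.
Proof. by rewrite /sqdist (bigD1 i)//= lerDl sumr_ge0// => j _; exact: sqr_ge0. Qed.

Lemma norm_sqdist y x (r : R) : 0 < r -> sqdist y x < r ^+ 2 -> `|x - y| < r.
Proof.
move=> r0 yxr; rewrite /Num.norm /= mx_normrE; apply/bigmax_ltP; split=> // -[i j] _ /=.
rewrite (ord1 i) !mxE; have := le_lt_trans (coord_sqdist y x j) yxr.
by rewrite -real_normK ?num_real// ltr_pXn2r// ?nnegrE// ltW.
Qed.

Lemma smooth_coord U i : open U -> smooth_on U (fun x : 'rV[R]_m => x 0 i).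
Proof.
move=> oU; apply: (@smooth_entry _ _ _ _ id) => // k.
have diffid (x : 'rV[R]_m) : differentiable id x by exact: ex_diff.
case: k => [|k]; first by move=> x _; exact: differentiable_continuous.
split => // j.
have -> : partial j id = cst (delta_mx 0 j : 'rV[R]_m) by apply/funext => x; exact: derive_id.
exact: Ck_cst.
Qed.

Lemma partial_coord (i j : 'I_m) u : partial j (fun x : 'rV[R]_m => x 0 i) u = (i == j)%:R.
Proof.
rewrite (@partial_entry _ _ _ id); last exact: ex_diff.
by rewrite /partial derive_id mxE eqxx.
Qed.

Lemma smooth_sqdist U y : open U -> smooth_on U (sqdist y).
Proof.
move=> oU; apply: smooth_sum => // i.
have sc : smooth_on U (fun x : 'rV[R]_m => x 0 i + - y 0 i).
  by apply: smoothD => //; [exact: smooth_coord|exact: smooth_cst].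
exact: (smoothM oU sc sc).
Qed.

Lemma partial_sqdist y u j : partial j (sqdist y) u = 2 * (u 0 j - y 0 j).
Proof.
have oT : open [set: 'rV[R]_m] by exact: openT.
have dc i : differentiable (fun x : 'rV[R]_m => x 0 i + - y 0 i) u.
  apply: (@smooth_differentiable _ _ _ setT) => //.
  by apply: smoothD => //; [exact: smooth_coord|exact: smooth_cst].
have pc i : partial j (fun x : 'rV[R]_m => x 0 i + - y 0 i) u = (i == j)%:R.
  rewrite (@partialD _ _ _ j (fun x : 'rV[R]_m => x 0 i) (cst (- y 0 i))).
  - by rewrite partial_coord (_ : partial j (cst _) u = 0) ?addr0//; exact: derive_cst.
  - by apply: (@smooth_differentiable _ _ _ setT) => //; exact: smooth_coord.
  - exact: differentiable_cst.
rewrite /sqdist partial_sum => [|i]; last exact: (differentiableM (dc i) (dc i)).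
rewrite (bigD1 j)//= big1 ?addr0 => [|i ij].
  rewrite (_ : (fun x : 'rV[R]_m => _) = (fun x => (x 0 j + - y 0 j) * (x 0 j + - y 0 j)))//.
  by rewrite partialM// pc eqxx mul1r mulr1 -mulr2n mulr_natl.
rewrite (_ : (fun x : 'rV[R]_m => _) = (fun x => (x 0 i + - y 0 i) * (x 0 i + - y 0 i)))//.
by rewrite partialM// pc (negbTE ij) mul0r mulr0 addr0.
Qed.

Lemma continuous_sqdist y : continuous (sqdist y).
Proof.
move=> x; apply: (@smooth_continuous _ _ _ setT) => //.
by apply: smooth_sqdist; exact: openT.
Qed.

Lemma compact_ball_sqdist y (r : R) : compact [set x | sqdist y x <= r].
Proof.
apply: bounded_closed_compact.
  exists (Num.sqrt (r + 1) + 1 + `|y|); split; first exact: num_real.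
  move=> M rM x /= yx.
  have r0 : 0 <= r by exact: le_trans (sqdist_ge0 y x) yx.
  have xy : `|x - y| < Num.sqrt (r + 1) + 1.
    apply: norm_sqdist; first by rewrite ltr_wpDl// sqrtr_ge0.
    rewrite sqrrD1 sqr_sqrtr; last by rewrite addr_ge0.
    apply: (le_lt_trans yx); have := sqrtr_ge0 (r + 1).
    by move: (Num.sqrt _) => q q0; lra.
  rewrite -(subrK y x); apply: (le_trans (ler_normD _ _)).
  by apply/ltW; apply: (lt_trans _ rM); rewrite ltrD2r.
rewrite (_ : [set x | _] = sqdist y @^-1` [set z | z <= r])//.
apply: preimage_closed; last exact: closed_le.
by move=> x _; exact: continuous_sqdist.
Qed.

End Sqdist.

(** * Strong maximum principle *)

Section CompactExtrema.
Context {R : realType} {T : topologicalType}.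
Implicit Types (f : T -> R) (A : set T).

Lemma compact_max f A : A !=set0 -> compact A ->
  (forall x, A x -> {for x, continuous f}) ->
  exists2 c, A c & forall x, A x -> f x <= f c.
Proof.
move=> A0 cA cf; have [|c /set_mem Ac cmax] := @compact_EVT_max _ _ f A A0 cA.
  by apply: continuous_in_subspaceT => x /set_mem; exact: cf.
by exists c => // x Ax; apply: cmax; exact: mem_set.
Qed.

Lemma compact_min f A : A !=set0 -> compact A ->
  (forall x, A x -> {for x, continuous f}) ->
  exists2 c, A c & forall x, A x -> f c <= f x.
Proof.
move=> A0 cA cf; have [|c /set_mem Ac cmin] := @compact_EVT_min _ _ f A A0 cA.
  by apply: continuous_in_subspaceT => x /set_mem; exact: cf.
by exists c => // x Ax; apply: cmin; exact: mem_set.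
Qed.

Lemma closed_setI_preimage f A (C : set R) : closed A ->
  (forall x, A x -> {for x, continuous f}) -> closed C ->
  closed (A `&` f @^-1` C).
Proof.
move=> clA cf clC x cx.
have Ax : A x by apply: clA; apply: closure_subset cx => y [].
split=> //=; apply: clC => N fxN.
have [y [[_ Cy] Ny]] := cx _ (cf x Ax _ fxN).
by exists (f y).
Qed.

End CompactExtrema.

Section StrongMaximum.
Context {R : realType} {m p : nat} (U : set 'rV[R]_m).
Context (W : 'rV[R]_m -> 'M[R]_(m, p)) (beta : 'I_p -> 'rV[R]_m -> R).
Hypothesis oU : open U.
Hypothesis sW : forall i a, smooth_on U (fun u => W u i a).
Hypothesis sbeta : forall a, smooth_on U (beta a).
Hypothesis freeW : forall u, U u -> row_free (W u).
Implicit Types f g : 'rV[R]_m -> R.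
Local Notation D := (vf W).

(** For the tangential fields of an immersion the sum of squares is the Laplace-Beltrami operator,
    since the covariant derivatives of the fields along themselves add up to zero. A general drift
    [beta] covers both [L] and, with [beta = 0], the Laplacian. *)
Definition drift_laplacian (f : 'rV[R]_m -> R) (u : 'rV[R]_m) : R :=
  \sum_(a < p) (D a (D a f) u + beta a u * D a f u).
Local Notation L := drift_laplacian.

Lemma smooth_drift_laplacian f : smooth_on U f -> smooth_on U (L f).
Proof.
move=> sf; apply: smooth_sum => // a; apply: smoothD => //.
  by do 2 apply: smooth_vf => //.
by apply: smoothM => //; apply: smooth_vf.
Qed.

Lemma drift_laplacianD f g u : U u -> smooth_on U f -> smooth_on U g ->
  L (fun x => f x + g x) u = L f u + L g u.
Proof.
move=> Uu sf sg; rewrite /L -big_split; apply: eq_bigr => a _ /=.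
rewrite (vfD W a Uu sf sg) mulrDr addrACA; congr (_ + _).
have sDf := smooth_vf oU sW a sf; have sDg := smooth_vf oU sW a sg.
rewrite -(vfD W a Uu sDf sDg); apply: (eq_vf W oU) => // x Ux.
exact: (vfD W a Ux sf sg).
Qed.

Lemma drift_laplacianZ (k : R) f u : U u -> smooth_on U f ->
  L (fun x => k * f x) u = k * L f u.
Proof.
move=> Uu sf; rewrite /L mulr_sumr; apply: eq_bigr => a _.
have sDf := smooth_vf oU sW a sf.
rewrite (vfZ W a k Uu sf) mulrDr -(vfZ W a k Uu sDf) mulrCA; congr (_ + _).
by apply: (eq_vf W oU) => // x Ux; exact: (vfZ W a k Ux sf).
Qed.

Lemma local_max_drift_laplacian f u : smooth_on U f -> U u ->
  (\forall x \near u, f x <= f u) -> L f u <= 0.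
Proof.
move=> sf Uu fmax; apply: sumr_le0 => a _.
have [-> DD] := local_max_vf oU sW a sf Uu fmax.
by rewrite mulr0 addr0.
Qed.

Section Barrier.
Variables (q y : 'rV[R]_m).
Hypothesis (Uq : U q) (qy : q != y).

(* [s >= 0] is a ball that meets the sphere of centre [y] through [q] only at [q];
   the term [al s^2] makes [L] positive at [q] for [al] large. *)
Let s (x : 'rV[R]_m) := sqdist y q + -1 * sqdist y x + -1 * sqdist q x.
Let bar al (x : 'rV[R]_m) := s x + al * (s x * s x).

Let smooth_s : smooth_on U s.
Proof.
have sc (k : R) : smooth_on U (fun=> k) by exact: smooth_cst.
apply: smoothD => //; first apply: smoothD => //.
  by apply: smoothM => //; exact: smooth_sqdist.
by apply: smoothM => //; exact: smooth_sqdist.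
Qed.

Lemma smooth_barrier al : smooth_on U (bar al).
Proof.
apply: smoothD => //; apply: smoothM => //; first exact: smooth_cst.
exact: smoothM.
Qed.

Let s_q : s q = 0.
Proof. by rewrite /s sqdistxx; ring. Qed.

Let grad_s_neq0 : 0 < \sum_(a < p) D a s q ^+ 2.
Proof.
rewrite lt_neqAle sumr_ge0 ?andbT; last by move=> a _; exact: sqr_ge0.
apply/eqP => /esym/eqP; rewrite psumr_eq0 => [/allP D0|a _]; last exact: sqr_ge0.
(* The differential of [s] at [q] is [-2 (q - y)], so the derivatives of [s] along the fields are
   the entries of [-2 (q - y) *m W q]; full row rank of [W q] then gives [q = y]. *)
suff : (q - y) *m W q = 0.
  move=> /(congr1 (mulmx^~ (pinvmx (W q)))); rewrite mul0mx -mulmxA.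
  rewrite (mulmxVp (freeW Uq)) mulmx1 => /eqP.
  by rewrite subr_eq0 (negbTE qy).
apply/rowP => a; rewrite !mxE; have := D0 a (mem_index_enum a).
rewrite /= sqrf_eq0 => /eqP Da.
apply: (@mulfI _ (-2)); first by rewrite oppr_eq0 pnatr_eq0.
rewrite mulr0 mulr_sumr -[RHS]Da; apply: eq_bigr => i _; rewrite !mxE.
have ds z : differentiable (sqdist z) q.
  by apply: (smooth_differentiable (smooth_sqdist z oU)).
have dc (k : R) : differentiable (cst k : 'rV[R]_m -> R) q by exact: differentiable_cst.
have dm z : differentiable (fun x => -1 * sqdist z x) q.
  exact: (differentiableM (dc (-1)) (ds z)).
have pm z : partial i (fun x => -1 * sqdist z x) q = -2 * (q 0 i - z 0 i).
  rewrite (partialM i (dc (-1)) (ds z)) partial_sqdist.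
  by rewrite (_ : partial i (cst _) q = 0) /=; [ring|exact: derive_cst].
rewrite (_ : partial i s q = -2 * (q 0 i - y 0 i)); first by ring.
rewrite (partialD i (differentiableD (dc (sqdist y q)) (dm y)) (dm q)).
rewrite (partialD i (dc (sqdist y q)) (dm y)) !pm.
by rewrite (_ : partial i (cst _) q = 0); [ring|exact: derive_cst].
Qed.

(** As [s q = 0], the operator applied to [s * s] at [q] is twice the squared gradient of [s], a
    positive number [2 Q], whatever the drift. *)
Lemma barrier_positive : exists al, 0 < L (bar al) q.
Proof.
have := grad_s_neq0; set Q := \sum_(a < p) _ => Q0.
(* Chosen so that [al * (2 Q) = |L s q| + 1], which leaves [L (bar al) q >= 1]. *)
exists ((`|L s q| + 1) / (2 * Q)); set al := _ / _.
have sss := smoothM oU smooth_s smooth_s.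
have sal : smooth_on U (fun x => al * (s x * s x)).
  by apply: smoothM => //; exact: smooth_cst.
rewrite (drift_laplacianD Uq smooth_s sal) (drift_laplacianZ al Uq sss).
have -> : L (fun x => s x * s x) q = 2 * Q.
  rewrite /L mulr_sumr; apply: eq_bigr => a _.
  rewrite (vfM W a Uq smooth_s smooth_s) s_q mul0r mulr0 addr0 mulr0 addr0.
  have sDs := smooth_vf oU sW a smooth_s.
  rewrite (@eq_vf _ _ _ _ W oU a _ (fun x => 2 * (s x * D a s x))) => // [|x Ux].
    by rewrite (vfZ W a _ Uq (smoothM oU smooth_s sDs)) (vfM W a Uq smooth_s sDs) s_q; ring.
  by rewrite (vfM W a Ux smooth_s smooth_s); ring.
have Q2 : 2 * Q != 0 by rewrite mulf_neq0 ?pnatr_eq0// gt_eqF.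
rewrite /al divfK//; apply: (@lt_le_trans _ _ 1) => //.
by rewrite addrA lerDr -lerBlDr sub0r lerNl -normrN ler_norm.
Qed.

End Barrier.

(** Hopf's argument. If [f y < mu] for some [y] near [u0], let [q] be a point of the level set
    [f = mu] nearest to [y]. The perturbation [f + eps bar] equals [mu] at [q] and is smaller on a
    small sphere around [q], so it has an interior maximum; but [L] of it is positive near [q]. *)
Lemma strong_max_local f mu u0 : smooth_on U f ->
  (forall x, U x -> f x <= mu) -> (forall x, U x -> 0 <= L f x) ->
  U u0 -> f u0 = mu -> \forall x \near u0, f x = mu.
Proof.
move=> sf fmu Lf Uu0 fu0.
have [r r0 rU] : exists2 r : R, 0 < r & forall x, `|x - u0| < r -> U x.
  by apply: near_norm; exact: (open_near oU Uu0).
have r20 : 0 < r / 2 by exact: divr_gt0.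
have : \forall y \near u0, sqdist u0 y < (r / 2) ^+ 2.
  have /cvgr_lt := @continuous_sqdist R m u0 u0; apply.
  by rewrite sqdistxx exprn_gt0.
apply: filterS => y yr; apply/eqP; apply: contraT => fy_neq.
pose B := [set x | sqdist y x <= sqdist y u0].
have BU x : B x -> U x.
  move=> Bx; apply: rU; rewrite [ltRHS]splitr.
  rewrite (_ : x - u0 = (x - y) + (y - u0)); last by rewrite addrA subrK.
  apply: (le_lt_trans (ler_normD _ _)); apply: ltrD; last exact: norm_sqdist.
  by apply: norm_sqdist => //; rewrite (le_lt_trans Bx)// sqdistC.
have cB : compact B by exact: compact_ball_sqdist.
have clB : closed B.
  rewrite (_ : B = sqdist y @^-1` [set z | z <= sqdist y u0])//.
  by apply: preimage_closed; [move=> x _; exact: continuous_sqdist|exact: closed_le].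
have cf x : U x -> {for x, continuous f} by exact: smooth_continuous.
have [q [Bq fq] qmin] : exists2 q, (B `&` f @^-1` [set mu]) q &
    forall x, (B `&` f @^-1` [set mu]) x -> sqdist y q <= sqdist y x.
  apply: compact_min.
  - by exists u0; split=> //; rewrite /B /= lexx.
  - apply: (subclosed_compact _ cB); last by move=> x [].
    by apply: closed_setI_preimage => // x Bx; exact: cf (BU x Bx).
  - by move=> x _; exact: continuous_sqdist.
have Uq := BU q Bq.
have qy : q != y by apply: contraNneq fy_neq => <-; apply/eqP.
have [al] := barrier_positive Uq qy.
set s := fun x => sqdist y q + -1 * sqdist y x + -1 * sqdist q x.
set bar := fun x => s x + al * (s x * s x) => Lbar.
have sbar : smooth_on U bar := smooth_barrier q y al.
have sLbar := smooth_drift_laplacian sbar.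
have cs : continuous s.
  have oT : open [set: 'rV[R]_m] by exact: openT.
  have sk z : smooth_on [set: 'rV[R]_m] (fun x => -1 * sqdist z x).
    by apply: smoothM => //; [exact: smooth_cst|exact: smooth_sqdist].
  have sc : smooth_on [set: 'rV[R]_m] (fun x => sqdist y q + -1 * sqdist y x).
    by apply: smoothD => //; exact: smooth_cst.
  by move=> x; apply: (smooth_continuous (smoothD oT sc (sk q))).
have sq0 : s q = 0 by rewrite /s sqdistxx; ring.
have nLbar : \forall x \near q, 0 < L bar x.
  by have /cvgr_gt := smooth_continuous sLbar Uq; apply.
(* Writing [bar = s (1 + al s)], the bound [|al s| < 1] makes [bar] negative where [s < 0] and at
   most [2 s] where [s >= 0]. *)
have nals : \forall x \near q, `|al * s x| < 1.
  have cas : {for q, continuous (fun x => `|al * s x|)}.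
    apply: (@continuous_comp _ _ _ (fun x => al * s x) Num.norm); last exact: norm_continuous.
    by apply: continuousM; [exact: cst_continuous|exact: cs].
  by have /cvgr_lt := cas; apply; rewrite sq0 mulr0 normr0.
have [d d0 dP] : exists2 d : R, 0 < d & forall x, `|x - q| < d ->
    [/\ U x, 0 < L bar x & `|al * s x| < 1].
  apply: near_norm; apply: filterS3 (open_near oU Uq (fun x Ux => Ux)) nLbar nals.
  by move=> x ? ? ?; split.
pose e := (d / 2) ^+ 2.
have e0 : 0 < e by rewrite exprn_gt0// divr_gt0.
pose Dq := [set x | sqdist q x <= e].
have DqP x : Dq x -> [/\ U x, 0 < L bar x & `|al * s x| < 1].
  move=> Dx; apply: dP; apply: norm_sqdist => //.
  apply: (le_lt_trans Dx); rewrite /e ltr_pXn2r ?nnegrE// ?ltW ?divr_gt0//.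
  by rewrite [ltRHS]splitr ltrDl divr_gt0.
have bar_lt0 x : Dq x -> s x < 0 -> bar x < 0.
  move=> /DqP[_ _]; rewrite ltr_norml => /andP[a1 _] s0.
  rewrite /bar mulrA -{1}[s x]mul1r -mulrDl nmulr_llt0//.
  by rewrite -ltrBlDl sub0r.
have bar_le x : Dq x -> 0 <= s x -> bar x <= 2 * sqdist y q.
  move=> /DqP[_ _]; rewrite ltr_norml => /andP[_ a1] s0.
  rewrite /bar mulrA -{1}[s x]mul1r -mulrDl.
  have sle : s x <= sqdist y q.
    by rewrite /s; have := sqdist_ge0 y x; have := sqdist_ge0 q x; move=> *; lra.
  apply: (@le_trans _ _ (2 * s x)); last by rewrite ler_pM2l.
  by rewrite [leRHS]mulrC [leRHS]mulrC ler_wpM2r//; lra.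
have f_lt x : x != q -> 0 <= s x -> f x < mu.
  move=> xq sx0; have q0 : 0 < sqdist q x by rewrite lt_def sqdist_eq0 xq sqdist_ge0.
  have yx : sqdist y x < sqdist y q by move: sx0 q0; rewrite /s; lra.
  have Bx : B x by rewrite /B /=; apply: ltW; apply: (lt_le_trans yx).
  rewrite lt_neqAle fmu ?andbT; last exact: BU.
  by apply/eqP => fx; have := qmin x (conj Bx fx); rewrite leNgt yx.
have cfbar k x : U x -> {for x, continuous (fun x => f x + k * bar x)}.
  move=> Ux; apply: (@smooth_continuous _ _ _ U) => //; apply: smoothD => //.
  by apply: smoothM => //; exact: smooth_cst.
have cDq : compact Dq by exact: compact_ball_sqdist.
pose E := [set x | sqdist q x = e].
have ED x : E x -> Dq x by rewrite /Dq /= => ->.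
have eq_neq x : E x -> x != q.
  by move=> Ex; rewrite -sqdist_eq0 Ex gt_eqF.
have [eps eps0 epsP] : exists2 eps, 0 < eps & forall x, E x ->
    f x + eps * bar x < mu.
  (* Where [s < 0] on the sphere, [bar < 0] already suffices. The remaining part [E'] is compact,
     lies in the ball of centre [y] through [q] and misses [q], so [f] stays away from [mu]
     there. *)
  pose E' := (Dq `&` sqdist q @^-1` [set e]) `&` s @^-1` [set t | 0 <= t].
  have cE' : compact E'.
    apply: (subclosed_compact _ cDq); last by move=> x [[]].
    apply: closed_setI_preimage; [|by move=> x _; exact: cs|exact: closed_ge].
    apply: closed_setI_preimage; [|by move=> x _; exact: continuous_sqdist|exact: (@closed_eq R e)].
    rewrite (_ : Dq = sqdist q @^-1` [set z | z <= e])//.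
    by apply: preimage_closed; [move=> x _; exact: continuous_sqdist|exact: closed_le].
  have EE' x : E x -> 0 <= s x -> E' x by move=> Ex sx; split=> //; split=> //; exact: ED.
  have lt_neg k x : 0 < k -> E x -> s x < 0 -> f x + k * bar x < mu.
    move=> k0 Ex sx; have [Ux _ _] := DqP x (ED x Ex).
    have := bar_lt0 x (ED x Ex) sx; have := fmu x Ux; move: (bar x) (f x) => b g gmu b0.
    by rewrite -[mu]addr0 ler_ltD// pmulr_rlt0.
  have [E'0|/set0P E'0] := eqVneq E' set0.
    exists 1 => // x Ex; apply: lt_neg => //; rewrite ltNge; apply/negP => sx.
    by have := EE' x Ex sx; rewrite E'0.
  have [z [[Dz Ez] sz0] zmax] : exists2 z, E' z & forall x, E' x -> f x <= f z.
    apply: compact_max => // x [[Dx _] _]; apply: cf.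
    by have [] := DqP x Dx.
  have fz : f z < mu by apply: f_lt => //; exact: eq_neq.
  have yq0 : 0 < 2 * sqdist y q by rewrite mulr_gt0// lt_def sqdist_eq0 qy sqdist_ge0.
  (* Since [bar <= 2 * sqdist y q] on [E'], this [eps] uses up at most half of the gap
     [mu - f z]. *)
  exists ((mu - f z) / (2 * sqdist y q) / 2).
    by rewrite !divr_gt0// subr_gt0.
  set k := _ / 2; have k0 : 0 < k by rewrite /k !divr_gt0// subr_gt0.
  move=> x Ex; have [sx|sx] := ltP (s x) 0; first exact: lt_neg.
  apply: (@le_lt_trans _ _ (f z + k * (2 * sqdist y q))).
    apply: lerD; first exact: zmax (EE' _ Ex sx).
    by rewrite ler_pM2l//; apply: bar_le => //; exact: ED.
  rewrite /k mulrAC divfK ?gt_eqF//; lra.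
have [z Dz zmax] : exists2 z, Dq z & forall x, Dq x -> f x + eps * bar x <= f z + eps * bar z.
  apply: compact_max => //; last by move=> x /DqP[Ux _ _]; exact: cfbar.
  by exists q; rewrite /Dq /= sqdistxx ltW.
have zint : sqdist q z < e.
  rewrite lt_neqAle Dz andbT; apply/eqP => Ez.
  have := zmax q; rewrite /bar sq0 !mulr0 addr0 mulr0 addr0 fq => /(_ _) h.
  have : mu <= f z + eps * bar z by apply: h; rewrite /Dq /= sqdistxx ltW.
  by rewrite leNgt epsP.
have : L (fun x => f x + eps * bar x) z <= 0.
  have [Uz _ _] := DqP z Dz.
  apply: local_max_drift_laplacian => //.
    by apply: smoothD => //; apply: smoothM => //; exact: smooth_cst.
  have : \forall x \near z, sqdist q x < e.
    by have /cvgr_lt := @continuous_sqdist R m q z; apply.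
  by apply: filterS => x xe; apply: zmax; exact: ltW.
have [Uz Lz _] := DqP z Dz.
have seb : smooth_on U (fun x => eps * bar x).
  by apply: smoothM => //; exact: smooth_cst.
rewrite (drift_laplacianD Uz sf seb) (drift_laplacianZ eps Uz sbar) leNgt => /negP[].
by rewrite ltr_wpDl ?Lf// mulr_gt0.
Qed.

End StrongMaximum.

(** * Tangential derivations of an immersion *)

Definition smooth_mx {R : realType} {m a b : nat} (U : set 'rV[R]_m)
    (A : 'rV[R]_m -> 'M[R]_(a, b)) : Prop :=
  forall i j, smooth_on U (fun u => A u i j).

Definition vf_mx {R : realType} {m p a b : nat} (W : 'rV[R]_m -> 'M[R]_(m, p))
    (d : 'I_p) (A : 'rV[R]_m -> 'M[R]_(a, b)) (u : 'rV[R]_m) : 'M[R]_(a, b) :=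
  \matrix_(i, j) vf W d (fun x => A x i j) u.

Section MatrixFields.
Context {R : realType} {m p : nat} (U : set 'rV[R]_m).
Context (W : 'rV[R]_m -> 'M[R]_(m, p)).
Hypothesis oU : open U.
Hypothesis sW : smooth_mx U W.
Local Notation D := (vf W).
Local Notation DM := (vf_mx W).

Lemma smooth_mx_cst a b (B : 'M[R]_(a, b)) : smooth_mx U (fun=> B).
Proof. by move=> i j; exact: smooth_cst. Qed.

Lemma smooth_mxM a b c (A : 'rV[R]_m -> 'M[R]_(a, b)) (B : 'rV[R]_m -> 'M[R]_(b, c)) :
  smooth_mx U A -> smooth_mx U B -> smooth_mx U (fun u => A u *m B u).
Proof.
move=> sA sB i j; under eq_fun do rewrite mxE.
by apply: smooth_sum => // k; exact: smoothM.
Qed.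

Lemma smooth_mxD a b (A B : 'rV[R]_m -> 'M[R]_(a, b)) :
  smooth_mx U A -> smooth_mx U B -> smooth_mx U (fun u => A u + B u).
Proof. by move=> sA sB i j; under eq_fun do rewrite mxE; exact: smoothD. Qed.

Lemma smooth_mxN a b (A : 'rV[R]_m -> 'M[R]_(a, b)) :
  smooth_mx U A -> smooth_mx U (fun u => - A u).
Proof. by move=> sA i j; under eq_fun do rewrite mxE; exact: smoothN. Qed.

Lemma smooth_mxT a b (A : 'rV[R]_m -> 'M[R]_(a, b)) :
  smooth_mx U A -> smooth_mx U (fun u => (A u)^T).
Proof. by move=> sA i j; under eq_fun do rewrite mxE; exact: sA. Qed.

Lemma smooth_vf_mx d a b (A : 'rV[R]_m -> 'M[R]_(a, b)) :
  smooth_mx U A -> smooth_mx U (DM d A).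
Proof. by move=> sA i j; under eq_fun do rewrite mxE; exact: smooth_vf. Qed.

Lemma smooth_det n (A : 'rV[R]_m -> 'M[R]_n) :
  smooth_mx U A -> smooth_on U (fun u => \det (A u)).
Proof.
move=> sA; apply: smooth_sum => // s; apply: smoothM => //; first exact: smooth_cst.
by apply: smooth_prod.
Qed.

Lemma smooth_mx_inv n (A : 'rV[R]_m -> 'M[R]_n) :
  (forall u, U u -> A u \in unitmx) ->
  smooth_mx U A -> smooth_mx U (fun u => invmx (A u)).
Proof.
move=> Au sA i j.
apply: (@eq_smooth _ _ _ _ (fun u => (\det (A u))^-1 * cofactor (A u) j i)) => //.
  by move=> u Uu; rewrite /invmx Au// !mxE.
apply: smoothM => //; first apply: smoothV => //.
- by move=> u /Au; rewrite unitmxE unitfE.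
- exact: smooth_det.
apply: smoothM => //; first exact: smooth_cst.
apply: smooth_det => k l; under eq_fun do rewrite !mxE.
exact: sA.
Qed.

Lemma eq_vf_mx d a b (A B : 'rV[R]_m -> 'M[R]_(a, b)) u : U u ->
  (forall x, U x -> A x = B x) -> DM d A u = DM d B u.
Proof.
move=> Uu AB; apply/matrixP => i j; rewrite !mxE.
by apply: (eq_vf W oU) => // x Ux; rewrite AB.
Qed.

Lemma vf_mx_cst d a b (B : 'M[R]_(a, b)) u : DM d (fun=> B) u = 0.
Proof. by apply/matrixP => i j; rewrite !mxE; exact: vf_cst. Qed.

Lemma vf_mxD d a b (A B : 'rV[R]_m -> 'M[R]_(a, b)) u : U u ->
  smooth_mx U A -> smooth_mx U B ->
  DM d (fun x => A x + B x) u = DM d A u + DM d B u.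
Proof.
move=> Uu sA sB; apply/matrixP => i j; rewrite !mxE.
under [in LHS]eq_fun do rewrite mxE.
exact: (vfD W d Uu (sA i j) (sB i j)).
Qed.

Lemma vf_mxN d a b (A : 'rV[R]_m -> 'M[R]_(a, b)) u : U u ->
  smooth_mx U A -> DM d (fun x => - A x) u = - DM d A u.
Proof.
move=> Uu sA; apply/matrixP => i j; rewrite !mxE.
under [in LHS]eq_fun do rewrite mxE.
exact: (vfN W oU d Uu (sA i j)).
Qed.

Lemma vf_mxT d a b (A : 'rV[R]_m -> 'M[R]_(a, b)) u :
  DM d (fun x => (A x)^T) u = (DM d A u)^T.
Proof.
by apply/matrixP => i j; rewrite !mxE; under eq_fun do rewrite mxE.
Qed.

Lemma vf_mxM d a b c (A : 'rV[R]_m -> 'M[R]_(a, b)) (B : 'rV[R]_m -> 'M[R]_(b, c)) u :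
  U u -> smooth_mx U A -> smooth_mx U B ->
  DM d (fun x => A x *m B x) u = DM d A u *m B u + A u *m DM d B u.
Proof.
move=> Uu sA sB; apply/matrixP => i j; rewrite !mxE.
under [in LHS]eq_fun do rewrite mxE.
rewrite (vf_sum W d _ _ Uu) => [|k]; last exact: smoothM.
rewrite -big_split; apply: eq_bigr => k _ /=; rewrite !mxE.
exact: (vfM W d Uu (sA i k) (sB k j)).
Qed.

Lemma vf_mxMr d a b c (A : 'rV[R]_m -> 'M[R]_(a, b)) (B : 'M[R]_(b, c)) u :
  U u -> smooth_mx U A -> DM d (fun x => A x *m B) u = DM d A u *m B.
Proof.
move=> Uu sA; rewrite (vf_mxM d Uu sA (@smooth_mx_cst _ _ B)) vf_mx_cst.
by rewrite mulmx0 addr0.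
Qed.

Lemma vf_mxtrace d n (A : 'rV[R]_m -> 'M[R]_n) u : U u -> smooth_mx U A ->
  D d (fun x => \tr (A x)) u = \tr (DM d A u).
Proof.
move=> Uu sA; rewrite (vf_sum W d _ _ Uu) => [|k]; last exact: sA.
by apply: eq_bigr => k _; rewrite mxE.
Qed.

End MatrixFields.

(** Row [i] is the dual basis vector [g^ij d_j F]; column [a] holds the chart coefficients of the
    tangential part of the [a]-th ambient basis vector. Accordingly [tproj] is [J^T (J J^T)^-1 J],
    the orthogonal projection onto the tangent space, acting on row vectors. *)
Definition tangent_frame {R : realType} {m p : nat} (F : 'rV[R]_m -> 'rV[R]_p)
    (u : 'rV[R]_m) : 'M[R]_(m, p) :=
  invmx (gram F u) *m 'J F u.

Definition tproj {R : realType} {m p : nat} (F : 'rV[R]_m -> 'rV[R]_p)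
    (u : 'rV[R]_m) : 'M[R]_p :=
  ('J F u)^T *m tangent_frame F u.

Section Euclid.
Context {R : realType} {p : nat}.
Implicit Types x y : 'rV[R]_p.

Lemma edotE x y : edot x y = (x *m y^T) 0 0.
Proof. by rewrite mxE; apply: eq_bigr => i _; rewrite mxE. Qed.

Lemma edotC x y : edot x y = edot y x.
Proof. by apply: eq_bigr => i _; rewrite mulrC. Qed.

Lemma edot_ge0 x : 0 <= edot x x.
Proof. by apply: sumr_ge0 => i _; rewrite -expr2 sqr_ge0. Qed.

Lemma edot_eq0 x : (edot x x == 0) = (x == 0).
Proof.
apply/idP/eqP => [|->]; last by rewrite edotE mul0mx mxE.
rewrite psumr_eq0 => [/allP x0|i _]; last by rewrite -expr2 sqr_ge0.
apply/rowP => i; have := x0 i (mem_index_enum i).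
by rewrite mxE /= -expr2 sqrf_eq0 => /eqP.
Qed.

Lemma mulmx_tr_eq0 k (A : 'M[R]_(k, p)) : A *m A^T = 0 -> A = 0.
Proof.
move=> AA; apply/row_matrixP => i; rewrite row0; apply/eqP.
rewrite -edot_eq0; apply/eqP.
have := congr1 (fun M : 'M[R]_k => M i i) AA; rewrite !mxE => <-.
by apply: eq_bigr => j _; rewrite !mxE.
Qed.

End Euclid.

Lemma gram_unit {R : realType} {m p : nat} (F : 'rV[R]_m -> 'rV[R]_p) u :
  row_free ('J F u) -> gram F u \in unitmx.
Proof.
move=> freeJ; rewrite -row_free_unit -kermx_eq0; apply/eqP.
have : kermx (gram F u) *m 'J F u = 0.
  apply: mulmx_tr_eq0; rewrite trmx_mul mulmxA -(mulmxA _ ('J F u)) -/(gram F u).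
  by rewrite mulmx_ker mul0mx.
move/(congr1 (mulmx^~ (pinvmx ('J F u)))); rewrite mul0mx -mulmxA.
by rewrite (mulmxVp freeJ) mulmx1.
Qed.

(** * The tangential projection and the commutators of the tangential derivations *)

Section Immersion.
Context {R : realType} {m p : nat} (U : set 'rV[R]_m) (F : 'rV[R]_m -> 'rV[R]_p).
Hypothesis oU : open U.
Hypothesis sF : smooth_on U F.
Hypothesis freeJ : forall u, U u -> row_free ('J F u).
Local Notation W := (tangent_frame F).
Local Notation P := (tproj F).
Local Notation D := (vf W).
Local Notation DM := (vf_mx W).

Lemma jacobian_entry u i a : U u -> 'J F u i a = partial i (fun x => F x 0 a) u.
Proof.
move=> Uu; have dF := smooth_differentiable sF Uu.
by rewrite partial_entry// partialE// mxE.
Qed.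

Lemma smooth_jacobian : smooth_mx U (fun u => 'J F u).
Proof.
move=> i a; apply: (@eq_smooth _ _ _ _ (partial i (fun x => F x 0 a))) => //.
  by move=> x Ux; rewrite jacobian_entry.
by apply: smooth_partial; exact: smooth_entry.
Qed.

Lemma gram_sym u : (gram F u)^T = gram F u.
Proof. by rewrite trmx_mul trmxK. Qed.

Lemma smooth_frame : smooth_mx U W.
Proof.
apply: smooth_mxM => //; last exact: smooth_jacobian.
apply: smooth_mx_inv => //; first by move=> u Uu; exact: gram_unit (freeJ Uu).
by apply: smooth_mxM => //; [|apply: smooth_mxT => //]; exact: smooth_jacobian.
Qed.

Lemma smooth_tproj : smooth_mx U P.
Proof.
by apply: smooth_mxM => //; [apply: smooth_mxT => //; exact: smooth_jacobian|
  exact: smooth_frame].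
Qed.

Lemma smooth_mx_map : smooth_mx U F.
Proof. by move=> i a; rewrite (ord1 i); exact: smooth_entry. Qed.

Lemma frame_jacobian u : U u -> 'J F u *m (W u)^T = 1%:M.
Proof.
move=> Uu; rewrite trmx_mul trmx_inv gram_sym mulmxA.
exact: mulmxV (gram_unit (freeJ Uu)).
Qed.

Lemma frame_free u : U u -> row_free (W u).
Proof.
move=> Uu; apply/row_freeP; exists ('J F u)^T.
by rewrite -[LHS]trmxK trmx_mul trmxK frame_jacobian// trmx1.
Qed.

Lemma frame_gram u : U u -> W u *m (W u)^T = invmx (gram F u).
Proof. by move=> Uu; rewrite -mulmxA frame_jacobian// mulmx1. Qed.

Lemma tproj_sym u : (P u)^T = P u.
Proof. by rewrite /tproj !trmx_mul trmxK trmx_inv gram_sym mulmxA. Qed.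

Lemma tprojE u : P u = (W u)^T *m 'J F u.
Proof. by rewrite -tproj_sym trmx_mul trmxK. Qed.

Lemma jacobian_tproj u : U u -> 'J F u *m P u = 'J F u.
Proof. by move=> Uu; rewrite tprojE mulmxA frame_jacobian// mul1mx. Qed.

Lemma frame_tproj u : U u -> W u *m P u = W u.
Proof. by move=> Uu; rewrite -mulmxA jacobian_tproj. Qed.

Lemma tproj_idem u : U u -> P u *m P u = P u.
Proof. by move=> Uu; rewrite {1}/tproj -mulmxA frame_tproj. Qed.

Lemma mxtrace_tproj u : U u -> \tr (P u) = m%:R.
Proof.
by move=> Uu; rewrite tprojE mxtrace_mulC frame_jacobian// mxtrace1.
Qed.

Lemma normal_projE u (w : 'rV[R]_p) : normal_proj F u w = w - w *m P u.
Proof. by rewrite /normal_proj /tproj !mulmxA. Qed.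

Lemma vf_partial u i f : U u -> partial i f u = \sum_(a < p) 'J F u i a * D a f u.
Proof.
move=> Uu.
transitivity (('J F u *m (W u)^T *m \col_j partial j f u) i 0).
  by rewrite frame_jacobian// mul1mx mxE.
rewrite -mulmxA mxE; apply: eq_bigr => a _; congr (_ * _); rewrite [LHS]mxE.
by apply: eq_bigr => j _; rewrite mxE [(\col_j _) _ _]mxE.
Qed.

Lemma vf_tangent u a f : U u -> D a f u = \sum_(b < p) P u a b * D b f u.
Proof.
move=> Uu; rewrite /vf; under eq_bigr => i _ do rewrite vf_partial// mulr_sumr.
rewrite exchange_big; apply: eq_bigr => b _; rewrite tprojE mxE mulr_suml.
by apply: eq_bigr => i _; rewrite [_^T _ _]mxE mulrA.
Qed.

Lemma vf_map u a : U u -> DM a F u = row a (P u).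
Proof.
move=> Uu; apply/rowP => b; rewrite mxE [RHS]mxE tprojE mxE.
by apply: eq_bigr => i _; rewrite [_^T _ _]mxE jacobian_entry.
Qed.

(** Second derivatives cancel by [partialC], so the commutator is a tangent vector field. Such a
    field is determined by its values on the coordinates of [F], where [D b F_c = P b c]; this is
    how the derivatives of [P] enter. *)
Lemma vf_commutator u a b f : U u -> smooth_on U f ->
  D a (D b f) u - D b (D a f) u =
  \sum_(c < p) (DM a P u b c - DM b P u a c) * D c f u.
Proof.
move=> Uu sf; pose C j := D a (fun x => W x j b) u - D b (fun x => W x j a) u.
have comm g : smooth_on U g ->
    D a (D b g) u - D b (D a g) u = \sum_(j < m) C j * partial j g u.
  move=> sg; have sWp c j : smooth_on U (fun x => W x j c * partial j g x).
    by apply: smoothM => //; [exact: smooth_frame|exact: smooth_partial].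
  have E c d : D c (D d g) u = \sum_(j < m) D c (fun x => W x j d) u * partial j g u +
      \sum_(i < m) \sum_(j < m) W u i c * W u j d * partial i (partial j g) u.
    rewrite [in LHS](_ : D d g = (fun x => \sum_(j < m) W x j d * partial j g x))//.
    rewrite (vf_sum W c _ _ Uu) => [|j]; last exact: sWp.
    rewrite [X in _ = _ + X]exchange_big -big_split; apply: eq_bigr => j _ /=.
    have -> := vfM W c Uu (smooth_frame j d) (smooth_partial j sg); congr (_ + _).
    by rewrite mulr_sumr; apply: eq_bigr => i _; rewrite mulrA (mulrC (W u j d)).
  rewrite !E [X in _ - (_ + X)]exchange_big /=.
  rewrite [X in _ - (_ + X)](_ : _ = \sum_(i < m) \sum_(j < m)
      W u i a * W u j b * partial i (partial j g) u); last first.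
    apply: eq_bigr => i _; apply: eq_bigr => j _.
    by rewrite (partialC j i oU sg Uu) (mulrC (W u j b)).
  rewrite opprD addrACA subrr addr0 -sumrB.
  by apply: eq_bigr => j _; rewrite -mulrBl.
rewrite comm//; under eq_bigr => j _ do rewrite vf_partial// mulr_sumr.
rewrite exchange_big; apply: eq_bigr => c _.
under eq_bigr => j _ do rewrite mulrA; rewrite -mulr_suml; congr (_ * _).
have sc := smooth_entry c oU sF.
have := comm _ sc; under [in RHS]eq_bigr => j _ do rewrite -jacobian_entry//.
move=> <-; rewrite !mxE.
have E d x : U x -> D d (fun x => F x 0 c) x = P x d c.
  by move=> Ux; have := congr1 (fun M : 'rV[R]_p => M 0 c) (vf_map d Ux); rewrite !mxE.
by rewrite (eq_vf W oU a Uu (E b)) (eq_vf W oU b Uu (E a)).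
Qed.

End Immersion.

(** * The second fundamental form as the derivative of the tangential projection *)

Section SecondForm.
Context {R : realType} {m p : nat} (U : set 'rV[R]_m) (F : 'rV[R]_m -> 'rV[R]_p).
Hypothesis oU : open U.
Hypothesis sF : smooth_on U F.
Hypothesis freeJ : forall u, U u -> row_free ('J F u).
Local Notation W := (tangent_frame F).
Local Notation P := (tproj F).
Local Notation D := (vf W).
Local Notation DM := (vf_mx W).
Local Notation S a := (vf_mx (tangent_frame F) a (tproj F)).

Let sW : smooth_mx U W := smooth_frame oU sF freeJ.
Let sP : smooth_mx U P := smooth_tproj oU sF freeJ.

Lemma vf_tproj_sym a u : (S a u)^T = S a u.
Proof.
rewrite -vf_mxT; congr (vf_mx _ _ _ _); apply/funext => x; exact: tproj_sym.
Qed.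

Lemma vf_tproj_idem a u : U u -> S a u *m P u + P u *m S a u = S a u.
Proof.
move=> Uu; rewrite -(vf_mxM W oU a Uu sP sP).
by apply: (eq_vf_mx W oU) => // x Ux; exact: (tproj_idem freeJ Ux).
Qed.

(** The normal part of the [k]-th basis vector gives the zero derivation, because [D k] is already
    [\sum_b P k b D b]. *)
Lemma vf_tproj_tangent k u : U u -> \sum_(a < p) (1%:M - P u) k a *: S a u = 0.
Proof.
move=> Uu; under eq_bigr => a _ do rewrite !mxE scalerBl.
rewrite sumrB; apply/eqP; rewrite subr_eq0; apply/eqP/matrixP => i j.
rewrite !summxE (bigD1 k)//= big1 => [|a ak]; last first.
  by rewrite eq_sym (negbTE ak) scale0r mxE.
rewrite eqxx scale1r addr0 mxE (vf_tangent freeJ k _ Uu).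
apply: eq_bigr => b _; rewrite [RHS]mxE; congr (_ * _); rewrite mxE; reflexivity.
Qed.

Lemma second_ffE u i j k : U u ->
  second_ff F u i j 0 k =
  ((\row_l partial i (partial j (fun x => F x 0 l)) u) *m (1%:M - P u)) 0 k.
Proof.
move=> Uu; rewrite /second_ff normal_projE mulmxBr mulmx1.
suff -> : partial i (partial j F) u =
    \row_l partial i (partial j (fun x => F x 0 l)) u by [].
apply/rowP => l; rewrite mxE -partial_entry; last first.
  exact (smooth_differentiable (smooth_partial j sF) Uu).
apply: near_eq_partial; apply: (open_near_eq oU Uu) => x Ux.
by rewrite -partial_entry//; exact (smooth_differentiable sF Ux).
Qed.

Lemma second_ff_sym u i j : U u -> second_ff F u i j = second_ff F u j i.
Proof.
move=> Uu; apply/rowP => k; refine (etrans (second_ffE i j k Uu) (etrans _ (esym (second_ffE j i k Uu)))).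
refine (congr1 (fun G : 'I_p -> R => ((\row_l G l) *m (1%:M - P u)) 0 k) _).
apply/funext => l; exact (partialC i j oU (smooth_entry l oU sF) Uu).
Qed.

(** Write [P = W^T J]. The derivative of [W^T] is followed by [J (1 - P) = 0]; the derivative of [J]
    consists of second derivatives of [F], whose normal part is [II]. So row [b] is [II] on the
    tangential parts of the basis vectors [a] and [b]. *)
Lemma vf_tproj_second_ff a b k u : U u ->
  (S a u *m (1%:M - P u)) b k =
  \sum_(i < m) \sum_(j < m) W u i a * W u j b * second_ff F u i j 0 k.
Proof.
move=> Uu; have sJ := smooth_jacobian oU sF.
have sWT : smooth_mx U (fun x => (W x)^T) by exact: smooth_mxT.
have -> : S a u = DM a (fun x => (W x)^T) u *m 'J F u + (W u)^T *m DM a (fun x => 'J F x) u.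
  rewrite -(vf_mxM W oU a Uu sWT sJ); apply: (eq_vf_mx W oU) => // x _.
  exact: tprojE.
rewrite mulmxDl -mulmxA mulmxBr mulmx1 (jacobian_tproj freeJ Uu) subrr mulmx0 add0r.
rewrite -mulmxA mxE exchange_big; apply: eq_bigr => j _ /=.
rewrite [_^T _ _]mxE.
transitivity (W u j b * \sum_(i < m) W u i a * second_ff F u i j 0 k); last first.
  by rewrite mulr_sumr; apply: eq_bigr => i _; rewrite mulrCA mulrA.
congr (_ * _); rewrite mxE.
transitivity (\sum_(i < m) \sum_(l < p)
    W u i a * (partial i (partial j (fun x => F x 0 l)) u * (1%:M - P u) l k)).
  rewrite exchange_big; apply: eq_bigr => l _ /=.
  rewrite [vf_mx _ _ _ _ _ _]mxE mulr_suml; apply: eq_bigr => i _.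
  rewrite -mulrA; congr (_ * (_ * _)).
  apply: near_eq_partial; apply: (open_near_eq oU Uu) => x Ux.
  exact: (jacobian_entry sF _ _ Ux).
apply: eq_bigr => i _; rewrite second_ffE// [X in _ * X]mxE mulr_sumr; apply: eq_bigr => l _.
by rewrite [(\row_l _) _ _]mxE.
Qed.

Lemma second_fundamental_sym a b u : U u ->
  row b (S a u *m (1%:M - P u)) = row a (S b u *m (1%:M - P u)).
Proof.
move=> Uu; apply/rowP => k; rewrite mxE [RHS]mxE !vf_tproj_second_ff//.
rewrite exchange_big; apply: eq_bigr => i _; apply: eq_bigr => j _ /=.
by rewrite (second_ff_sym _ _ Uu) (mulrC (W u j a)).
Qed.

Lemma inv_gramE u i j : U u ->
  invmx (gram F u) i j = \sum_(a < p) W u i a * W u j a.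
Proof.
move=> Uu; rewrite -(frame_gram freeJ Uu) mxE.
by apply: eq_bigr => a _; rewrite [_^T _ _]mxE.
Qed.

(** Since [g^ij = \sum_a W i a W j a], contraction with the inverse metric becomes a plain sum over
    ambient indices. The same substitution, made twice, gives [second_ff_sqnormE]. *)
Lemma mean_curvatureE u : U u ->
  mean_curvature F u = \sum_(a < p) row a (S a u *m (1%:M - P u)).
Proof.
move=> Uu; apply/rowP => k; rewrite !summxE.
under [RHS]eq_bigr => a _ do rewrite mxE vf_tproj_second_ff//.
rewrite exchange_big; apply: eq_bigr => i _ /=; rewrite summxE exchange_big.
apply: eq_bigr => j _ /=; rewrite mxE inv_gramE// mulr_suml.
exact: eq_bigr.
Qed.

Lemma second_ff_sqnormE u : U u ->
  second_ff_sqnorm F u =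
  \sum_(a < p) \sum_(b < p) edot (row b (S a u *m (1%:M - P u))) (row b (S a u *m (1%:M - P u))).
Proof.
move=> Uu; pose II i j := second_ff F u i j.
have E a b : row b (S a u *m (1%:M - P u)) =
    \sum_(i < m) \sum_(j < m) (W u i a * W u j b) *: II i j.
  apply/rowP => k; rewrite mxE vf_tproj_second_ff// summxE.
  by apply: eq_bigr => i _; rewrite summxE; apply: eq_bigr => j _; rewrite [RHS]mxE.
have edot_suml (I : finType) (v : I -> 'rV[R]_p) w :
    edot (\sum_i v i) w = \sum_i edot (v i) w.
  rewrite edotE mulmx_suml summxE; apply: eq_bigr => i _; by rewrite edotE.
have edotZl k (v w : 'rV[R]_p) : edot (k *: v) w = k * edot v w.
  by rewrite !edotE -scalemxAl mxE.
have edotZr k (v w : 'rV[R]_p) : edot w (k *: v) = k * edot w v.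
  by rewrite edotC edotZl edotC.
have edot_sumr (I : finType) (v : I -> 'rV[R]_p) w :
    edot w (\sum_i v i) = \sum_i edot w (v i).
  by rewrite edotC edot_suml; apply: eq_bigr => i _; rewrite edotC.
pose T a b i j k l := W u i a * W u j b * (W u k a * W u l b) * edot (II i j) (II k l).
transitivity (\sum_(a < p) \sum_(b < p) \sum_(i < m) \sum_(j < m) \sum_(k < m) \sum_(l < m)
    T a b i j k l); last first.
  apply: eq_bigr => a _; apply: eq_bigr => b _; rewrite E edot_suml.
  apply: eq_bigr => i _; rewrite edot_suml; apply: eq_bigr => j _.
  rewrite edot_sumr; apply: eq_bigr => k _; rewrite edot_sumr; apply: eq_bigr => l _.
  by rewrite edotZl edotZr mulrA.
under [RHS]eq_bigr => a _ do rewrite exchange_big.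
rewrite [RHS]exchange_big; apply: eq_bigr => i _.
under [RHS]eq_bigr => a _ do rewrite exchange_big.
rewrite [RHS]exchange_big; apply: eq_bigr => j _.
under [RHS]eq_bigr => a _ do rewrite exchange_big.
rewrite [RHS]exchange_big; apply: eq_bigr => k _.
under [RHS]eq_bigr => a _ do rewrite exchange_big.
rewrite [RHS]exchange_big; apply: eq_bigr => l _.
rewrite !inv_gramE// /T /II; move: (edot _ _) => e; rewrite mulr_suml mulr_suml.
apply: eq_bigr => a _.
rewrite mulr_sumr mulr_suml; apply: eq_bigr => b _.
by ring.
Qed.

End SecondForm.

(** * The shrinker equation *)

Lemma sym_mxtrace_ge0 {R : realType} n (A : 'M[R]_n) : A^T = A -> 0 <= \tr (A *m A).
Proof.
move=> AT; rewrite -{2}AT; apply: sumr_ge0 => i _; rewrite mxE.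
by apply: sumr_ge0 => j _; rewrite mxE -expr2 sqr_ge0.
Qed.

Lemma sym_mxtrace_eq0 {R : realType} n (A : 'M[R]_n) : A^T = A ->
  \tr (A *m A) = 0 -> A = 0.
Proof.
move=> AT /eqP; rewrite -{2}AT psumr_eq0 => [/allP A0|i _]; last first.
  by rewrite mxE; apply: sumr_ge0 => j _; rewrite mxE -expr2 sqr_ge0.
apply/row_matrixP => i; rewrite row0; apply/eqP; rewrite -edot_eq0.
have /eqP := A0 i (mem_index_enum i); rewrite mxE => E; apply/eqP; rewrite -[RHS]E.
by apply: eq_bigr => j _; rewrite !mxE.
Qed.

Section EdotAlgebra.
Context {R : realType} {p : nat}.
Implicit Types v w : 'rV[R]_p.

Lemma edotDl v v' w : edot (v + v') w = edot v w + edot v' w.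
Proof. by rewrite !edotE mulmxDl mxE. Qed.

Lemma edotDr v w w' : edot v (w + w') = edot v w + edot v w'.
Proof. by rewrite edotC edotDl !(edotC v). Qed.

Lemma edotZl k v w : edot (k *: v) w = k * edot v w.
Proof. by rewrite !edotE -scalemxAl mxE. Qed.

Lemma edotZr k v w : edot v (k *: w) = k * edot v w.
Proof. by rewrite edotC edotZl edotC. Qed.

Lemma edotNl v w : edot (- v) w = - edot v w.
Proof. by rewrite -scaleN1r edotZl mulN1r. Qed.

Lemma edotNr v w : edot v (- w) = - edot v w.
Proof. by rewrite edotC edotNl edotC. Qed.

Lemma edotBl v v' w : edot (v - v') w = edot v w - edot v' w.
Proof. by rewrite edotDl edotNl. Qed.

Lemma edotBr v w w' : edot v (w - w') = edot v w - edot v w'.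
Proof. by rewrite edotDr edotNr. Qed.

Lemma edot0l w : edot 0 w = 0.
Proof. by rewrite edotE mul0mx mxE. Qed.

Lemma edot0r v : edot v 0 = 0.
Proof. by rewrite edotC edot0l. Qed.

Lemma edot_suml (I : finType) (v : I -> 'rV[R]_p) w :
  edot (\sum_i v i) w = \sum_i edot (v i) w.
Proof. by rewrite edotE mulmx_suml summxE; apply: eq_bigr => i _; rewrite edotE. Qed.

Lemma edot_mulmx q v (A : 'M[R]_(p, q)) (w : 'rV[R]_q) :
  edot (v *m A) w = edot v (w *m A^T).
Proof. by rewrite !edotE trmx_mul trmxK mulmxA. Qed.

End EdotAlgebra.

(** The interface of the shrinker computation, free of Jacobians: below, the immersion enters only
    through [P], the position [x] and the derivations. The geometric content lies in [tc_vf_map],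
    [tc_second_sym] and [tc_commutator]. *)
Record tangent_calculus {R : realType} {m p : nat} (U : set 'rV[R]_m)
    (W : 'rV[R]_m -> 'M[R]_(m, p)) (P : 'rV[R]_m -> 'M[R]_p)
    (x : 'rV[R]_m -> 'rV[R]_p) : Prop := TangentCalculus {
  tc_open : open U;
  tc_smooth_frame : smooth_mx U W;
  tc_smooth_proj : smooth_mx U P;
  tc_smooth_map : smooth_mx U x;
  tc_proj_sym : forall u, (P u)^T = P u;
  tc_proj_idem : forall u, U u -> P u *m P u = P u;
  tc_mxtrace_proj : forall u, U u -> \tr (P u) = m%:R;
  tc_vf_map : forall a u, U u -> vf_mx W a x u = row a (P u);
  tc_vf_proj_tangent : forall k u, U u -> \sum_(a < p) (1%:M - P u) k a *: vf_mx W a P u = 0;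
  tc_vf_proj_sym : forall a u, (vf_mx W a P u)^T = vf_mx W a P u;
  tc_vf_proj_idem : forall a u, U u -> vf_mx W a P u *m P u + P u *m vf_mx W a P u = vf_mx W a P u;
  tc_second_sym : forall a b u, U u ->
    row b (vf_mx W a P u *m (1%:M - P u)) = row a (vf_mx W b P u *m (1%:M - P u));
  tc_commutator : forall u a b f, U u -> smooth_on U f ->
    vf W a (vf W b f) u - vf W b (vf W a f) u =
    \sum_(d < p) (vf_mx W a P u b d - vf_mx W b P u a d) * vf W d f u
}.

Section Shrinker.
Context {R : realType} {m p : nat} (U : set 'rV[R]_m).
Context (W : 'rV[R]_m -> 'M[R]_(m, p)) (P : 'rV[R]_m -> 'M[R]_p).
Context (x : 'rV[R]_m -> 'rV[R]_p) (c : R).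
Local Notation D := (vf W).
Local Notation DM := (vf_mx W).
Local Notation S a := (vf_mx W a P).
Hypothesis TC : tangent_calculus U W P x.
Let oU := tc_open TC.
Let sW := tc_smooth_frame TC.
Let sP := tc_smooth_proj TC.
Let sx := tc_smooth_map TC.
Let PT := tc_proj_sym TC.
Let PP := tc_proj_idem TC.
Let trP := tc_mxtrace_proj TC.
Let Dx := tc_vf_map TC.
Let Stan := tc_vf_proj_tangent TC.
Let ST := tc_vf_proj_sym TC.
Let SPPS := tc_vf_proj_idem TC.
Let Ssym := tc_second_sym TC.
Let comm := tc_commutator TC.

(* [P] is the tangential projection and [D a] the derivative along the tangential
   part of the [a]-th basis vector, so that [II(e_a, e_b)] is row [b] of
   [S a *m (1%:M - P)], where [S a = D_a P]. *)
Definition normal_part (u : 'rV[R]_m) : 'rV[R]_p := x u - x u *m P u.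

Hypothesis soliton_eq : forall u, U u ->
  c *: normal_part u = \sum_(a < p) row a (S a u *m (1%:M - P u)).

Definition normal_sqnorm u : R := edot (normal_part u) (normal_part u).
(** This is the form [b = <II, h>] extended by zero to normal vectors, see [shape_entry]. Since
    [x P S a = x S a (1 - P)], [second_tangent a] is [II] of the [a]-th basis vector and [x^T]. *)
Definition shape u : 'M[R]_p := \matrix_(a, d) (normal_part u *m S a u) 0 d.
Definition second_tangent a u : 'rV[R]_p := x u *m P u *m S a u.

Lemma normal_part_tproj u : U u -> normal_part u *m P u = 0.
Proof. by move=> Uu; rewrite mulmxBl -mulmxA PP// subrr. Qed.

Lemma normal_part_nproj u : U u -> normal_part u *m (1%:M - P u) = normal_part u.
Proof. by move=> Uu; rewrite mulmxBr mulmx1 normal_part_tproj// subr0. Qed.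

Let sS a : smooth_mx U (S a).
Proof. exact (smooth_vf_mx oU sW a sP). Qed.

Lemma smooth_normal_part : smooth_mx U normal_part.
Proof.
apply: (smooth_mxD oU sx); apply: (smooth_mxN oU); exact (smooth_mxM oU sx sP).
Qed.

Lemma smooth_shape : smooth_mx U shape.
Proof.
move=> a d; apply: (eq_smooth oU _ (smooth_mxM oU smooth_normal_part (sS a) 0 d)) => u _.
by rewrite [RHS]mxE.
Qed.

Lemma smooth_normal_sqnorm : smooth_on U normal_sqnorm.
Proof.
apply: (smooth_sum _ _ oU) => i; exact (smoothM oU (smooth_normal_part 0 i) (smooth_normal_part 0 i)).
Qed.

Lemma vf_normal_part a u : U u -> DM a normal_part u = - (x u *m S a u).
Proof.
move=> Uu; have sxP := smooth_mxM oU sx sP.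
rewrite (vf_mxD W a Uu sx (smooth_mxN oU sxP)) (vf_mxN W oU a Uu sxP).
rewrite (vf_mxM W oU a Uu sx sP) !Dx// -row_mul PP//.
by rewrite opprD addrA subrr add0r.
Qed.

Lemma row_shape a u : row a (shape u) = normal_part u *m S a u.
Proof. by apply/rowP => d; rewrite !mxE. Qed.

Lemma normal_part_vf_tproj a u : U u -> normal_part u *m S a u *m P u = normal_part u *m S a u.
Proof.
move=> Uu; rewrite -[in RHS](SPPS a Uu) mulmxDr !mulmxA (normal_part_tproj Uu) mul0mx addr0.
by [].
Qed.

Lemma shape_entry a d u : U u ->
  shape u a d = edot (row d (S a u *m (1%:M - P u))) (normal_part u).
Proof.
move=> Uu; rewrite mxE row_mul edot_mulmx linearB /= trmx1 PT normal_part_nproj//.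
rewrite edotC /edot mxE; apply: eq_bigr => i _; rewrite [row _ _ _ _]mxE.
by rewrite -{1}ST [_^T _ _]mxE.
Qed.

Lemma shape_sym u : U u -> (shape u)^T = shape u.
Proof.
by move=> Uu; apply/matrixP => a d; rewrite [LHS]mxE !shape_entry// Ssym.
Qed.

Lemma shape_tproj u : U u -> shape u *m P u = shape u.
Proof. by move=> Uu; apply/row_matrixP => a; rewrite row_mul row_shape normal_part_vf_tproj. Qed.

Lemma tproj_shape u : U u -> P u *m shape u = shape u.
Proof. by move=> Uu; apply: trmx_inj; rewrite trmx_mul PT shape_sym// shape_tproj. Qed.

Lemma mxtrace_shape u : U u -> \tr (shape u) = c * normal_sqnorm u.
Proof.
move=> Uu; rewrite /normal_sqnorm -edotZl soliton_eq// edot_suml.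
by apply: eq_bigr => a _; rewrite shape_entry.
Qed.

Lemma tproj_vf_tproj a u : U u -> P u *m S a u *m P u = 0.
Proof.
move=> Uu; have := congr1 (mulmx (P u)) (SPPS a Uu); rewrite mulmxDr !mulmxA PP//.
by move/eqP; rewrite -subr_eq0 addrK => /eqP.
Qed.

Lemma second_tangent_tproj a u : U u -> second_tangent a u *m P u = 0.
Proof. by move=> Uu; rewrite /second_tangent -!mulmxA (mulmxA (P u)) tproj_vf_tproj// mulmx0. Qed.

Lemma map_vf_tproj a u : x u *m S a u = row a (shape u) + second_tangent a u.
Proof. by rewrite row_shape mulmxBl subrK. Qed.

Lemma edot_shape_second_tangent a u : U u -> edot (row a (shape u)) (second_tangent a u) = 0.
Proof.
by move=> Uu; rewrite row_shape -normal_part_vf_tproj// edot_mulmx PT second_tangent_tproj// edot0r.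
Qed.

Lemma vf_normal_sqnorm a u : U u -> D a normal_sqnorm u = -2 * (shape u *m (x u)^T) a 0.
Proof.
move=> Uu; have sh := smooth_normal_part.
rewrite /normal_sqnorm /edot (vf_sum W a _ _ Uu) => [|i]; last exact (smoothM oU (sh 0 i) (sh 0 i)).
transitivity (2 * edot (DM a normal_part u) (normal_part u)).
  rewrite mulr_sumr; apply: eq_bigr => i _.
  rewrite (vfM W a Uu (sh 0 i) (sh 0 i)) [vf_mx _ _ _ _ _ _]mxE; ring.
rewrite vf_normal_part// edotNl mulrN -mulNr; congr (_ * _).
rewrite edot_mulmx ST -row_shape edotC edotE.
by rewrite -row_mul mxE.
Qed.

(** The divergence of the projection is the mean curvature. The rows of [S a (1 - P)] add up to [H],
    while [S a P = (1 - P) S a] contributes derivatives in normal directions, which vanish. *)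
Lemma div_vf_tproj u g : U u -> \sum_(a < p) S a u g a = c * normal_part u 0 g.
Proof.
move=> Uu; have := congr1 (fun v : 'rV[R]_p => v 0 g) (soliton_eq Uu).
rewrite [LHS]mxE => ->; rewrite summxE.
have E a : S a u g a = row a (S a u *m (1%:M - P u)) 0 g + (row a (S a u *m P u)) 0 g.
  rewrite -[S a u g a]/((S a u) g a) -{1}ST mxE [X in _ = X + _]mxE [X in _ = _ + X]mxE.
  have := congr1 (fun M : 'M[R]_p => M a g) (mulmxDr (S a u) (1%:M - P u) (P u)).
  by rewrite subrK mulmx1 => ->; rewrite mxE.
rewrite (eq_bigr _ (fun a _ => E a)) big_split /= [X in _ + X](_ : _ = 0) ?addr0//.
have Q a : S a u *m P u = (1%:M - P u) *m S a u.
  by rewrite mulmxBl mul1mx -{2}(SPPS a Uu) addrK.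
transitivity (\sum_(k < p) (\sum_(a < p) (1%:M - P u) k a *: S a u) k g).
  under [RHS]eq_bigr => k _ do rewrite summxE.
  rewrite exchange_big; apply: eq_bigr => a _ /=; rewrite [LHS]mxE Q mxE.
  apply: eq_bigr => k _; rewrite [RHS]mxE; congr (_ * _).
  by rewrite -[in LHS]PT !mxE eq_sym.
by rewrite big1// => k _; rewrite Stan// mxE.
Qed.

Lemma vf_shape_entry a d e u : U u ->
  D a (fun z => shape z d e) u =
  (DM a normal_part u *m S d u) 0 e + \sum_(g < p) normal_part u 0 g * D a (D d (fun z => P z g e)) u.
Proof.
move=> Uu; rewrite (eq_vf W oU a (g := fun z => (normal_part z *m S d z) 0 e) Uu) => [|z _]; last by rewrite mxE.
have := congr1 (fun M : 'rV[R]_p => M 0 e) (vf_mxM W oU a Uu smooth_normal_part (sS d)).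
rewrite [LHS]mxE => ->; rewrite mxE; congr (_ + _); rewrite mxE; apply: eq_bigr => g _.
by rewrite [vf_mx _ _ _ _ _ _]mxE; congr (_ * _); apply: (eq_vf W oU) => // z _; rewrite mxE.
Qed.

(** A traced Codazzi equation: [D a] is commuted past [D d] so that it meets the divergence of [P],
    which is [c h] by the soliton equation. The last sum is the commutator. *)
Lemma div_shape d u : U u -> \sum_(a < p) D a (fun z => shape z d a) u =
  \sum_(a < p) (DM a normal_part u *m S d u) 0 a + c * edot (normal_part u) (DM d normal_part u) +
  \sum_(a < p) \sum_(e < p) (S a u d e - S d u a e) * shape u e a.
Proof.
move=> Uu; rewrite (eq_bigr _ (fun a _ => vf_shape_entry a d a Uu)) big_split -addrA.
congr (_ + _) => /=.
have E a g : D a (D d (fun z => P z g a)) u =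
    D d (D a (fun z => P z g a)) u + \sum_(e < p) (S a u d e - S d u a e) * S e u g a.
  apply/eqP; rewrite addrC -subr_eq; apply/eqP; rewrite comm//.
  by apply: eq_bigr => e _; rewrite [S e u g a]mxE.
under eq_bigr => a _ do under eq_bigr => g _ do rewrite E mulrDr.
under eq_bigr => a _ do rewrite big_split.
rewrite big_split /=; congr (_ + _).
  rewrite exchange_big /edot mulr_sumr; apply: eq_bigr => g _ /=.
  rewrite -mulr_sumr mulrCA; congr (_ * _).
  rewrite -(vf_sum W d _ _ Uu) => [|a]; last exact (smooth_vf oU sW a (sP g a)).
  rewrite mxE -(vfZ W d c Uu (smooth_normal_part 0 g)); apply: (eq_vf W oU) => // z Uz.
  by rewrite -div_vf_tproj//; apply: eq_bigr => a _; rewrite mxE.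
apply: eq_bigr => a _; under eq_bigr => g _ do rewrite mulr_sumr.
rewrite exchange_big; apply: eq_bigr => e _ /=.
rewrite [shape u e a]mxE [(normal_part u *m _) 0 a]mxE mulr_sumr; apply: eq_bigr => g _.
by rewrite mulrCA.
Qed.

Let Sx u : 'M[R]_p := \sum_(d < p) x u 0 d *: S d u.

Let row_SxQ a u : U u -> row a (Sx u *m (1%:M - P u)) = second_tangent a u.
Proof.
move=> Uu; rewrite mulmx_suml linear_sum /=.
transitivity (\sum_(d < p) x u 0 d *: row d (S a u *m (1%:M - P u))).
  by apply: eq_bigr => d _; rewrite -scalemxAl linearZ /= Ssym.
have -> : S a u *m (1%:M - P u) = P u *m S a u.
  by rewrite mulmxBr mulmx1 -{1}(SPPS a Uu) addrAC subrr add0r.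
rewrite /second_tangent -mulmxA mulmx_sum_row; exact: eq_bigr.
Qed.

Let PSxP u : U u -> P u *m Sx u *m P u = 0.
Proof.
move=> Uu; rewrite mulmx_sumr mulmx_suml big1// => d _.
by rewrite -scalemxAr -scalemxAl tproj_vf_tproj// scaler0.
Qed.

(** [D a h = - x S a] splits into minus a row of [b], which is tangential, and minus [II(e_a, x^T)].
    Row [a] of [Sx] is [II(e_a, x^T)] plus a row of [(1 - P) Sx], and the latter contributes a
    derivative in normal directions. Only the square of [II(e_a, x^T)] is left. *)
Let first_term u : U u ->
  \sum_(d < p) x u 0 d * \sum_(a < p) (DM a normal_part u *m S d u) 0 a =
  - \sum_(a < p) edot (second_tangent a u) (second_tangent a u).
Proof.
move=> Uu.
transitivity (- \sum_(a < p) edot (x u *m S a u) (row a (Sx u))).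
  rewrite -sumrN; under eq_bigr => d _ do rewrite mulr_sumr.
  rewrite exchange_big; apply: eq_bigr => a _ /=.
  transitivity ((DM a normal_part u *m Sx u) 0 a).
    rewrite mulmx_sumr summxE; apply: eq_bigr => d _.
    by rewrite -scalemxAr [RHS]mxE.
  rewrite vf_normal_part// mulNmx mxE; congr (- _); rewrite mxE; apply: eq_bigr => k _.
  congr (_ * _); rewrite mxE !summxE; apply: eq_bigr => d _.
  by rewrite mxE [RHS]mxE -{1}ST [_^T _ _]mxE.
congr (- _).
have E a : edot (x u *m S a u) (row a (Sx u)) = edot (second_tangent a u) (second_tangent a u) +
    edot (x u *m S a u) (row a ((1%:M - P u) *m Sx u)).
  have -> : row a (Sx u) = second_tangent a u + row a ((1%:M - P u) *m Sx u).
    rewrite -row_SxQ// -linearD /=; congr (row a _).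
    apply/eqP; rewrite -subr_eq; apply/eqP.
    rewrite mulmxBl mul1mx opprB addrC addrNK mulmxBr mulmx1.
    rewrite mulmx_sumr mulmx_suml -sumrB; apply: eq_bigr => d _.
    by rewrite -scalemxAr -scalemxAl -scalerBr -{2}(SPPS d Uu) addrAC subrr add0r.
  by rewrite edotDr {1}map_vf_tproj edotDl edot_shape_second_tangent// add0r.
rewrite (eq_bigr _ (fun a _ => E a)) big_split /= [X in _ + X](_ : _ = 0) ?addr0//.
transitivity (\sum_(j < p) edot (x u *m \sum_(a < p) (1%:M - P u) j a *: S a u) (row j (Sx u))).
  under [RHS]eq_bigr => j _ do rewrite mulmx_sumr edot_suml.
  rewrite [RHS]exchange_big; apply: eq_bigr => a _ /=.
  rewrite row_mul [row a _ *m _]mulmx_sum_row edotC edot_suml; apply: eq_bigr => j _.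
  rewrite -scalemxAr !edotZl edotC; congr (_ * _).
  by rewrite -[in LHS]PT !mxE eq_sym.
by rewrite big1// => j _; rewrite Stan// mulmx0 edot0l.
Qed.

(** The terms with [S d] assemble to [Sx], whose tangential block [P Sx P] is zero; the terms with
    [S a] reproduce [b], because the tangential part of [x S a] is row [a] of [b]. *)
Let third_term u : U u ->
  \sum_(d < p) x u 0 d * \sum_(a < p) \sum_(e < p) (S a u d e - S d u a e) * shape u e a =
  \tr (shape u *m shape u).
Proof.
move=> Uu.
have -> : \tr (shape u *m shape u) = \sum_(a < p) \sum_(e < p) (x u *m S a u) 0 e * shape u e a.
  apply: eq_bigr => a _.
  transitivity ((row a (shape u) *m shape u) 0 a); first by rewrite -row_mul [RHS]mxE.
  transitivity ((x u *m S a u *m shape u) 0 a); last by rewrite [LHS]mxE.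
  have yb0 : second_tangent a u *m shape u = 0 by rewrite -(tproj_shape Uu) mulmxA second_tangent_tproj// mul0mx.
  by rewrite map_vf_tproj mulmxDl yb0 addr0.
have -> : \sum_(d < p) x u 0 d * \sum_(a < p) \sum_(e < p) (S a u d e - S d u a e) * shape u e a
  = \sum_(a < p) \sum_(e < p) (x u *m S a u) 0 e * shape u e a - \tr (Sx u *m shape u).
  rewrite /mxtrace; under eq_bigr => d _ do rewrite mulr_sumr.
  rewrite exchange_big -sumrB; apply: eq_bigr => a _ /=.
  under eq_bigr => d _ do rewrite mulr_sumr.
  rewrite exchange_big [(Sx u *m _) a a]mxE -sumrB; apply: eq_bigr => e _ /=.
  rewrite -mulrBl; under eq_bigr => d _ do rewrite mulrA mulrBr.
  rewrite -mulr_suml sumrB; congr ((_ - _) * _); first by rewrite mxE.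
  by rewrite summxE; apply: eq_bigr => d _; rewrite [RHS]mxE.
suff -> : \tr (Sx u *m shape u) = 0 by rewrite subr0.
have -> : shape u = P u *m (shape u *m P u) by rewrite shape_tproj// tproj_shape.
by rewrite mulmxA mxtrace_mulC -mulmxA (mulmxA (P u)) PSxP// mulmx0 mxtrace0.
Qed.

(** The gradient of [f] is [-2 b x]. Its divergence contains [c <h, D h>] contracted with [x], and
    the drift term [c <x, grad f>] cancels it exactly; this is why [L] and not the Laplacian is
    applied to [f]. *)
Lemma drift_normal_sqnorm u : U u ->
  \sum_(a < p) (D a (D a normal_sqnorm) u + c * x u 0 a * D a normal_sqnorm u) =
  2 * (\sum_(a < p) edot (second_tangent a u) (second_tangent a u)) -
  2 * \tr (shape u *m shape u) - 2 * c * normal_sqnorm u.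
Proof.
move=> Uu.
have sbx : smooth_mx U (fun z => shape z *m (x z)^T).
  by apply: (smooth_mxM oU smooth_shape); exact: smooth_mxT.
have DD a : D a (D a normal_sqnorm) u =
    -2 * ((\sum_(d < p) D a (fun z => shape z d a) u * x u 0 d) + (shape u *m P u) a a).
  rewrite (eq_vf W oU a (g := fun z => -2 * (shape z *m (x z)^T) a 0) Uu); last first.
    by move=> z Uz; exact: vf_normal_sqnorm.
  rewrite (vfZ W a _ Uu (sbx a 0)); congr (_ * _).
  have := congr1 (fun M : 'cV[R]_p => M a 0) (vf_mxM W oU a Uu smooth_shape (smooth_mxT sx)).
  rewrite [LHS]mxE => ->; rewrite mxE; congr (_ + _).
    rewrite mxE; apply: eq_bigr => d _; rewrite !mxE; congr (_ * _).
    by apply: (eq_vf W oU) => // z Uz; rewrite -{1}(shape_sym Uz) mxE.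
  rewrite vf_mxT Dx// !mxE; apply: eq_bigr => k _; rewrite !mxE.
  by rewrite -{1}PT mxE.
under eq_bigr => a _ do rewrite DD vf_normal_sqnorm//.
have E1 : \sum_(a < p) (shape u *m P u) a a = c * normal_sqnorm u by rewrite shape_tproj// -mxtrace_shape.
have E2 : \sum_(a < p) \sum_(d < p) D a (fun z => shape z d a) u * x u 0 d =
    - (\sum_(a < p) edot (second_tangent a u) (second_tangent a u)) +
    (\sum_(d < p) c * edot (normal_part u) (DM d normal_part u) * x u 0 d) + \tr (shape u *m shape u).
  rewrite -first_term// -third_term// -!big_split exchange_big.
  apply: eq_bigr => d _ /=; rewrite -mulr_suml div_shape// !mulrDl.
  by rewrite (mulrC (x u 0 d)) (mulrC (x u 0 d)).
have E3 : \sum_(a < p) c * x u 0 a * (-2 * (shape u *m (x u)^T) a 0) =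
   2 * \sum_(i < p) c * edot (normal_part u) (DM i normal_part u) * x u 0 i.
  rewrite mulr_sumr; apply: eq_bigr => a _; rewrite vf_normal_part// edotNr.
  have -> : edot (normal_part u) (x u *m S a u) = (shape u *m (x u)^T) a 0.
    by rewrite edotC edot_mulmx ST -row_shape edotC edotE -row_mul mxE.
  ring.
rewrite big_split /= -mulr_sumr E3 big_split /= E1 E2; ring.
Qed.

Lemma smooth_edot_map v : smooth_on U (fun z => edot (x z) v).
Proof.
apply: (smooth_sum _ _ oU) => i; apply: (smoothM oU (sx 0 i)); exact: smooth_cst.
Qed.

Lemma vf_edot_map a v u : U u -> D a (fun z => edot (x z) v) u = (P u *m v^T) a 0.
Proof.
move=> Uu; rewrite (eq_vf W oU a (g := fun z => (x z *m v^T) 0 0) Uu) => [|z _]; last exact: edotE.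
have := congr1 (fun M : 'M[R]_1 => M 0 0) (vf_mxMr W oU a v^T Uu sx).
by rewrite Dx// -row_mul [RHS]mxE [LHS]mxE.
Qed.

Lemma laplacian_edot_map v u : U u ->
  \sum_(a < p) D a (D a (fun z => edot (x z) v)) u = c * edot (normal_part u) v.
Proof.
move=> Uu; transitivity (\sum_(a < p) (S a u *m v^T) a 0).
  apply: eq_bigr => a _; rewrite (eq_vf W oU a (g := fun z => (P z *m v^T) a 0) Uu); last first.
    by move=> z Uz; exact: vf_edot_map.
  have := congr1 (fun M : 'cV[R]_p => M a 0) (vf_mxMr W oU a v^T Uu sP).
  by rewrite [LHS]mxE.
under eq_bigr => a _ do rewrite mxE.
rewrite exchange_big /edot mulr_sumr; apply: eq_bigr => g _ /=.
rewrite mulrA -div_vf_tproj// mulr_suml; apply: eq_bigr => a _.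
by rewrite -{1}ST [_^T _ _]mxE [v^T _ _]mxE.
Qed.

(** The Laplacian of the position is [H = c h] and the drift adds [c x^T]; together they give
    [c x]. *)
Lemma drift_edot_map v u : U u ->
  \sum_(a < p) (D a (D a (fun z => edot (x z) v)) u +
     c * x u 0 a * D a (fun z => edot (x z) v) u) = c * edot (x u) v.
Proof.
move=> Uu; rewrite big_split /= laplacian_edot_map//.
have -> : \sum_(a < p) c * x u 0 a * D a (fun z => edot (x z) v) u = c * edot (x u *m P u) v.
  rewrite edot_mulmx PT /edot mulr_sumr; apply: eq_bigr => a _; rewrite vf_edot_map// mulrA.
  by rewrite -{1}PT -trmx_mul mxE.
by rewrite -mulrDr -edotDl subrK.
Qed.

Lemma laplacian_sqnorm_map u : U u -> (forall z, U z -> normal_part z = 0) ->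
  \sum_(a < p) D a (D a (fun z => edot (x z) (x z))) u = 2 * m%:R.
Proof.
move=> Uu h0; have D1 a z : U z -> D a (fun z => edot (x z) (x z)) z = 2 * x z 0 a.
  move=> Uz; rewrite (vf_sum W a _ _ Uz) => [|i]; last exact (smoothM oU (sx 0 i) (sx 0 i)).
  transitivity (2 * edot (DM a x z) (x z)).
    rewrite mulr_sumr; apply: eq_bigr => i _.
    by rewrite (vfM W a Uz (sx 0 i) (sx 0 i)) [vf_mx _ _ _ _ _ _]mxE; ring.
  have xP : x z *m P z = x z by move/eqP: (h0 z Uz); rewrite subr_eq0 => /eqP.
  congr (_ * _); rewrite Dx// edotE -row_mul mxE -{1}PT -trmx_mul xP.
  by rewrite mxE.
rewrite -(trP Uu) mulr_sumr; apply: eq_bigr => a _.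
rewrite (eq_vf W oU a (g := fun z => 2 * x z 0 a) Uu); last by move=> z; exact: D1.
rewrite (vfZ W a 2 Uu (sx 0 a)); congr (_ * _).
by have := congr1 (fun M : 'rV[R]_p => M 0 a) (Dx a Uu); rewrite [LHS]mxE [RHS]mxE.
Qed.

Definition second_sqnorm u : R := \sum_(a < p) \sum_(b < p)
  edot (row b (S a u *m (1%:M - P u))) (row b (S a u *m (1%:M - P u))).

Let mxtrace_shape_sq u : U u -> \tr (shape u *m shape u) = \sum_(a < p) \sum_(b < p) shape u a b ^+ 2.
Proof.
move=> Uu; rewrite -{2}shape_sym//; apply: eq_bigr => a _; rewrite mxE.
by apply: eq_bigr => b _; rewrite [_^T _ _]mxE expr2.
Qed.

(** Pythagoras for the component of [II] along [h / |h|]. Nonnegativity gives a Cauchy-Schwarz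
    bound, and the vanishing of the sum is the equality case needed for rigidity. *)
Let deviation u : U u -> 0 < normal_sqnorm u ->
  \sum_(a < p) \sum_(b < p)
    (let z := row b (S a u *m (1%:M - P u)) -
       (shape u a b / normal_sqnorm u) *: normal_part u in
     edot z z) = second_sqnorm u - \tr (shape u *m shape u) / normal_sqnorm u.
Proof.
move=> Uu f0; rewrite mxtrace_shape_sq// mulr_suml -sumrB; apply: eq_bigr => a _.
rewrite mulr_suml -sumrB; apply: eq_bigr => b _ /=.
rewrite edotBl !edotBr !edotZl !edotZr -/(normal_sqnorm u) (edotC (normal_part u)) -(shape_entry a b Uu).
by field; rewrite gt_eqF.
Qed.

Lemma mxtrace_shape_sq_le u : U u -> \tr (shape u *m shape u) <= second_sqnorm u * normal_sqnorm u.
Proof.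
move=> Uu; have := edot_ge0 (normal_part u); rewrite -/(normal_sqnorm u) le_eqVlt => /orP[/eqP f0|f0].
  have h0 : normal_part u = 0 by apply/eqP; rewrite -edot_eq0 -/(normal_sqnorm u) -f0.
  have -> : shape u = 0 by apply/matrixP => i j; rewrite !mxE h0 big1// => k _; rewrite mxE mul0r.
  by rewrite mulmx0 mxtrace0 -f0 mulr0.
rewrite -ler_pdivrMr// -subr_ge0 -deviation//.
by do 2 (apply: sumr_ge0 => ? _); exact: edot_ge0.
Qed.

(** Expand [0 <= tr (b + P)^2 = tr b^2 + 2 c f + m] and use [tr b^2 <= - c f]. Equality would force
    [b = - P], as on a round sphere. *)
Lemma normal_sqnorm_le u : U u -> c < 0 -> second_sqnorm u <= - c -> normal_sqnorm u <= - m%:R / c.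
Proof.
move=> Uu c0 II; have f0 : 0 <= normal_sqnorm u := edot_ge0 _.
have bbf : \tr (shape u *m shape u) <= - c * normal_sqnorm u.
  by apply: (le_trans (mxtrace_shape_sq_le Uu)); rewrite ler_wpM2r.
have : 0 <= \tr ((shape u + P u) *m (shape u + P u)).
  by apply: sym_mxtrace_ge0; rewrite linearD /= shape_sym// PT.
rewrite mulmxDl !mulmxDr shape_tproj// tproj_shape// PP// !mxtraceD mxtrace_shape// trP//.
move=> ge0; rewrite ler_ndivlMr// ; lra.
Qed.

Lemma drift_normal_sqnorm_ge0 u : U u -> c < 0 -> second_sqnorm u <= - c ->
  0 <= \sum_(a < p) (D a (D a normal_sqnorm) u + c * x u 0 a * D a normal_sqnorm u).
Proof.
move=> Uu c0 II; rewrite drift_normal_sqnorm//.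
have bbf : \tr (shape u *m shape u) <= - c * normal_sqnorm u.
  by apply: (le_trans (mxtrace_shape_sq_le Uu)); rewrite ler_wpM2r// edot_ge0.
have : 0 <= \sum_(a < p) edot (second_tangent a u) (second_tangent a u).
  by apply: sumr_ge0 => a _; exact: edot_ge0.
move: (\sum_(a < p) _) => Y Y0; lra.
Qed.

(** * Rigidity when the normal part has constant positive length *)

Section Rigidity.
Variable f0 : R.
Hypothesis c0 : c < 0.
Hypothesis f0_gt0 : 0 < f0.
Hypothesis sqh_cst : forall u, U u -> normal_sqnorm u = f0.
Hypothesis II_le : forall u, U u -> second_sqnorm u <= - c.

Let f0_neq0 : f0 != 0. Proof. by rewrite gt_eqF. Qed.

Let Dsqh0 a u : U u -> D a normal_sqnorm u = 0.
Proof. by move=> Uu; rewrite -(vf_cst W a f0 u); exact: (eq_vf W oU). Qed.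

(** The left side of [drift_normal_sqnorm] is now zero and its right side is a sum of two
    nonnegative quantities. The vanishing of the second one forces equality throughout
    [tr b^2 <= |II|^2 f <= - c f]. *)
Let rigid u : U u -> [/\ forall a, second_tangent a u = 0,
  \tr (shape u *m shape u) = - c * f0 & second_sqnorm u = - c].
Proof.
move=> Uu; have := drift_normal_sqnorm Uu; rewrite big1 => [|a _]; last first.
  rewrite Dsqh0// mulr0 addr0 -(vf_cst W a 0 u); apply: (eq_vf W oU) => // z Uz.
  exact: Dsqh0.
have := mxtrace_shape_sq_le Uu; rewrite sqh_cst//.
have := ler_wpM2r (ltW f0_gt0) (II_le Uu).
have Y0 : 0 <= \sum_(a < p) edot (second_tangent a u) (second_tangent a u).
  by apply: sumr_ge0 => a _; exact: edot_ge0.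
move=> le1 le2 E.
have YE : \sum_(a < p) edot (second_tangent a u) (second_tangent a u) = 0.
  move: Y0 E; move: (\sum_(a < p) _) => Y Y0 E; lra.
rewrite YE in E; split; last 2 first.
- by lra.
- by apply: (mulIf f0_neq0); lra.
move=> a; apply/eqP; rewrite -edot_eq0; move/eqP: YE.
rewrite psumr_eq0 => [/allP /(_ a (mem_index_enum a))//|i _]; exact: edot_ge0.
Qed.

Lemma second_sqnorm_rigid u : U u -> second_sqnorm u = - c.
Proof. by case/rigid. Qed.

Let trbb2 u : U u -> \tr (shape u *m shape u) = - c * f0.
Proof. by case/rigid. Qed.

Lemma vf_normal_part_rigid a u : U u -> DM a normal_part u = - row a (shape u).
Proof. by move=> Uu; rewrite vf_normal_part// map_vf_tproj; have [-> _ _] := rigid Uu; rewrite addr0. Qed.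

Lemma shape_map_rigid u : U u -> shape u *m (x u)^T = 0.
Proof.
move=> Uu; apply/colP => a; rewrite [RHS]mxE; apply: (@mulfI _ (-2)).
  by rewrite oppr_eq0 pnatr_eq0.
by rewrite -vf_normal_sqnorm// Dsqh0// mulr0.
Qed.

Let SQ_rigid a u : U u -> S a u *m (1%:M - P u) = f0^-1 *: ((row a (shape u))^T *m normal_part u).
Proof.
move=> Uu; apply/row_matrixP => b; rewrite [RHS]linearZ /= [X in _ *: X]row_mul.
have f0u : 0 < normal_sqnorm u by rewrite sqh_cst.
have := deviation Uu f0u; rewrite trbb2// sqh_cst// mulfK// second_sqnorm_rigid// subrr.
move/eqP; rewrite psumr_eq0 => [/allP /(_ a (mem_index_enum a)) /=|i _]; last first.
  by apply: sumr_ge0 => ? _; exact: edot_ge0.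
rewrite psumr_eq0 => [/allP /(_ b (mem_index_enum b)) /=|i _]; last exact: edot_ge0.
rewrite edot_eq0 subr_eq0 => /eqP ->.
have -> : row b (row a (shape u))^T = (shape u a b)%:M.
  apply/rowP => i; rewrite (ord1 i) [RHS]mxE eqxx mulr1n.
  by rewrite [LHS]mxE [LHS]mxE [LHS]mxE.
by rewrite mul_scalar_mx scalerA mulrC.
Qed.

Lemma vf_tproj_rigid a u : U u ->
  S a u = f0^-1 *: ((row a (shape u))^T *m normal_part u + (normal_part u)^T *m row a (shape u)).
Proof.
move=> Uu; have : S a u = S a u *m (1%:M - P u) + (P u *m S a u)^T.
  by rewrite trmx_mul ST PT -mulmxDr subrK mulmx1.
have -> : P u *m S a u = S a u *m (1%:M - P u).
  by rewrite mulmxBr mulmx1 -{2}(SPPS a Uu) addrAC subrr add0r.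
by rewrite SQ_rigid// linearZ /= trmx_mul trmxK -scalerDr.
Qed.

Let hbb u : U u -> normal_part u *m shape u = 0.
Proof. by move=> Uu; rewrite -tproj_shape// mulmxA normal_part_tproj// mul0mx. Qed.

Let edot_x_hh u : U u -> edot (x u) (normal_part u) = f0.
Proof.
move=> Uu; rewrite -(sqh_cst Uu) /normal_sqnorm {2}/normal_part.
rewrite edotBl edot_mulmx PT normal_part_tproj// edot0r subr0.
by [].
Qed.

(** By rigidity [b] is minus the derivative of [h], so the left side is a commutator acting on
    [h_a]. The explicit form of [S a] and [h b = 0] give the right side, a correction due to the
    ambient indices that vanishes on tangential [d] and [e]. *)
Lemma Codazzi_shape d e a u : U u ->
  D e (fun z => shape z d a) u - D d (fun z => shape z e a) u =
  f0^-1 * (normal_part u 0 d * (shape u *m shape u) e a -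
    normal_part u 0 e * (shape u *m shape u) d a).
Proof.
move=> Uu.
have E k z : U z -> shape z k a = - D k (fun y => normal_part y 0 a) z.
  move=> Uz; have := congr1 (fun v : 'rV[R]_p => v 0 a) (vf_normal_part_rigid k Uz).
  by rewrite !mxE => ->; rewrite opprK.
have sh := smooth_normal_part 0 a.
rewrite (eq_vf W oU e Uu (E d)) (eq_vf W oU d Uu (E e)).
rewrite (vfN W oU e Uu (smooth_vf oU sW d sh)) (vfN W oU d Uu (smooth_vf oU sW e sh)).
rewrite opprK addrC -opprB comm//.
have hb : \sum_(k < p) normal_part u 0 k * shape u k a = 0.
  by have := congr1 (fun v : 'rV[R]_p => v 0 a) (hbb Uu); rewrite !mxE.
transitivity (\sum_(k < p) (S e u d k - S d u e k) * shape u k a).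
  rewrite -sumrN; apply: eq_bigr => k _; rewrite -mulrN; congr (_ * _).
  by rewrite E.
have SE i j k : S i u j k = f0^-1 * (shape u i j * normal_part u 0 k + normal_part u 0 j * shape u i k).
  by rewrite vf_tproj_rigid// !mxE !big_ord1 !mxE.
transitivity (f0^-1 * (\sum_(k < p) (shape u e d - shape u d e) * (normal_part u 0 k * shape u k a) +
   (normal_part u 0 d * (\sum_(k < p) shape u e k * shape u k a) -
    normal_part u 0 e * (\sum_(k < p) shape u d k * shape u k a)))).
  rewrite !mulr_sumr -sumrB -big_split mulr_sumr; apply: eq_bigr => k _ /=.
  by rewrite !SE; ring.
by rewrite -mulr_sumr hb mulr0 add0r !mxE.
Qed.

Let Ebb u : 'M[R]_p := \sum_(d < p) x u 0 d *: DM d shape u.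

(** Differentiating [b x = 0] in direction [e] shows that [D e b] contracted with [x] is [- b]. The
    Codazzi equation exchanges [e] with the contracted index, and its correction becomes [- b^2]
    because [<x, h> = f0] and [x b^2 = 0]. *)
Let EbbE u : U u -> Ebb u = - (shape u + shape u *m shape u).
Proof.
move=> Uu; apply/matrixP => e a; rewrite summxE.
have sbx : smooth_mx U (fun z => shape z *m (x z)^T).
  by apply: (smooth_mxM oU smooth_shape); exact: smooth_mxT.
have bx : \sum_(d < p) x u 0 d * D e (fun z => shape z d a) u = - shape u e a.
  have E : (DM e shape u *m (x u)^T) a 0 = - (shape u *m (row e (P u))^T) a 0.
    have := vf_mxM W oU e Uu smooth_shape (smooth_mxT sx).
    rewrite (eq_vf_mx W oU e (B := fun=> 0) Uu) => [|z Uz]; last exact: shape_map_rigid.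
    rewrite vf_mx_cst vf_mxT Dx// => /esym/eqP; rewrite addr_eq0 => /eqP ->.
    by rewrite [LHS]mxE.
  transitivity ((DM e shape u *m (x u)^T) a 0).
    rewrite [RHS]mxE; apply: eq_bigr => d _; rewrite mulrC mxE [_^T _ _]mxE; congr (_ * _).
    by apply: (eq_vf W oU) => // z Uz; rewrite -{1}shape_sym// mxE.
  rewrite E; congr (- _).
  transitivity ((shape u *m P u) a e); last by rewrite shape_tproj// -{1}shape_sym// mxE.
  by rewrite [LHS]mxE [RHS]mxE; apply: eq_bigr => k _; rewrite !mxE -{1}PT mxE.
transitivity (\sum_(d < p) x u 0 d * (D e (fun z => shape z d a) u -
    f0^-1 * (normal_part u 0 d * (shape u *m shape u) e a -
      normal_part u 0 e * (shape u *m shape u) d a))).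
  apply: eq_bigr => d _; rewrite -Codazzi_shape// [LHS]mxE [vf_mx _ _ _ _ _ _]mxE; congr (_ * _).
  by rewrite opprB addrC subrK.
have xbb : \sum_(d < p) x u 0 d * (shape u *m shape u) d a = 0.
  have : x u *m (shape u *m shape u) = 0.
    rewrite mulmxA (_ : x u *m shape u = 0) ?mul0mx//.
    by apply: trmx_inj; rewrite trmx_mul shape_sym// shape_map_rigid// trmx0.
  by move/(congr1 (fun v : 'rV[R]_p => v 0 a)); rewrite [LHS]mxE [RHS]mxE.
transitivity (- shape u e a - f0^-1 * (edot (x u) (normal_part u) * (shape u *m shape u) e a
   - normal_part u 0 e * \sum_(d < p) x u 0 d * (shape u *m shape u) d a)).
  rewrite -bx /edot mulr_suml mulr_sumr -sumrB mulr_sumr -sumrB.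
  by apply: eq_bigr => d _; ring.
rewrite xbb mulr0 subr0 edot_x_hh// mulKf// opprD [RHS]mxE.
by congr (_ + _); rewrite [RHS]mxE.
Qed.

(** Differentiating along [x^T], constancy of [tr b^2 = - c f0] gives [tr b^3 = c f0], and constancy
    of the latter gives [tr b^4 = - c f0]. Hence [tr (b + b^2)^2 = tr b^2 + 2 tr b^3 + tr b^4 = 0]
    with [b + b^2] symmetric. *)
Lemma shape_sq_rigid u : U u -> shape u *m shape u = - shape u.
Proof.
have sb := smooth_shape; have sbb := smooth_mxM oU sb sb.
have E2 z : U z -> \tr (shape z *m Ebb z) = 0.
  move=> Uz; rewrite mulmx_sumr raddf_sum /= big1// => d _.
  rewrite -scalemxAr mxtraceZ; apply/eqP; rewrite mulf_eq0; apply/orP; right; apply/eqP.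
  have := vf_mxtrace W d Uz sbb; rewrite (vf_mxM W oU d Uz sb sb) mxtraceD.
  rewrite (mxtrace_mulC (DM d shape z)) (eq_vf W oU d (g := cst (- c * f0)) Uz) => [|y Uy].
    by rewrite vf_cst => ?; lra.
  exact: trbb2.
have tr3 z : U z -> \tr (shape z *m shape z *m shape z) = c * f0.
  move=> Uz; have := E2 z Uz; rewrite EbbE// mulmxN mulmxDr mulmxA linearN linearD /= trbb2//.
  by move=> ?; lra.
have E3 z : U z -> \tr (shape z *m shape z *m Ebb z) = 0.
  move=> Uz; rewrite mulmx_sumr raddf_sum /= big1// => d _.
  rewrite -scalemxAr mxtraceZ; apply/eqP; rewrite mulf_eq0; apply/orP; right; apply/eqP.
  have := vf_mxtrace W d Uz (smooth_mxM oU sbb sb); rewrite (vf_mxM W oU d Uz sbb sb).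
  rewrite (vf_mxM W oU d Uz sb sb) mulmxDl !mxtraceD.
  rewrite (eq_vf W oU d (g := cst (c * f0)) Uz) => [|y Uy]; last exact: tr3.
  rewrite vf_cst -mulmxA mxtrace_mulC.
  rewrite (_ : \tr (shape z *m vf_mx W d shape z *m shape z) = \tr (shape z *m shape z *m vf_mx W d shape z)).
    by move=> ?; lra.
  by rewrite mxtrace_mulC mulmxA.
move=> Uu; apply/eqP; rewrite -subr_eq0 opprK; apply/eqP.
apply: sym_mxtrace_eq0; first by rewrite linearD /= trmx_mul shape_sym.
have := E3 u Uu; rewrite EbbE// mulmxN mulmxDr linearN linearD /= => /eqP.
rewrite oppr_eq0 => /eqP; have := tr3 u Uu; have := trbb2 Uu.
rewrite mulmxDl !mulmxDr !mxtraceD (mulmxA (shape u) (shape u) (shape u)).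
by move=> -> -> ?; lra.
Qed.

(** Since [b^2 = - b], the eigenvalues of [b] are [0] and [-1]: [flat_proj] projects onto its kernel
    inside the tangent space, the Euclidean directions, and [round_proj] onto the tangent space plus
    the line of [h]. *)
Definition flat_proj u : 'M[R]_p := P u + shape u.
Definition round_proj u : 'M[R]_p := P u + f0^-1 *: ((normal_part u)^T *m normal_part u).
Local Notation G := flat_proj.

Lemma smooth_flat_proj : smooth_mx U G.
Proof. exact (smooth_mxD oU sP smooth_shape). Qed.

Lemma flat_proj_sym u : U u -> (G u)^T = G u.
Proof. by move=> Uu; rewrite linearD /= PT shape_sym. Qed.

Lemma flat_proj_idem u : U u -> G u *m G u = G u.
Proof.
move=> Uu; rewrite mulmxDl !mulmxDr PP// tproj_shape// shape_tproj// shape_sq_rigid// subrr addr0.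
by [].
Qed.

Lemma tproj_flat_proj u : U u -> P u *m G u = G u.
Proof. by move=> Uu; rewrite mulmxDr PP// tproj_shape. Qed.

Lemma map_flat_proj u : U u -> x u *m G u = x u - normal_part u.
Proof.
move=> Uu; rewrite mulmxDr (_ : x u *m shape u = 0); last first.
  by apply: trmx_inj; rewrite trmx_mul shape_sym// shape_map_rigid// trmx0.
by rewrite addr0 opprB addrC subrK.
Qed.

(* [N_e = D_e G] is totally symmetric (Codazzi) while [N_e = G N_e + N_e G]
   since [G] is idempotent; so [G] acts in the same way on each of the three
   indices of [N], and [N = 2 G N] forces [N = 0]. *)
Lemma vf_flat_proj e u : U u -> DM e G u = 0.
Proof.
move=> Uu; pose N i := DM i G u.
have sG := smooth_flat_proj.
have NE i j k : N i j k = S i u j k + D i (fun z => shape z j k) u.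
  by rewrite /N (vf_mxD W i Uu sP smooth_shape) mxE [vf_mx _ _ shape _ _ _]mxE.
have SE i j k : S i u j k = f0^-1 * (shape u i j * normal_part u 0 k + normal_part u 0 j * shape u i k).
  by rewrite vf_tproj_rigid// !mxE !big_ord1 !mxE.
have bbC i j : shape u i j = shape u j i by rewrite -{1}shape_sym// mxE.
have N12 i j k : N i j k = N j i k.
  apply/eqP; rewrite -subr_eq0; apply/eqP.
  rewrite !NE opprD addrACA Codazzi_shape// shape_sq_rigid// !SE (bbC j i) ![(- shape u) _ _]mxE.
  ring.
have N23 i j k : N i j k = N i k j.
  have : (N i)^T = N i.
    rewrite /N -vf_mxT; apply: (eq_vf_mx W oU) => // z Uz; exact: flat_proj_sym.
  by move=> {1}<-; rewrite mxE.
have NG i : N i = N i *m G u + G u *m N i.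
  rewrite /N -(vf_mxM W oU i Uu sG sG).
  by apply: (eq_vf_mx W oU) => // z Uz; rewrite flat_proj_idem.
pose G3 i j k := (N i *m G u) j k; pose G2 i j k := (G u *m N i) j k.
have NG' i j k : N i j k = G3 i j k + G2 i j k by rewrite {1}NG mxE.
have G23 i j k : G2 i j k = G3 i k j.
  rewrite /G2 /G3 !mxE; apply: eq_bigr => l _; rewrite mulrC (N23 i l k); congr (_ * _).
  by rewrite -{1}flat_proj_sym// mxE.
have G3s i j k : G3 i j k = G3 j i k.
  by rewrite /G3 !mxE; apply: eq_bigr => l _; rewrite N12.
have G13 i j k : G3 i j k = G3 k j i.
  rewrite -!G23; have := N12 i k j.
  by rewrite !NG' G3s => /addrI.
have G32 i j k : G3 i j k = G3 i k j by rewrite G3s G13 G3s.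
have comm2 : N e *m G u = G u *m N e.
  by apply/matrixP => j k; rewrite -/(G3 e j k) -/(G2 e j k) G23 G32.
have : N e *m G u = N e *m G u + N e *m G u.
  rewrite {1}NG mulmxDl -mulmxA flat_proj_idem// -comm2 -mulmxA flat_proj_idem//.
move/eqP; rewrite eq_sym -subr_eq0 addrK => /eqP N0.
by rewrite -/(N e) NG -comm2 N0 addr0.
Qed.

Let hhT_hh u : U u -> normal_part u *m (normal_part u)^T = f0%:M.
Proof.
by move=> Uu; rewrite [LHS]mx11_scalar -edotE -(sqh_cst Uu).
Qed.

(** The derivative of [h^T h / f0] is exactly [- S a]: [D a h] is minus row [a] of [b], and by
    [vf_tproj_rigid] [S a] is the symmetrized product of that row with [h], over [f0]. *)
Lemma vf_round_proj a u : U u -> DM a round_proj u = 0.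
Proof.
move=> Uu; have sh := smooth_normal_part; have shT := smooth_mxT sh.
have shh := smooth_mxM oU shT sh.
have E : DM a (fun z => f0^-1 *: ((normal_part z)^T *m normal_part z)) u =
    f0^-1 *: DM a (fun z => (normal_part z)^T *m normal_part z) u.
  apply/matrixP => i j; rewrite [LHS]mxE [RHS]mxE [vf_mx _ _ _ _ _ _]mxE.
  rewrite -(vfZ W a f0^-1 Uu (shh i j)); apply: (eq_vf W oU) => // z _.
  by rewrite mxE.
have sfh : smooth_mx U (fun z => f0^-1 *: ((normal_part z)^T *m normal_part z)).
  move=> i j; apply: (eq_smooth oU (f := fun z => f0^-1 * ((normal_part z)^T *m normal_part z) i j)).
    by move=> z _; rewrite [RHS]mxE.
  by apply: smoothM => //; exact: smooth_cst.
rewrite (vf_mxD W a Uu sP sfh) E (vf_mxM W oU a Uu shT sh) vf_mxT vf_normal_part_rigid//.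
rewrite vf_tproj_rigid// -scalerDr linearN /= mulNmx mulmxN -opprD subrr scaler0.
by [].
Qed.

Lemma round_proj_sym u : (round_proj u)^T = round_proj u.
Proof. by rewrite linearD /= PT linearZ /= trmx_mul trmxK. Qed.

Lemma round_proj_idem u : U u -> round_proj u *m round_proj u = round_proj u.
Proof.
move=> Uu; have sum_idem (X : 'M[R]_p) : P u *m X = 0 -> X *m P u = 0 -> X *m X = X ->
    (P u + X) *m (P u + X) = P u + X.
  by move=> PX XP XX; rewrite mulmxDl !mulmxDr PP// PX XP XX addr0 add0r.
apply: sum_idem.
- rewrite -scalemxAr mulmxA (_ : P u *m (normal_part u)^T = 0) ?mul0mx ?scaler0//.
  by apply: trmx_inj; rewrite trmx_mul trmxK PT normal_part_tproj// trmx0.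
- by rewrite -scalemxAl -mulmxA normal_part_tproj// mulmx0 scaler0.
rewrite -scalemxAl -scalemxAr -mulmxA (mulmxA (normal_part u)) hhT_hh//.
by rewrite mul_scalar_mx -scalemxAr (scalerA f0^-1 f0) mulVf// scale1r.
Qed.

Lemma mxtrace_round_proj u : U u -> \tr (round_proj u) = m.+1%:R.
Proof.
move=> Uu; rewrite mxtraceD trP// mxtraceZ mxtrace_mulC hhT_hh//.
by rewrite mxtrace_scalar mulr1n mulVf// -natr1.
Qed.

Lemma normal_part_round_proj u : U u -> normal_part u *m round_proj u = normal_part u.
Proof.
move=> Uu; rewrite mulmxDr normal_part_tproj// add0r -scalemxAr mulmxA hhT_hh// mul_scalar_mx.
by rewrite scalerA mulVf// scale1r.
Qed.

End Rigidity.

End Shrinker.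

Lemma tangent_calculus_immersion {R : realType} {m p : nat} (U : set 'rV[R]_m)
    (F : 'rV[R]_m -> 'rV[R]_p) :
  open U -> smooth_on U F -> (forall u, U u -> row_free ('J F u)) ->
  tangent_calculus U (tangent_frame F) (tproj F) F.
Proof.
move=> oU sF freeJ; split.
- by [].
- exact: smooth_frame.
- exact: smooth_tproj.
- exact: smooth_mx_map.
- exact: tproj_sym.
- by move=> u; exact: (tproj_idem freeJ).
- by move=> u; exact: (mxtrace_tproj freeJ).
- by move=> a u; exact: vf_map.
- by move=> k u; exact: (vf_tproj_tangent freeJ).
- exact: vf_tproj_sym.
- by move=> a u; exact: (vf_tproj_idem oU sF freeJ).
- by move=> a b u; exact: (second_fundamental_sym oU sF freeJ).
- by move=> u a b f; exact: (vf_commutator oU sF freeJ).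
Qed.

Lemma locally_constant {R : realType} {m : nat} (U : set 'rV[R]_m)
    (f : 'rV[R]_m -> R) (u : 'rV[R]_m) : open U -> U u -> smooth_on U f ->
  (forall z i, U z -> partial i f z = 0) -> \forall z \near u, f z = f u.
Proof.
move=> oU Uu sf df0.
have [r r0 rU] : exists2 r : R, 0 < r & forall x, `|x - u| < r -> U x.
  by apply: near_norm; exact: (open_near oU Uu).
apply/nbhs_ballP; exists r => //= z; rewrite -ball_normE /= distrC => zr.
have line t : 0 <= t <= 1 -> U (u + t *: (z - u)).
  move=> /andP[t0 t1]; apply: rU; rewrite addrAC subrr add0r normrZ ger0_norm//.
  by apply: le_lt_trans zr; rewrite ler_piMl.
have [t t01|t /andP[t0 t1]] := @mean_value _ (fun t => f (u + t *: (z - u)))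
    (fun t => 'D_(z - u) f (u + t *: (z - u))) 0 1 ltr01.
  by apply: is_derive_line; exact: (smooth_differentiable sf (line t t01)).
have Ut : U (u + t *: (z - u)) by apply: line; rewrite !ltW.
rewrite (deriveE_partial _ (smooth_differentiable sf Ut)) big1 => [|i _]; last first.
  by rewrite df0// mulr0.
rewrite mul0r scale1r scale0r addr0 (addrC u) subrK => /eqP.
by rewrite subr_eq0 => /eqP.
Qed.

(** * Independence of the chart *)

Section ChangeOfChart.
Context {R : realType} {m p : nat} (F F' : 'rV[R]_m -> 'rV[R]_p).
Variables (theta : 'rV[R]_m -> 'rV[R]_m) (u : 'rV[R]_m).
Hypothesis FE : {near u, F =1 F' \o theta}.
Hypothesis dtheta : differentiable theta u.
Hypothesis dF' : differentiable F' (theta u).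
Hypothesis freeJ : row_free ('J F u).
Hypothesis freeJ' : row_free ('J F' (theta u)).

Lemma partial_comp (f f' : 'rV[R]_m -> R) i : {near u, f =1 f' \o theta} ->
  differentiable f' (theta u) ->
  partial i f u = \sum_(j < m) 'J theta u i j * partial j f' (theta u).
Proof.
move=> ff' df'; rewrite (near_eq_partial i ff') partialE; last exact: differentiable_comp.
rewrite diff_comp//= -deriveE// deriveE_partial//; apply: eq_bigr => j _.
by rewrite mxE.
Qed.

Lemma jacobian_comp : 'J F u = 'J theta u *m 'J F' (theta u).
Proof.
have dF : differentiable F u.
  apply: near_eq_differentiable (differentiable_comp dtheta dF').
  by move: FE; apply: filterS => z ->.
have E (G : 'rV[R]_m -> 'rV[R]_p) z i a : differentiable G z ->
    'J G z i a = partial i (fun x => G x 0 a) z.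
  by move=> dG; rewrite partial_entry// partialE// mxE.
apply/matrixP => i a; rewrite E// [RHS]mxE.
rewrite (@partial_comp _ (fun x => F' x 0 a)).
- by apply: eq_bigr => j _; rewrite E.
- by move: FE; apply: filterS => z ->.
- exact: differentiable_entry.
Qed.

(** Coefficients of vector fields transform in this way, so the derivations are chart independent.
    Full rank of [J F = J theta J F'] makes [J theta] invertible; multiplied on the left by
    [gram F'] and then [J theta], both sides become [J F]. *)
Lemma frame_comp : ('J theta u)^T *m tangent_frame F u = tangent_frame F' (theta u).
Proof.
have unit_theta : 'J theta u \in unitmx.
  rewrite -row_free_unit; apply/row_freeP.
  have /row_freeP[B JB] := freeJ; exists ('J F' (theta u) *m B).
  by rewrite mulmxA -jacobian_comp.
apply: (can_inj (mulKmx (gram_unit freeJ'))).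
rewrite [RHS]mulKVmx; last exact: gram_unit.
apply: (can_inj (mulKmx unit_theta)); rewrite -jacobian_comp.
have -> : 'J theta u *m (gram F' (theta u) *m (('J theta u)^T *m tangent_frame F u)) =
    gram F u *m tangent_frame F u.
  by rewrite /gram jacobian_comp trmx_mul !mulmxA.
by rewrite mulKVmx//; exact: gram_unit.
Qed.

Lemma vf_comp (f f' : 'rV[R]_m -> R) a : {near u, f =1 f' \o theta} ->
  differentiable f' (theta u) ->
  vf (tangent_frame F) a f u = vf (tangent_frame F') a f' (theta u).
Proof.
move=> ff' df'; rewrite /vf -frame_comp.
under eq_bigr => i _ do rewrite (partial_comp i ff' df') mulr_sumr.
rewrite exchange_big; apply: eq_bigr => j _ /=.
rewrite [X in X * _]mxE mulr_suml; apply: eq_bigr => i _.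
by rewrite [_^T _ _]mxE mulrA (mulrC (tangent_frame F u i a)).
Qed.

Lemma tproj_comp : tproj F u = tproj F' (theta u).
Proof. by rewrite /tproj jacobian_comp trmx_mul -mulmxA frame_comp. Qed.

End ChangeOfChart.

(** * From charts to the manifold *)

Section Manifold.
Context {R : realType} {M : topologicalType} {m p : nat}.
Context (A : set (chart R M m)) (psi : M -> 'rV[R]_p).
Hypothesis atlas : smooth_atlas A.
Hypothesis imm : immersion A psi.
Implicit Types e : chart R M m.
Local Notation F e := (psi \o param e).

Let charts e : A e -> is_chart e.
Proof. by case: atlas => + _ _; exact. Qed.

Let cover x : exists2 e, A e & dom e x.
Proof. by case: atlas => _ + _; exact. Qed.

Lemma param_coords e x : A e -> dom e x -> param e (coords e x) = x.
Proof. by move=> /charts[_ _ + _ _]; exact. Qed.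

Lemma codom_coords e x : dom e x -> codom_of e (coords e x).
Proof. by move=> ex; exists x. Qed.

Lemma open_codom e : A e -> open (codom_of e).
Proof. by case/charts. Qed.

Lemma immersion_calculus e : A e ->
  tangent_calculus (codom_of e) (tangent_frame (F e)) (tproj (F e)) (F e).
Proof.
move=> Ae; apply: tangent_calculus_immersion; first exact: open_codom.
  exact: (proj1 imm).
by move=> u eu; exact: (proj2 imm _ Ae _ eu).
Qed.

Let freeJ e u : A e -> codom_of e u -> row_free ('J (F e) u).
Proof. by move=> Ae eu; exact: (proj2 imm _ Ae _ eu). Qed.

Lemma nbhs_param e x (Q : set M) : A e -> dom e x -> nbhs x Q ->
  \forall z \near coords e x, Q (param e z).
Proof.
move=> Ae ex xQ; have [_ _ _ _ cont] := charts Ae.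
by apply: (cont _ (codom_coords ex)); rewrite param_coords.
Qed.

Lemma nbhs_coords e x (Q : set 'rV[R]_m) : A e -> dom e x ->
  nbhs (coords e x) Q -> \forall y \near x, Q (coords e y) /\ dom e y.
Proof.
move=> Ae ex xQ; have [oe _ _ cont _] := charts Ae.
have n1 : \forall y \near x, Q (coords e y) by exact: (cont _ ex).
have n2 : \forall y \near x, dom e y by exact: open_nbhs_nbhs.
by apply: filterS2 n1 n2 => y ? ?; split.
Qed.

Lemma continuous_of_charts (g : M -> R) :
  (forall e u, A e -> codom_of e u -> {for u, continuous (g \o param e)}) ->
  continuous g.
Proof.
move=> cg x Q gQ; have [e Ae ex] := cover x.
have := cg e _ Ae (codom_coords ex) Q; rewrite /= param_coords// => /(_ gQ).
move=> /(nbhs_coords Ae ex); apply: filterS => y [+ ey].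
by rewrite /= param_coords.
Qed.

Lemma eq_near_chart (g : M -> R) (k : R) e x : A e -> dom e x ->
  (\forall z \near coords e x, g (param e z) = k) -> \forall y \near x, g y = k.
Proof.
move=> Ae ex /(nbhs_coords Ae ex); apply: filterS => y [+ ey].
by rewrite param_coords.
Qed.

Lemma locally_constant_connected (g : M -> R) : connected [set: M] ->
  continuous g -> (forall x, \forall y \near x, g y = g x) ->
  forall x y, g x = g y.
Proof.
move=> conn cg loc x y; pose B := [set z | g z = g x].
have : B = setT.
  apply: conn; first by exists x.
    exists B; last by rewrite setTI.
    rewrite openE => z Bz; have := loc z.
    by rewrite Bz.
  exists B; last by rewrite setTI.
  rewrite (_ : B = g @^-1` [set z | z = g x])//.
  by apply: preimage_closed; [move=> z _; exact: cg|exact: (@closed_eq R (g x))].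
by move=> BT; have : B y by rewrite BT.
Qed.

(** Only the level [k] has to be open; for the maximum value this is what the strong maximum
    principle supplies. *)
Lemma connected_set_level (g : M -> R) (k : R) x : connected [set: M] ->
  continuous g -> (forall z, g z = k -> \forall y \near z, g y = k) -> g x = k ->
  forall y, g y = k.
Proof.
move=> conn cg loc gx y; pose B := [set z | g z = k].
have : B = setT.
  apply: conn; first by exists x.
    exists B; last by rewrite setTI.
    by rewrite openE => z Bz; exact: loc.
  exists B; last by rewrite setTI.
  rewrite (_ : B = g @^-1` [set z | z = k])//.
  by apply: preimage_closed; [move=> z _; exact: cg|exact: (@closed_eq R k)].
by move=> BT; have : B y by rewrite BT.
Qed.

(** A chart is chosen at each point by [cid2]; compatibility makes the value independent of the
    choice. *)
Lemma globalize (T : Type) (phi : chart R M m -> 'rV[R]_m -> T) :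
  (forall e e' x, A e -> A e' -> dom e x -> dom e' x ->
    phi e (coords e x) = phi e' (coords e' x)) ->
  exists g : M -> T, forall e u, A e -> codom_of e u -> g (param e u) = phi e u.
Proof.
move=> compat; pose ch x := cid2 (cover x).
exists (fun x => phi (s2val (ch x)) (coords (s2val (ch x)) x)) => e u Ae [x ex <-].
rewrite param_coords//; apply: compat => //; first exact: (s2valP (ch x)).
exact: (s2valP' (ch x)).
Qed.

Section Overlap.
Variables (e e' : chart R M m).
Hypotheses (Ae : A e) (Ae' : A e').
Let theta := coords e' \o param e.

Let overlap u : codom_of e u -> dom e' (param e u) ->
  \forall z \near u, codom_of e z /\ dom e' (param e z).
Proof.
case=> x ex <-; rewrite param_coords// => e'x.
have [oe' _ _ _ _] := charts Ae'.
have n2 : \forall z \near coords e x, dom e' (param e z).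
  by apply: nbhs_param => //; exact: open_nbhs_nbhs.
have n1 : \forall z \near coords e x, codom_of e z.
  by apply: (open_near (open_codom Ae)) => //; exact: codom_coords.
by apply: filterS2 n1 n2 => z ? ?; split.
Qed.

Let near_map u : codom_of e u -> dom e' (param e u) ->
  {near u, F e =1 F e' \o theta}.
Proof.
move=> eu e'u; apply: filterS (overlap eu e'u) => z [_ e'z].
by rewrite /= param_coords.
Qed.

Let diff_theta u : codom_of e u -> dom e' (param e u) -> differentiable theta u.
Proof.
case=> x ex <-; rewrite param_coords// => e'x; case: atlas => _ _ /(_ e e' Ae Ae').
move=> /(_ 1%N)[+ _]; apply; exists x => //.
Qed.

Let codom_theta u : dom e' (param e u) -> codom_of e' (theta u).
Proof. exact: codom_coords. Qed.

Lemma tproj_overlap u : codom_of e u -> dom e' (param e u) ->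
  tproj (F e) u = tproj (F e') (theta u).
Proof.
move=> eu e'u; have e't := codom_theta e'u.
apply: tproj_comp; [exact: near_map|exact: diff_theta| |exact: freeJ|exact: freeJ].
exact: (smooth_differentiable (proj1 imm _ Ae')).
Qed.

Lemma vf_overlap (f f' : 'rV[R]_m -> R) a u : codom_of e u -> dom e' (param e u) ->
  (forall z, codom_of e z -> dom e' (param e z) -> f z = f' (theta z)) ->
  differentiable f' (theta u) ->
  vf (tangent_frame (F e)) a f u = vf (tangent_frame (F e')) a f' (theta u).
Proof.
move=> eu e'u ff' df'; have e't := codom_theta e'u.
apply: vf_comp => //; [exact: near_map|exact: diff_theta| |exact: freeJ|exact: freeJ|].
  exact: (smooth_differentiable (proj1 imm _ Ae')).
by apply: filterS (overlap eu e'u) => z [ez e'z]; exact: ff'.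
Qed.

Lemma flat_proj_overlap u : codom_of e u -> dom e' (param e u) ->
  flat_proj (tangent_frame (F e)) (tproj (F e)) (F e) u =
  flat_proj (tangent_frame (F e')) (tproj (F e')) (F e') (theta u).
Proof.
move=> eu e'u; have e't := codom_theta e'u.
have FE z : dom e' (param e z) -> F e z = F e' (theta z) by move=> e'z; rewrite /= param_coords.
have SE a : vf_mx (tangent_frame (F e)) a (tproj (F e)) u =
    vf_mx (tangent_frame (F e')) a (tproj (F e')) (theta u).
  apply/matrixP => i j; apply: etrans (mxE _ _ _ _) (etrans _ (esym (mxE _ _ _ _))).
  refine (@vf_overlap (fun x => tproj (F e) x i j) (fun x => tproj (F e') x i j)
    a u eu e'u _ _).
    move=> z ez e'z; exact (congr1 (fun B : 'M[R]_p => B i j) (tproj_overlap ez e'z)).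
  exact (smooth_differentiable (tc_smooth_proj (immersion_calculus Ae') i j) e't).
have hE : normal_part (tproj (F e)) (F e) u = normal_part (tproj (F e')) (F e') (theta u).
  by rewrite /normal_part (tproj_overlap eu e'u) FE.
have bE : shape (tangent_frame (F e)) (tproj (F e)) (F e) u =
    shape (tangent_frame (F e')) (tproj (F e')) (F e') (theta u).
  exact (f_equal2 (fun (h : 'rV[R]_p) (S : 'I_p -> 'M[R]_p) =>
    \matrix_(a, d) (h *m S a) 0 d : 'M[R]_p) hE (funext SE)).
exact (f_equal2 +%R (tproj_overlap eu e'u) bE).
Qed.

End Overlap.

Lemma round_proj_overlap e e' f0 u : A e -> A e' -> codom_of e u -> dom e' (param e u) ->
  round_proj (tproj (F e)) (F e) f0 u = round_proj (tproj (F e')) (F e') f0 (coords e' (param e u)).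
Proof.
move=> Ae Ae' eu e'u; rewrite /round_proj /normal_part (tproj_overlap Ae Ae' eu e'u) /=.
by rewrite param_coords.
Qed.

End Manifold.

(** * Extrema and maximum principles from the proper height function *)

Section ProperShrinker.
Context {R : realType} {M : topologicalType} {m p : nat}.
Context (A : set (chart R M m)) (psi : M -> 'rV[R]_p) (c : R) (v : 'rV[R]_p).
Implicit Types (e : chart R M m) (g : M -> R).
Hypothesis atlas : smooth_atlas A.
Hypothesis imm : immersion A psi.
Hypothesis c0 : c < 0.
Hypothesis sol : soliton A psi c.
Hypothesis infty : edot (psi x) v @[x --> at_infinity M] --> +oo.
Local Notation F e := (psi \o param e).
Local Notation W e := (tangent_frame (F e)).
Local Notation P e := (tproj (F e)).
Local Notation L e := (drift_laplacian (W e) (fun a z => c * (F e) z 0 a)).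
Local Notation height := (fun x => edot (psi x) v).

Let TC e (Ae : A e) := immersion_calculus atlas imm Ae.

Let cover x : exists2 e, A e & dom e x.
Proof. by case: atlas => _ + _; exact. Qed.

Let freeJ e (Ae : A e) u (eu : codom_of e u) : row_free ('J (F e) u) :=
  proj2 imm _ Ae _ eu.

Lemma soliton_local e (Ae : A e) u : codom_of e u ->
  c *: normal_part (P e) (F e) u =
  \sum_(a < p) row a (vf_mx (W e) a (P e) u *m (1%:M - P e u)).
Proof.
move=> eu; have oU := tc_open (TC Ae).
rewrite -(mean_curvatureE oU (proj1 imm _ Ae) (freeJ Ae) eu) -(sol Ae eu).
by rewrite normal_projE.
Qed.

Definition chart_smooth g : Prop :=
  forall e, A e -> smooth_on (codom_of e) (g \o param e).

Lemma chart_smooth_continuous g : chart_smooth g -> continuous g.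
Proof.
move=> sg; apply: (continuous_of_charts atlas) => e u Ae eu.
exact: (smooth_continuous (sg e Ae) eu).
Qed.

Let sbeta e (Ae : A e) a : smooth_on (codom_of e) (fun z => c * (F e) z 0 a).
Proof.
apply: (smoothM (tc_open (TC Ae)) _ (tc_smooth_map (TC Ae) 0 a)); exact: smooth_cst.
Qed.

Lemma chart_smooth_edot w : chart_smooth (fun x => edot (psi x) w).
Proof. by move=> e Ae; exact (smooth_edot_map (TC Ae) w). Qed.

Lemma chart_smooth_norm : chart_smooth (fun x => edot (psi x) (psi x)).
Proof.
move=> e Ae; apply: (smooth_sum _ _ (tc_open (TC Ae))) => i.
exact (smoothM (tc_open (TC Ae)) (tc_smooth_map (TC Ae) 0 i) (tc_smooth_map (TC Ae) 0 i)).
Qed.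

Lemma chart_smoothD g g' : chart_smooth g -> chart_smooth g' ->
  chart_smooth (fun x => g x + g' x).
Proof. by move=> sg sg' e Ae; exact (smoothD (tc_open (TC Ae)) (sg e Ae) (sg' e Ae)). Qed.

Lemma chart_smoothZ k g : chart_smooth g -> chart_smooth (fun x => k * g x).
Proof.
move=> sg e Ae; apply: (smoothM (tc_open (TC Ae)) _ (sg e Ae)); exact: smooth_cst.
Qed.

Lemma drift_height e (Ae : A e) u w : codom_of e u ->
  L e ((fun x => edot (psi x) w) \o param e) u = c * edot (psi (param e u)) w.
Proof. by move=> eu; exact (drift_edot_map (TC Ae) (soliton_local Ae) w eu). Qed.

Lemma local_max_chart g e x : A e -> dom e x -> chart_smooth g ->
  (\forall y \near x, g y <= g x) ->
  (forall a, vf (W e) a (g \o param e) (coords e x) = 0) /\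
  (forall b, drift_laplacian (W e) b (g \o param e) (coords e x) <= 0).
Proof.
move=> Ae ex sg /(nbhs_param atlas Ae ex) gmax.
have eu : codom_of e (coords e x) by exact: codom_coords.
have oU := tc_open (TC Ae); have sW := tc_smooth_frame (TC Ae).
have gmax' : \forall z \near coords e x, (g \o param e) z <= (g \o param e) (coords e x).
  by apply: filterS gmax => z; rewrite /= (param_coords atlas Ae ex).
split=> [a|b]; first by have [] := local_max_vf oU sW a (sg e Ae) eu gmax'.
exact: (local_max_drift_laplacian b oU sW (sg e Ae) eu gmax').
Qed.

Lemma local_min_chart g e x : A e -> dom e x -> chart_smooth g ->
  (\forall y \near x, g x <= g y) ->
  (forall a, vf (W e) a (g \o param e) (coords e x) = 0) /\
  (forall b, 0 <= drift_laplacian (W e) b (g \o param e) (coords e x)).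
Proof.
move=> Ae ex sg gmin.
have eu : codom_of e (coords e x) by exact: codom_coords.
have gmax : \forall y \near x, -1 * g y <= -1 * g x.
  by apply: filterS gmin => y; rewrite !mulN1r lerN2.
have oU := tc_open (TC Ae); have sW := tc_smooth_frame (TC Ae).
have [D0 L0] := local_max_chart Ae ex (chart_smoothZ (-1) sg) gmax.
split=> [a|b].
  have := D0 a; rewrite (vfZ (W e) a (-1) eu (sg e Ae)) => /eqP.
  by rewrite mulN1r oppr_eq0 => /eqP.
have := L0 b; rewrite (drift_laplacianZ b oU sW (-1) eu (sg e Ae)).
by rewrite mulN1r oppr_le0.
Qed.

Lemma sublevel_compact (C : R) : compact [set x | edot (psi x) v <= C].
Proof.
have [K cK KC] : at_infinity M (height @^-1` [set z | C < z]).
  by apply: infty; exists C; split; [exact: num_real|].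
apply: (subclosed_compact _ cK).
  rewrite (_ : [set x | _] = height @^-1` [set z | z <= C])//.
  apply: preimage_closed; last exact: closed_le.
  by move=> x _; exact: (chart_smooth_continuous (chart_smooth_edot v)).
move=> x /= xC; apply: contrapT => nKx; have := KC x nKx.
by rewrite /= ltNge xC.
Qed.

(** Where [g <= g x0], the height is at most [g x0 + C], and this sublevel set is compact. *)
Lemma proper_min g (C : R) (x0 : M) : continuous g ->
  (forall x, edot (psi x) v <= g x + C) ->
  exists q, forall x, g q <= g x.
Proof.
move=> cg gC; have := @compact_min R M g [set x | edot (psi x) v <= g x0 + C].
case.
- by exists x0; exact: gC.
- exact: sublevel_compact.
- by move=> x _; exact: cg.
move=> q _ qmin; exists q => x; have [xl|xg] := leP (edot (psi x) v) (g x0 + C).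
  exact: qmin.
apply: (@le_trans _ _ (g x0)); first by apply: qmin; exact: gC.
by have := lt_le_trans xg (gC x); rewrite ltrD2r => /ltW.
Qed.

(** At a minimum [0 <= L u = c u] with [c < 0], so the minimal height is nonpositive. In particular
    the compact sublevel set at level [1], used below, is not empty. *)
Lemma height_min (x0 : M) :
  exists q, edot (psi q) v <= 0 /\ forall x, edot (psi q) v <= edot (psi x) v.
Proof.
have [q qmin] : exists q, forall x, height q <= height x.
  apply: (@proper_min height 0 x0) => [|x]; last by rewrite addr0.
  exact: (chart_smooth_continuous (chart_smooth_edot v)).
exists q; split=> //; have [e Ae ex] := cover q.
have [_ Lq] := @local_min_chart height e q Ae ex (chart_smooth_edot v)
  (filterS (fun y _ => qmin y) filterT).
have := Lq (fun a z => c * (F e) z 0 a).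
rewrite (drift_height Ae v (codom_coords ex)) (param_coords atlas Ae ex).
by rewrite nmulr_rge0.
Qed.

(* Khas'minskii: the height function [u] satisfies [L u = c u < 0] outside a
   compact set and tends to infinity, so [f - eps u] is controlled there. *)
Lemma subharmonic_max f (C : R) (x0 : M) : chart_smooth f ->
  (forall e u, A e -> codom_of e u -> 0 <= L e (f \o param e) u) ->
  (forall x, f x <= C) -> exists q, forall x, f x <= f q.
Proof.
move=> sf Lf fC.
have cf := chart_smooth_continuous sf.
have ch := chart_smooth_continuous (chart_smooth_edot v).
have [q0 [q0_le0 _]] := height_min x0.
have [q q1 qmax] : exists2 q, edot (psi q) v <= 1 &
    forall x, edot (psi x) v <= 1 -> f x <= f q.
  apply: (@compact_max R M f [set x | edot (psi x) v <= 1]).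
  - by exists q0; exact: (le_trans q0_le0 ler01).
  - exact: sublevel_compact.
  - by move=> x _; exact: cf.
exists q => x; rewrite leNgt; apply/negP => fx.
have hx : 1 < edot (psi x) v by rewrite ltNge; apply/negP => /qmax; rewrite leNgt fx.
have hx0 : 0 < edot (psi x) v - 1 by rewrite subr_gt0.
(* Half of the slope for which [g x] would equal [f q - eps]. Thus [g x > f q - eps], while
   [g <= f q - eps] at height [1]. *)
pose eps := (f x - f q) / (edot (psi x) v - 1) / 2.
have eps0 : 0 < eps by rewrite !divr_gt0// subr_gt0.
pose g y := f y + - eps * edot (psi y) v.
have sg : chart_smooth g.
  apply: chart_smoothD => //; apply: chart_smoothZ; exact: chart_smooth_edot.
have cg := chart_smooth_continuous sg.
have gx : f q - eps < g x.
  rewrite /g; have E : eps * (edot (psi x) v - 1) = (f x - f q) / 2.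
    by rewrite /eps mulrAC divfK// gt_eqF.
  have : (f x - f q) / 2 < f x - f q.
    by rewrite ltr_pdivrMr// ltr_pMr ?ltr1n// subr_gt0.
  by rewrite -E mulrBr mulr1; lra.
(* At height at least the second argument, [f <= C] already gives [g < f q - eps]; the first
   argument keeps [x] in the range. So [g] is maximal strictly between heights [1] and [D]. *)
pose D := Num.max (edot (psi x) v) ((C - f q) / eps + 1 + 1).
have [z [zD z1] zmax] : exists2 z, (edot (psi z) v <= D /\ 1 <= edot (psi z) v) &
    forall y, (edot (psi y) v <= D /\ 1 <= edot (psi y) v) -> g y <= g z.
  apply: (@compact_max R M g [set y | edot (psi y) v <= D /\ 1 <= edot (psi y) v]).
  - by exists x; split; [rewrite /D le_max lexx|exact: ltW].
  - apply: (subclosed_compact _ (@sublevel_compact D)); last by move=> y [].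
    rewrite (_ : [set y | _] = (height @^-1` [set t | t <= D]) `&` (height @^-1` [set t | 1 <= t]))//.
    apply: closedI; apply: preimage_closed.
    + by move=> y _; exact: ch.
    + exact: closed_le.
    + by move=> y _; exact: ch.
    + exact: closed_ge.
  - by move=> y _; exact: cg.
have gz : f q - eps < g z.
  by apply: (lt_le_trans gx); apply: zmax; split; [rewrite /D le_max lexx|exact: ltW].
have z1' : 1 < edot (psi z) v.
  rewrite lt_neqAle z1 andbT; apply/eqP => E.
  have := qmax z; rewrite -E => /(_ (lexx _)) fz; move: gz; rewrite /g -E; lra.
have zD' : edot (psi z) v < D.
  rewrite lt_neqAle zD andbT; apply/eqP => E.
  have DC : (C - f q) / eps + 1 + 1 <= edot (psi z) v by rewrite E /D le_max lexx orbT.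
  have : eps * ((C - f q) / eps + 1 + 1) <= eps * edot (psi z) v by rewrite ler_pM2l.
  rewrite !mulrDr mulrCA divff ?gt_eqF// !mulr1 => le1.
  have := fC z; move: gz; rewrite /g; lra.
have [e Ae ez] := cover z.
have nz : \forall y \near z, g y <= g z.
  have n1 : \forall y \near z, 1 < edot (psi y) v by have /cvgr_gt := ch z; apply.
  have n2 : \forall y \near z, edot (psi y) v < D by have /cvgr_lt := ch z; apply.
  by apply: filterS2 n1 n2 => y ? ?; apply: zmax; split; exact: ltW.
have [_ Lz] := local_max_chart Ae ez sg nz.
have := Lz (fun a z => c * (F e) z 0 a); rewrite leNgt => /negP; apply.
have eu := codom_coords ez; have oU := tc_open (TC Ae); have sW := tc_smooth_frame (TC Ae).
have sh := chart_smooth_edot v Ae.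
rewrite (drift_laplacianD _ oU sW eu (sf e Ae) (chart_smoothZ (- eps) (chart_smooth_edot v) Ae)).
rewrite (drift_laplacianZ _ oU sW (- eps) eu sh) (drift_height Ae v eu).
rewrite (param_coords atlas Ae ez) ltr_wpDl//; first exact: Lf.
by rewrite nmulr_rgt0 ?oppr_lt0// nmulr_rlt0// (lt_trans ltr01).
Qed.

Lemma subharmonic_constant f (C : R) : connected [set: M] -> chart_smooth f ->
  (forall e u, A e -> codom_of e u -> 0 <= L e (f \o param e) u) ->
  (forall x, f x <= C) -> forall x y, f x = f y.
Proof.
move=> conn sf Lf fC x0 y0; have [q qmax] := subharmonic_max x0 sf Lf fC.
suff E y : f y = f q by rewrite !E.
apply: (connected_set_level conn (chart_smooth_continuous sf) _ (erefl (f q))) => z fz.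
have [e Ae ez] := cover z.
apply: (eq_near_chart atlas Ae ez).
have oU := tc_open (TC Ae); have sW := tc_smooth_frame (TC Ae).
apply: (strong_max_local oU sW (sbeta Ae) (frame_free (freeJ Ae)) (sf e Ae)).
- by move=> w _; exact: qmax.
- by move=> w ew; exact: Lf.
- exact: codom_coords.
- by rewrite /= (param_coords atlas Ae ez).
Qed.

(* For [C] large [C u - |psi|^2] would have an interior minimum on [u <= 1],
   where its Laplacian is [- 2 m]. *)
Lemma minimal_empty (x0 : M) : (0 < m)%N ->
  (forall e u, A e -> codom_of e u -> normal_part (P e) (F e) u = 0) -> False.
Proof.
move=> m0 h0; have [q [q0 _]] := height_min x0.
have q1 : edot (psi q) v <= 1 by exact: (le_trans q0 ler01).
have cn := chart_smooth_continuous chart_smooth_norm.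
have ch := chart_smooth_continuous (chart_smooth_edot v).
have [r _ rmax] : exists2 r, edot (psi r) v <= 1 &
    forall x, edot (psi x) v <= 1 -> edot (psi x) (psi x) <= edot (psi r) (psi r).
  apply: (@compact_max R M (fun x => edot (psi x) (psi x)) [set x | edot (psi x) v <= 1]).
  - by exists q.
  - exact: sublevel_compact.
  - by move=> x _; exact: cn.
(* This makes [g] positive at height [1], whereas [g q <= 0] because the height of [q] is
   nonpositive. *)
pose C := edot (psi r) (psi r) + 1.
pose g x := C * edot (psi x) v + -1 * edot (psi x) (psi x).
have sg : chart_smooth g.
  apply: chart_smoothD; apply: chart_smoothZ; first exact: chart_smooth_edot.
  exact: chart_smooth_norm.
have C0 : 0 < C by rewrite /C ltr_wpDl// edot_ge0.
have [z z1 zmin] : exists2 z, edot (psi z) v <= 1 &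
    forall x, edot (psi x) v <= 1 -> g z <= g x.
  apply: (@compact_min R M g [set x | edot (psi x) v <= 1]).
  - by exists q.
  - exact: sublevel_compact.
  - by move=> x _; exact: (chart_smooth_continuous sg).
have gq : g q <= 0.
  rewrite /g mulN1r subr_le0; apply: (@le_trans _ _ 0); last exact: edot_ge0.
  by rewrite pmulr_rle0.
have z1' : edot (psi z) v < 1.
  rewrite lt_neqAle z1 andbT; apply/eqP => E.
  have := le_trans (zmin q q1) gq; rewrite /g E mulr1 mulN1r subr_le0 leNgt => /negP; apply.
  by rewrite (le_lt_trans (rmax z z1))// /C ltrDl.
have [e Ae ez] := cover z.
have nz : \forall y \near z, g z <= g y.
  have n1 : \forall y \near z, edot (psi y) v < 1 by have /cvgr_lt := ch z; apply.
  by apply: filterS n1 => y ?; apply: zmin; exact: ltW.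
have [_ Lz] := local_min_chart Ae ez sg nz.
have := Lz (fun=> cst 0); rewrite leNgt => /negP; apply.
have eu := codom_coords ez; have oU := tc_open (TC Ae); have sW := tc_smooth_frame (TC Ae).
have sh := chart_smooth_edot v Ae; have sn := chart_smooth_norm Ae.
rewrite (drift_laplacianD _ oU sW eu (chart_smoothZ C (chart_smooth_edot v) Ae)
  (chart_smoothZ (-1) chart_smooth_norm Ae)).
rewrite (drift_laplacianZ _ oU sW C eu sh) (drift_laplacianZ _ oU sW (-1) eu sn).
have E f : drift_laplacian (W e) (fun=> cst 0) f (coords e z) =
    \sum_(a < p) vf (W e) a (vf (W e) a f) (coords e z).
  by apply: eq_bigr => a _; rewrite mul0r addr0.
have lt0 s1 s2 : s1 = 0 -> s2 = 2 * m%:R -> C * s1 + -1 * s2 < 0.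
  by move=> -> ->; rewrite mulr0 add0r mulN1r oppr_lt0 mulr_gt0// ltr0n.
rewrite !E; apply: lt0.
  refine (etrans (laplacian_edot_map (TC Ae) (soliton_local Ae) v eu) _).
  by rewrite (h0 e _ Ae eu) edot0l mulr0.
exact (laplacian_sqnorm_map (TC Ae) eu (fun z => h0 e z Ae)).
Qed.

End ProperShrinker.

(** * Classification *)

Lemma mulmx_tr_entry {R : realType} a p (B C : 'M[R]_(a, p)) i j :
  (B *m C^T) i j = edot (row i B) (row j C).
Proof. by rewrite mxE; apply: eq_bigr => k _; rewrite !mxE. Qed.

Section AdaptedBasis.
Context {R : realType} {p : nat} (r : nat) (Pi : 'M[R]_p).
Hypothesis PiT : Pi^T = Pi.
Hypothesis PiPi : Pi *m Pi = Pi.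
Hypothesis trPi : \tr Pi = r%:R.

(** Gram-Schmidt steered by traces: [B'] removes from the projection [B] the vectors found so far,
    and its trace [\tr B - k] is nonzero, so some row of [B'] is nonzero and can be normalized. *)
Lemma orthonormal_adapted k : (k <= p)%N -> exists q : nat -> 'rV[R]_p,
  (forall i j, (i < k)%N -> (j < k)%N -> edot (q i) (q j) = (i == j)%:R) /\
  (forall i, (i < k)%N -> (i < r)%N -> q i *m Pi = q i).
Proof.
elim: k => [|k IH] kp; first by exists (fun=> 0).
have [q [qO qPi]] := IH (ltnW kp).
(* The first [r] vectors are sought in the range of [Pi], the later ones anywhere. *)
pose B := if (k < r)%N then Pi else 1%:M.
have BB : B *m B = B by rewrite /B; case: ifP => // _; rewrite mulmx1.
have BT : B^T = B by rewrite /B; case: ifP => // _; rewrite trmx1.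
have qB i : (i < k)%N -> q i *m B = q i.
  rewrite /B; case: ifP => [kr ik|_ _]; last by rewrite mulmx1.
  by apply: qPi => //; exact: ltn_trans kr.
have trB : \tr B != k%:R.
  rewrite /B; case: ifP => [kr|_]; first by rewrite trPi eqr_nat gtn_eqF.
  by rewrite mxtrace1 eqr_nat gtn_eqF.
pose B' := B - \sum_(i < k) (q i)^T *m q i.
have B'q l : (l < k)%N -> B' *m (q l)^T = 0.
  move=> lk; rewrite mulmxBl -{1}BT -trmx_mul qB// mulmx_suml.
  rewrite (bigD1 (Ordinal lk))//= big1 => [|i il].
    rewrite addr0 -mulmxA [q l *m _]mx11_scalar -edotE qO// eqxx.
    by rewrite mulmx1 subrr.
  rewrite -mulmxA [q i *m _]mx11_scalar -edotE qO//.
  by rewrite -[(i : nat) == l]/(i == Ordinal lk) (negbTE il) raddf0 mulmx0.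
have B'B : B' *m B = B'.
  rewrite mulmxBl BB mulmx_suml; congr (_ - _); apply: eq_bigr => i _.
  by rewrite -mulmxA qB.
have [j yj] : exists j, row j B' != 0.
  apply: contrapT => no; have : \tr B' = 0.
    rewrite (_ : B' = 0) ?mxtrace0//; apply/row_matrixP => j; rewrite row0.
    by apply/eqP; apply: contrapT => /negP yj; apply: no; exists j.
  have -> : \tr B' = \tr B - k%:R.
    rewrite linearB; congr (_ - _); rewrite raddf_sum.
    rewrite -[k in RHS]card_ord -sumr_const; apply: eq_bigr => i _.
    by rewrite /= mxtrace_mulC [q i *m _]mx11_scalar -edotE qO// eqxx mxtrace1.
  by move/eqP; rewrite subr_eq0 (negbTE trB).
pose y := row j B'; pose s := Num.sqrt (edot y y).
have yy0 : 0 < edot y y by rewrite lt_def edot_ge0 edot_eq0 yj.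
have s0 : s != 0 by rewrite gt_eqF// sqrtr_gt0.
have ss : s * s = edot y y by rewrite -expr2 sqr_sqrtr// ltW.
exists (fun i => if (i < k)%N then q i else s^-1 *: y); split=> [i l|i].
  have yq t : (t < k)%N -> edot y (q t) = 0.
    by move=> tk; rewrite edotE -row_mul B'q// row0 mxE.
  rewrite !ltnS leq_eqVlt => /orP[/eqP ->|ik]; rewrite leq_eqVlt => /orP[/eqP ->|lk].
  - rewrite ltnn eqxx edotZl edotZr -ss; rewrite mulKf// mulVf//.
  - by rewrite ltnn lk edotZl yq// mulr0 gtn_eqF.
  - by rewrite ltnn ik edotZr edotC yq// mulr0 ltn_eqF.
  - by rewrite ik lk qO.
rewrite ltnS leq_eqVlt => /orP[/eqP ->|ik] ir; last by rewrite ik qPi.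
rewrite ltnn -scalemxAl; congr (_ *: _).
by move: B'B; rewrite /B ir => B'Pi; rewrite -row_mul B'Pi.
Qed.

(** A count: [tr Pi = r] is the sum of [|q_j Pi|^2] over the basis, and the first [r] terms are [1]
    each, so the others vanish. *)
Lemma adapted_basis : exists Q : 'M[R]_p, Q *m Q^T = 1%:M /\
  forall i : 'I_p, row i Q *m Pi = if (i < r)%N then row i Q else 0.
Proof.
have [q [qO qPi]] := orthonormal_adapted (leqnn p).
pose Q : 'M[R]_p := \matrix_(i < p) q i.
have QQ : Q *m Q^T = 1%:M.
  apply/matrixP => i j; rewrite [RHS]mxE -[i == j]/((i : nat) == j) -qO//.
  by rewrite mulmx_tr_entry !rowK.
exists Q; split=> // i; rewrite rowK; case: ifP => [ir|/negbT]; first exact: qPi.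
rewrite -leqNgt => ri; have rp : (r <= p)%N by exact: leq_trans ri (ltnW (ltn_ord i)).
have E : \sum_(j < p) edot (q j *m Pi) (q j *m Pi) = r%:R.
  rewrite -trPi -[Pi in RHS]mul1mx -(mulmx1C QQ) -mulmxA mxtrace_mulC.
  apply: eq_bigr => j _; rewrite edot_mulmx PiT -mulmxA PiPi edotC.
  by rewrite mulmx_tr_entry row_mul rowK.
have : \sum_(j < p | (r <= j)%N) edot (q j *m Pi) (q j *m Pi) = 0.
  move: E; rewrite (bigID (fun j : 'I_p => (j < r)%N)) /=.
  rewrite (eq_bigr (fun=> 1)) => [|j jr]; last by rewrite qPi// qO// eqxx.
  rewrite -(big_ord_widen p (fun=> 1) rp) sumr_const card_ord.
  under eq_bigl => j do rewrite -leqNgt.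
  by rewrite -[X in _ = X]addr0 => /addrI.
move/eqP; rewrite psumr_eq0 => [/allP /(_ i (mem_index_enum i))|j _]; last exact: edot_ge0.
by rewrite ri /= edot_eq0 => /eqP.
Qed.

End AdaptedBasis.

(** In an adapted orthonormal basis the range of [Pi] is spanned by the [m + 1] coordinates
    [i <= m]. With [k = m] the Euclidean factor of [sphere_product] is a point. *)
Lemma sphere_productE {R : realType} (m n : nat) (rho : R) (Pi : 'M[R]_n.+1) :
  (m <= n)%N -> 0 < rho -> Pi^T = Pi -> Pi *m Pi = Pi -> \tr Pi = m.+1%:R ->
  is_sphere_product m m (Num.sqrt rho) [set y | y *m Pi = y /\ edot y y = rho].
Proof.
move=> mn rho0 PiT PiPi trPi; have [Q [QQ QPi]] := adapted_basis PiT PiPi trPi.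
have QQ' := mulmx1C QQ.
have sumE (z : 'rV[R]_n.+1) : (forall i : 'I_n.+1, (m < i)%N -> z 0 i = 0) ->
    \sum_(i < n.+1 | (i <= m)%N) z 0 i ^+ 2 = edot z z.
  move=> z0; rewrite /edot [RHS](bigID (fun i : 'I_n.+1 => (i <= m)%N)) /=.
  rewrite [X in _ = _ + X]big1 ?addr0 => [|i]; last first.
    by rewrite -ltnNge => /z0 ->; rewrite mulr0.
  by apply: eq_bigr => i _; rewrite expr2.
have edotQ (z : 'rV[R]_n.+1) : edot (z *m Q) (z *m Q) = edot z z.
  by rewrite edot_mulmx -mulmxA QQ mulmx1.
have sqrtE (t : R) : 0 <= t -> Num.sqrt t = Num.sqrt rho -> t = rho.
  by move=> t0 /(congr1 (fun s => s ^+ 2)); rewrite !sqr_sqrtr// ltW.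
exists Q => //; apply/seteqP; split=> [y [yPi yrho]|_ [z [zrho z0] <-]].
  have yE : y *m Q^T *m Q = y by rewrite -mulmxA QQ' mulmx1.
  have z0 (i : 'I_n.+1) : (m < i)%N -> (y *m Q^T) 0 i = 0.
    move=> mi; have := QPi i; rewrite ltnS leqNgt mi /= => QPi0.
    rewrite -yPi -mulmxA -{1}PiT -trmx_mul.
    rewrite mxE big1// => k _; rewrite mxE.
    have := congr1 (fun w : 'rV[R]_n.+1 => w 0 k) QPi0; rewrite -row_mul !mxE => ->.
    by rewrite mulr0.
  exists (y *m Q^T) => //; split=> //.
  by rewrite sumE// -edotQ yE yrho.
split; last first.
  rewrite edotQ -sumE//; apply: sqrtE => //.
  by apply: sumr_ge0 => i _; exact: sqr_ge0.
rewrite -mulmxA; apply/rowP => k; rewrite [LHS]mxE [RHS]mxE; apply: eq_bigr => i _.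
have [im|mi] := leqP i m; last by rewrite z0// !mul0r.
congr (_ * _); have := congr1 (fun w : 'rV[R]_n.+1 => w 0 k) (QPi i).
by rewrite ltnS im -row_mul !mxE.
Qed.

Section Classification.
Context {R : realType} {M : topologicalType} {m p : nat}.
Context (A : set (chart R M m)) (psi : M -> 'rV[R]_p) (c : R) (v : 'rV[R]_p).
Implicit Types (e : chart R M m) (g : M -> R).
Hypothesis atlas : smooth_atlas A.
Hypothesis imm : immersion A psi.
Hypothesis conn : connected [set: M].
Hypothesis c0 : c < 0.
Hypothesis sol : soliton A psi c.
Hypothesis infty : edot (psi x) v @[x --> at_infinity M] --> +oo.
Hypothesis II_le : locally_everywhere A psi (fun F u => second_ff_sqnorm F u <= - c).
Local Notation F e := (psi \o param e).
Local Notation W e := (tangent_frame (F e)).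
Local Notation P e := (tproj (F e)).
Local Notation L e := (drift_laplacian (W e) (fun a z => c * (F e) z 0 a)).

Let TC e (Ae : A e) := immersion_calculus atlas imm Ae.
Let SL e (Ae : A e) := soliton_local atlas imm sol Ae.

Let cover x : exists2 e, A e & dom e x.
Proof. by case: atlas => _ + _; exact. Qed.

Let freeJ e (Ae : A e) u (eu : codom_of e u) : row_free ('J (F e) u) :=
  proj2 imm _ Ae _ eu.

Lemma second_ff_sqnorm_chart e (Ae : A e) u : codom_of e u ->
  second_ff_sqnorm (F e) u = second_sqnorm (W e) (P e) u.
Proof.
move=> eu; have oU := tc_open (TC Ae).
exact: (second_ff_sqnormE oU (proj1 imm _ Ae) (freeJ Ae) eu).
Qed.

Let sqII_le e (Ae : A e) u : codom_of e u -> second_sqnorm (W e) (P e) u <= - c.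
Proof. by move=> eu; rewrite -(second_ff_sqnorm_chart Ae eu); exact: (II_le Ae eu). Qed.

Lemma mean_curvature_chart e (Ae : A e) u : codom_of e u ->
  mean_curvature (F e) u = c *: normal_part (P e) (F e) u.
Proof. by move=> eu; rewrite -(sol Ae eu) normal_projE. Qed.

Lemma normal_sqnorm_constant : exists k, forall e u, A e -> codom_of e u ->
  normal_sqnorm (P e) (F e) u = k.
Proof.
have [[x0 _]|noM] := pselect (exists x : M, True); last first.
  by exists 0 => e u Ae [x _ _]; case: noM; exists x.
have [f fE] : exists f : M -> R, forall e u, A e -> codom_of e u ->
    f (param e u) = normal_sqnorm (P e) (F e) u.
  apply: (globalize atlas (phi := fun e => normal_sqnorm (P e) (F e))) => e e' x Ae Ae' ex e'x.
  have eu := codom_coords ex.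
  have e'u : dom e' (param e (coords e x)) by rewrite (param_coords atlas Ae ex).
  have PE := tproj_overlap atlas imm Ae Ae' eu e'u.
  have hE : normal_part (P e) (F e) (coords e x) = normal_part (P e') (F e') (coords e' x).
    rewrite /normal_part PE /= (param_coords atlas Ae ex) (param_coords atlas Ae' e'x).
    by [].
  exact (congr1 (fun h => edot h h) hE).
have sf : chart_smooth A f.
  move=> e Ae; apply: (eq_smooth (tc_open (TC Ae)) _ (smooth_normal_sqnorm (TC Ae))) => u eu.
  by rewrite /= fE.
exists (f x0) => e u Ae eu; rewrite -fE//.
apply: (subharmonic_constant (C := - m%:R / c) atlas imm c0 sol infty conn sf) => [e' u' Ae' e'u'|x].
  have := drift_normal_sqnorm_ge0 (TC Ae') (SL Ae') e'u' c0 (sqII_le Ae' e'u').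
  have oU := tc_open (TC Ae').
  rewrite (_ : L e' _ _ = \sum_(a < p) (vf (W e') a (vf (W e') a (normal_sqnorm (P e') (F e'))) u' +
    c * (F e') u' 0 a * vf (W e') a (normal_sqnorm (P e') (F e')) u'))//.
  have E a z : codom_of e' z -> vf (W e') a (f \o param e') z = vf (W e') a (normal_sqnorm (P e') (F e')) z.
    by move=> e'z; apply: (eq_vf (W e') oU) => // w e'w; rewrite /= fE.
  apply: eq_bigr => a _; rewrite (E a _ e'u') (eq_vf (W e') oU a e'u' (E a)).
  by [].
have [e' Ae' ex] := cover x; have eu' := codom_coords ex.
have := normal_sqnorm_le (TC Ae') (SL Ae') eu' c0 (sqII_le Ae' eu').
by rewrite -(fE e' _ Ae' eu') (param_coords atlas Ae' ex).
Qed.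

(** Compatibility turns the family into a function on [M]. By [vf_partial] the derivations control
    all partial derivatives, so its entries are locally constant, hence constant by
    connectedness. *)
Lemma constant_field (Phi : chart R M m -> 'rV[R]_m -> 'M[R]_p) (x0 : M) :
  (forall e e' u, A e -> A e' -> codom_of e u -> dom e' (param e u) ->
     Phi e u = Phi e' (coords e' (param e u))) ->
  (forall e, A e -> smooth_mx (codom_of e) (Phi e)) ->
  (forall e u a, A e -> codom_of e u -> vf_mx (W e) a (Phi e) u = 0) ->
  exists B, forall e u, A e -> codom_of e u -> Phi e u = B.
Proof.
move=> compat sPhi dPhi.
have [G GE] : exists G : M -> 'M[R]_p, forall e u, A e -> codom_of e u -> G (param e u) = Phi e u.
  apply: (globalize atlas) => e e' x Ae Ae' ex e'x.
  have eu := codom_coords ex.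
  have := compat e e' _ Ae Ae' eu; rewrite (param_coords atlas Ae ex); exact.
exists (G x0) => e u Ae eu; rewrite -GE//; apply/matrixP => i j.
have sG : chart_smooth A (fun x => G x i j).
  move=> e' Ae'; apply: (eq_smooth (tc_open (TC Ae')) _ (sPhi e' Ae' i j)) => z e'z.
  by rewrite /= GE.
apply: (locally_constant_connected (g := fun x => G x i j) conn).
  exact: (chart_smooth_continuous atlas sG).
move=> x; have [e' Ae' e'x] := cover x; apply: (eq_near_chart atlas Ae' e'x).
have oU := tc_open (TC Ae'); have e'u := codom_coords e'x.
have := locally_constant oU e'u (sG e' Ae'); rewrite /= (param_coords atlas Ae' e'x).
apply=> z k e'z; rewrite (vf_partial (freeJ Ae') _ _ e'z) big1// => a _.
rewrite (_ : vf _ _ _ _ = 0) ?mulr0//.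
have := congr1 (fun B : 'M[R]_p => B i j) (dPhi e' z a Ae' e'z).
rewrite [LHS]mxE [RHS]mxE => <-; apply: (eq_vf (W e') oU) => // w e'w.
by rewrite /= GE.
Qed.

(** * The case of nonzero mean curvature *)

Section Positive.
Variable f0 : R.
Hypothesis f0_gt0 : 0 < f0.
Hypothesis sqhE : forall e u, A e -> codom_of e u -> normal_sqnorm (P e) (F e) u = f0.

Let sqh_e e (Ae : A e) u (eu : codom_of e u) := sqhE Ae eu.

Lemma second_ff_sqnorm_rigid :
  locally_everywhere A psi (fun F u => second_ff_sqnorm F u = - c).
Proof.
move=> e Ae u eu; rewrite (second_ff_sqnorm_chart Ae eu).
exact: (second_sqnorm_rigid (TC Ae) (SL Ae) f0_gt0 (sqh_e Ae) (@sqII_le e Ae) eu).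
Qed.

(** With [H = c h], rigidity makes each derivative of [H] a combination of rows of [b], which are
    tangential and die under the normal projection. *)
Lemma parallel_rigid : parallel_mean_curvature A psi.
Proof.
move=> e Ae u eu i; have oU := tc_open (TC Ae); have sh := smooth_normal_part (TC Ae).
have nH k : {near u, (fun z => c * normal_part (P e) (F e) z 0 k) =1
    (fun z => mean_curvature (F e) z 0 k)}.
  by apply: (open_near_eq oU eu) => z ez; rewrite (mean_curvature_chart Ae ez) [RHS]mxE.
have sch k : smooth_on (codom_of e) (fun z => c * normal_part (P e) (F e) z 0 k).
  by apply: (smoothM oU _ (sh 0 k)); exact: smooth_cst.
have dH : derivable (mean_curvature (F e)) u (delta_mx 0 i).
  apply/derivable_mxP => j k; rewrite (ord1 j); apply: near_eq_derivable (nH k) _.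
  by apply: diff_derivable; exact (smooth_differentiable (sch k) eu).
have E : partial i (mean_curvature (F e)) u =
    - c *: row i ('J (F e) u *m shape (W e) (P e) (F e) u).
  apply/rowP => k.
  transitivity (partial i (fun z => c * normal_part (P e) (F e) z 0 k) u).
    rewrite (near_eq_partial i (nH k)) /partial (derive_mx dH).
    exact: mxE.
  rewrite (vf_partial (freeJ Ae) _ _ eu) [RHS]mxE [X in _ = _ * X]mxE [X in _ = _ * X]mxE.
  rewrite mulr_sumr; apply: eq_bigr => a _.
  rewrite (vfZ (W e) a c eu (sh 0 k)).
  have := congr1 (fun B : 'rV[R]_p => B 0 k)
    (vf_normal_part_rigid (TC Ae) (SL Ae) f0_gt0 (sqh_e Ae) (@sqII_le e Ae) a eu).
  have rowN (B : 'M[R]_p) : (- row a B) 0 k = - B a k by rewrite !mxE.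
  by rewrite rowN [LHS]mxE => ->; rewrite mulrN mulNr mulrN mulrCA.
rewrite /normal_derivative normal_projE E -scalemxAl -row_mul -mulmxA (shape_tproj (TC Ae) eu).
exact: subrr.
Qed.

Section Point.
Variable x0 : M.

Lemma flat_proj_constant : exists G, forall e u, A e -> codom_of e u ->
  flat_proj (W e) (P e) (F e) u = G.
Proof.
apply: (constant_field x0) => [e e' u Ae Ae' eu e'u|e Ae|e u a Ae eu].
- exact: (flat_proj_overlap atlas imm Ae Ae' eu e'u).
- exact (smooth_flat_proj (TC Ae)).
- exact (vf_flat_proj (TC Ae) (SL Ae) f0_gt0 (sqh_e Ae) (@sqII_le e Ae) a eu).
Qed.

Lemma round_proj_constant : exists Pi, forall e u, A e -> codom_of e u ->
  round_proj (P e) (F e) f0 u = Pi.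
Proof.
apply: (constant_field x0) => [e e' u Ae Ae' eu e'u|e Ae|e u a Ae eu].
- exact: (round_proj_overlap atlas imm f0 Ae Ae' eu e'u).
- have oU := tc_open (TC Ae); have sh := smooth_normal_part (TC Ae).
  apply: (smooth_mxD oU (tc_smooth_proj (TC Ae))) => i j.
  apply: (eq_smooth oU (f := fun z => f0^-1 * ((normal_part (P e) (F e) z)^T *m normal_part (P e) (F e) z) i j)).
    by move=> z _; rewrite [RHS]mxE.
  apply: (smoothM oU); first exact: smooth_cst.
  exact (smooth_mxM oU (smooth_mxT sh) sh i j).
- exact (vf_round_proj (TC Ae) (SL Ae) f0_gt0 (sqh_e Ae) (@sqII_le e Ae) a eu).
Qed.

Lemma critical_edot w q : (forall x, edot (psi q) w <= edot (psi x) w) ->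
  forall e, A e -> dom e q -> P e (coords e q) *m w^T = 0.
Proof.
move=> qmin e Ae eq.
have [D0 _] := local_min_chart atlas imm Ae eq (chart_smooth_edot atlas imm w)
  (filterS (fun y _ => qmin y) filterT).
apply/colP => a; rewrite [RHS]mxE -(vf_edot_map (TC Ae) a w (codom_coords eq)).
exact: D0.
Qed.

(* The Euclidean factor is trivial: a critical point of [<psi, w>] for [w] in the range of
   the constant projection [G <= P] forces [w = 0]. *)
Lemma flat_proj_eq0 e u : A e -> codom_of e u -> flat_proj (W e) (P e) (F e) u = 0.
Proof.
have [G GE] := flat_proj_constant.
have [e0 Ae0 e0x] := cover x0; have u0 := codom_coords e0x.
have GT : G^T = G by rewrite -(GE e0 _ Ae0 u0) (flat_proj_sym (TC Ae0) u0).
have psiG x : exists2 h, psi x *m G = psi x - h & edot h h = f0.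
  have [e' Ae' ex] := cover x; have eu := codom_coords ex.
  exists (normal_part (P e') (F e') (coords e' x)); last exact: sqhE eu.
  rewrite -(GE e' _ Ae' eu); have := map_flat_proj (TC Ae') (sqh_e Ae') eu.
  by rewrite /= (param_coords atlas Ae' ex).
have crit w : (exists q, forall x, edot (psi q) (w *m G) <= edot (psi x) (w *m G)) ->
    w *m G = 0.
  move=> [q qmin]; have [e' Ae' eq] := cover q; have eu := codom_coords eq.
  have := critical_edot qmin Ae' eq.
  rewrite trmx_mul GT mulmxA -{1}(GE e' _ Ae' eu) (tproj_flat_proj (TC Ae') eu) (GE e' _ Ae' eu).
  by move=> Gw; apply: trmx_inj; rewrite trmx_mul GT Gw trmx0.
(* Expanding [0 <= |h - v|^2] bounds [<h, v>] by [K]; as [psi G = psi - h], the height exceeds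
   [<psi, v G>] by at most [K]. Hence [<psi, v G>] attains its minimum and [v G = 0]. *)
pose K := f0 + edot v v.
have le_edot h : edot h h = f0 -> edot h v <= K.
  move=> hf; have := edot_ge0 (h - v); rewrite edotBl !edotBr hf (edotC v h) /K.
  have := edot_ge0 v; move: f0_gt0 (edot h v) (edot v v) => ? ? ? ? ?; lra.
have height_le x : edot (psi x) v <= edot (psi x) (v *m G) + K.
  have [h hG hf] := psiG x; rewrite -{1}GT -edot_mulmx hG edotBl.
  by have := le_edot h hf; move: (edot h v) => ? ?; lra.
have vG : v *m G = 0.
  apply: crit; apply: (proper_min atlas imm infty x0 _ height_le).
  exact: (chart_smooth_continuous atlas (chart_smooth_edot atlas imm _)).
(* The height is now bounded, so [M] is one of its compact sublevel sets and every [<psi, w G>]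
   attains its minimum. *)
have heightK x : edot (psi x) v <= K by have := height_le x; rewrite vG edot0r add0r.
move=> Ae eu; rewrite (GE e u Ae eu); apply/row_matrixP => i; rewrite row0 rowE.
apply: crit; have [||x _|q _ qmin] := @compact_min R M
  (fun x => edot (psi x) (delta_mx 0 i *m G)) [set x | edot (psi x) v <= K].
- by exists x0; exact: heightK.
- exact: (sublevel_compact atlas imm infty).
- exact: (chart_smooth_continuous atlas (chart_smooth_edot atlas imm _)).
- by exists q => x; apply: qmin; exact: heightK.
Qed.

(** With [P + b = 0] the position is normal, and [c f0 = tr b = - m]. For surjectivity, take [q]
    minimizing [<psi, - y>]: there [y] is orthogonal to the tangent space, and lying in the range of
    [round_proj] it is a multiple of [psi q]. *)
Lemma range_sphere : exists Pi : 'M[R]_p, [/\ Pi^T = Pi, Pi *m Pi = Pi,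
  \tr Pi = m.+1%:R, (0 < m)%N /\ f0 = - m%:R / c &
  range psi = [set y | y *m Pi = y /\ edot y y = f0]].
Proof.
have [Pi PiE] := round_proj_constant.
have [e0 Ae0 e0x] := cover x0; have u0 := codom_coords e0x.
have sq0 := sqh_e Ae0.
have hx e u : A e -> codom_of e u -> normal_part (P e) (F e) u = psi (param e u).
  move=> Ae eu; have := map_flat_proj (TC Ae) (sqh_e Ae) eu.
  by rewrite (flat_proj_eq0 Ae eu) mulmx0 => /eqP; rewrite eq_sym subr_eq0 => /eqP.
have hx' e x : A e -> dom e x -> normal_part (P e) (F e) (coords e x) = psi x.
  by move=> Ae ex; rewrite (hx _ _ Ae (codom_coords ex)) (param_coords atlas Ae ex).
have psi_norm x : edot (psi x) (psi x) = f0.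
  have [e Ae ex] := cover x.
  by rewrite -(sqhE Ae (codom_coords ex)) /normal_sqnorm (hx' e x Ae ex).
have mE : c * f0 = - m%:R.
  rewrite -(sq0 _ u0) -(mxtrace_shape (TC Ae0) (SL Ae0) u0) -(tc_mxtrace_proj (TC Ae0) u0).
  apply/eqP; rewrite -addr_eq0 addrC -mxtraceD; apply/eqP.
  have := flat_proj_eq0 Ae0 u0; rewrite /flat_proj => ->; exact: mxtrace0.
have m0 : (0 < m)%N.
  rewrite lt0n; apply/eqP => m_eq0; move/eqP: mE; rewrite m_eq0 oppr0 mulf_eq0.
  by rewrite (lt_eqF c0) (gt_eqF f0_gt0).
have PiT : Pi^T = Pi by rewrite -(PiE e0 _ Ae0 u0) (round_proj_sym (TC Ae0)).
exists Pi; split=> //.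
- by rewrite -(PiE e0 _ Ae0 u0) (round_proj_idem (TC Ae0) f0_gt0 sq0 u0).
- by rewrite -(PiE e0 _ Ae0 u0) (mxtrace_round_proj (TC Ae0) f0_gt0 sq0 u0).
- by split=> //; rewrite -mE mulrC mulKf// lt_eqF.
apply/seteqP; split=> [_ [x _ <-]|y [yPi yf0]].
  split=> //; have [e Ae ex] := cover x; have eu := codom_coords ex.
  rewrite -(PiE e _ Ae eu) -(hx' e x Ae ex).
  exact (normal_part_round_proj (TC Ae) f0_gt0 (sqh_e Ae) eu).
have y0 : edot y y != 0 by rewrite yf0 gt_eqF.
have [q qmin] : exists q, forall x, edot (psi q) (- y) <= edot (psi x) (- y).
  pose K := f0 + edot v v.
  have heightK x : edot (psi x) v <= K.
    have := edot_ge0 (psi x - v); rewrite edotBl !edotBr psi_norm (edotC v) /K.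
    have := edot_ge0 v; move: f0_gt0 (edot (psi x) v) (edot v v) => ? ? ? ? ?; lra.
  apply: (proper_min (C := K + (f0 + edot y y)) atlas imm infty x0) => [|x].
    exact: (chart_smooth_continuous atlas (chart_smooth_edot atlas imm _)).
  have := edot_ge0 (psi x - y); rewrite edotBl !edotBr psi_norm (edotC y) edotNr.
  have := heightK x; have := edot_ge0 y;
  move: f0_gt0 K {heightK} (edot (psi x) v) (edot (psi x) y) (edot y y).
  by move=> ? ? ? ? ? ? ? ?; lra.
have [e Ae eq] := cover q; have eu := codom_coords eq.
pose t := edot (psi q) y / f0.
have yt : y = t *: psi q.
  have := critical_edot qmin Ae eq; rewrite linearN mulmxN => /eqP; rewrite oppr_eq0 => /eqP Py.
  apply: trmx_inj; rewrite -yPi trmx_mul PiT -(PiE e _ Ae eu) /round_proj mulmxDl Py add0r.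
  rewrite (hx' e q Ae eq) -scalemxAl -mulmxA [psi q *m _]mx11_scalar -edotE.
  by rewrite mul_mx_scalar scalerA linearZ /= mulrC.
have t2 : t ^+ 2 = 1.
  have : edot y y = t ^+ 2 * f0 by rewrite {1 2}yt edotZl edotZr psi_norm expr2 mulrA.
  by rewrite yf0 => E; apply: (@mulIf _ f0); [rewrite gt_eqF|rewrite mul1r -E].
have := t2; move/eqP; rewrite sqrf_eq1 => /orP[/eqP t1|/eqP t1].
  by exists q => //; rewrite yt t1 scale1r.
(* If [y = - psi q], the maximum of [<psi, y>] is [- f0], its least possible value on the sphere.
   Then [psi] is constantly [- y], so [P = 0], against [tr P = m > 0]. *)
exfalso; have psi_y x : psi x = - y.
  apply/eqP; rewrite -subr_eq0 opprK -edot_eq0; apply/eqP/le_anti; rewrite edot_ge0 andbT.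
  have yq : edot (psi q) y = - f0 by rewrite yt t1 scaleN1r edotNr psi_norm.
  rewrite edotDl !edotDr psi_norm yf0 (edotC y).
  have := qmin x; rewrite !edotNr yq; move: (edot (psi x) y) => s; lra.
have Px a : row a (P e0 (coords e0 x0)) = 0.
  rewrite -(tc_vf_map (TC Ae0) a u0) -(vf_mx_cst (W e0) a (- y) (coords e0 x0)).
  by congr (vf_mx _ _ _ _); apply/funext => z; exact: psi_y.
have P0 : P e0 (coords e0 x0) = 0 by apply/row_matrixP => a; rewrite row0 Px.
have := tc_mxtrace_proj (TC Ae0) u0; rewrite P0 mxtrace0 => /eqP.
by rewrite eq_sym pnatr_eq0 -leqn0 leqNgt m0.
Qed.

End Point.

End Positive.

End Classification.

Theorem corollary8p13 (R : realType) (m n : nat) (hmn : (m <= n)%N)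
    (M : topologicalType) (A : set (chart R M m)) (psi : M -> 'rV[R]_n.+1)
    (c : R) (v : 'rV[R]_n.+1)
    (hM : smooth_manifold A)
    (hconn : connected [set: M])
    (himm : immersion A psi)
    (hcomplete : complete_induced A psi)
    (hc : c < 0)
    (hsol : soliton A psi c)
    (hv : enorm v = 1)
    (hinfty : edot (psi x) v @[x --> at_infinity M] --> +oo)
    (hII : locally_everywhere A psi (fun F u => second_ff_sqnorm F u <= - c)) :
  (minimal A psi \/
   (locally_everywhere A psi (fun F u => second_ff_sqnorm F u = - c) /\
    parallel_mean_curvature A psi)) /\
  (totally_geodesic A psi \/
   exists k : nat, [/\ (1 <= k)%N, (k <= m)%N &
     is_sphere_product k m (Num.sqrt (- k%:R / c)) (range psi)]).
Proof.
have [_ _ atlas] := hM.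
have [k kE] := normal_sqnorm_constant atlas himm hconn hc hsol hinfty hII.
have [noM|[x0 _]] : (forall x : M, False) \/ (exists x : M, True).
  by have [?|nx] := pselect (exists x : M, True); [right|left => x; apply: nx; exists x].
  split; left; first by move=> e _ u [x _ _]; case: (noM x).
  by move=> e _ u [x _ _]; case: (noM x).
have k0 : 0 <= k.
  have [e Ae ex] : exists2 e, A e & dom e x0 by case: atlas => _ + _; exact.
  by rewrite -(kE e _ Ae (codom_coords ex)); exact: edot_ge0.
move: k0; rewrite le_eqVlt => /orP[/eqP k_eq0|k_gt0].
  have h0 e u : A e -> codom_of e u -> normal_part (tproj (psi \o param e)) (psi \o param e) u = 0.
    by move=> Ae eu; apply/eqP; rewrite -edot_eq0 k_eq0; apply/eqP; exact: kE.
  split; left.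
    move=> e Ae u eu; rewrite (mean_curvature_chart hsol Ae eu) h0// scaler0.
    by [].
  (* [minimal_empty] excludes [m > 0]; when [m = 0] there are no indices and [II] vanishes
     vacuously. *)
  have [m0|m0] := posnP m; last first.
    by case: (minimal_empty atlas himm hc hsol hinfty x0 m0) => e u Ae; exact: h0.
  by move=> e _ u _ i; exfalso; move: (i : nat) (ltn_ord i) => ?; rewrite m0.
have [Pi [PiT PiPi trPi [m0 kE'] rangeE]] :=
  range_sphere atlas himm hconn hc hsol hinfty hII k_gt0 kE x0.
split; right.
  split; first exact: (second_ff_sqnorm_rigid atlas himm hsol hII k_gt0 kE).
  exact: (parallel_rigid atlas himm hsol hII k_gt0 kE).
(* Only [k = m] survives: properness of the height has removed the Euclidean factor. *)
exists m; split=> //.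
rewrite -kE' rangeE; exact: sphere_productE.
Qed.
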